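(* Let $h\colon\mathbb{R}^2\to\mathbb{R}$ be a continuous function satisfying $(h_1)$–$(h_6)$ (listed in the context). Let $\alpha\in\mathbb{Q}$ and let $(x^0,x^1)$ be a neighboring pair of $\mathcal{M}_\alpha^{\mathrm{per}}$, where $x^0=(x^0_i)_{i\in\mathbb{Z}}$, $x^1=(x^1_i)_{i\in\mathbb{Z}}$. Assume that $$I^+_\alpha(x^0,x^1)\neq (x^0_0,x^1_0)\quad\text{and}\quad I^-_\alpha(x^0,x^1)\neq (x^0_0,x^1_0),$$ where $(x^0_0,x^1_0)$ denotes the open interval of real numbers. For $j\in\mathbb{Z}$ put $x^j:=x^0$ if $j$ is even and $x^j:=x^1$ if $j$ is odd. Then for every sequence $\epsilon=(\epsilon_i)_{i\in\mathbb{Z}}$ of positive real numbers there is a sequence $m=(m_i)_{i\in\mathbb{Z}}$ of positive integers such that for every sequence of integers $k=(k_i)_{i\in\mathbb{Z}}$ with $k_{i+1}-k_i\ge m_i$ for all $i\in\mathbb{Z}$, there is a stationary configuration $x=(x_i)_{i\in\mathbb{Z}}$ for $h$ satisfying: 1. $x^0_i<x_i<x^1_i$ for all $i\in\mathbb{Z}$; 2. for every $j\in\mathbb{Z}$: $|x_i-x^{2j}_i|\le\epsilon_{2j}$ for all integers $i\in[k_{4j},k_{4j+1}]$, and $|x_i-x^{2j+1}_i|\le\epsilon_{2j+1}$ for all integers $i\in[k_{4j+2},k_{4j+3}]$.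
   Context: A configuration is an element $x=(x_i)_{i\in\mathbb{Z}}\in\mathbb{R}^{\mathbb{Z}}$. For a finite sequence write $h(x_{n_0},\dots,x_{n_1})=\sum_{i=n_0}^{n_1-1}h(x_i,x_{i+1})$. A finite sequence $(x_i)_{i=n}^m$ is minimal if for all $n\le n_0<n_1\le m$ and all real $(y_i)_{i=n_0}^{n_1}$ with $y_{n_0}=x_{n_0}$, $y_{n_1}=x_{n_1}$ one has $h(x_{n_0},\dots,x_{n_1})\le h(y_{n_0},\dots,y_{n_1})$. A configuration is minimal if all its finite segments $(x_i)_{i=n}^m$, $n<m$, are minimal. Assumptions on $h$: $(h_1)$ $h(\xi,\eta)=h(\xi+1,\eta+1)$ for all $(\xi,\eta)\in\mathbb{R}^2$. $(h_2)$ $h(\xi,\xi+\eta)\to\infty$ as $|\eta|\to\infty$, uniformly in $\xi$. $(h_3)$ If $\underline\xi<\bar\xi$ and $\underline\eta<\bar\eta$, then $h(\underline\xi,\underline\eta)+h(\bar\xi,\bar\eta)<h(\underline\xi,\bar\eta)+h(\bar\xi,\underline\eta)$. $(h_4)$ If $(x,x_0,x_1)$ and $(\xi,x_0,\xi_1)$ are minimal and $(x,x_0,x_1)\ne(\xi,x_0,\xi_1)$, then $(x-\xi)(x_1-\xi_1)<0$. $(h_5)$ There is a positive continuous function $p$ on $\mathbb{R}^2$ with $h(\xi,\eta')+h(\eta,\xi')-h(\xi,\xi')-h(\eta,\eta')>\int_\xi^\eta\int_{\xi'}^{\eta'}p$ whenever $\xi<\eta$ and $\xi'<\eta'$. $(h_6)$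 There is $\theta>0$ such that $\xi\mapsto\theta\xi^2/2-h(\xi,\xi')$ is convex for every $\xi'$ and $\xi'\mapsto\theta\xi'^2/2-h(\xi,\xi')$ is convex for every $\xi$. A configuration $x$ is stationary for $h$ if $\partial_2h(x_{i-1},x_i)+\partial_1h(x_i,x_{i+1})=0$ for all $i\in\mathbb{Z}$, where $\partial_1,\partial_2$ are the partial derivatives in the first and second variable; if $h$ is not differentiable they are understood as left-sided derivatives (which exist by $(h_6)$). The rotation number of $x$ is $\alpha(x)=\lim_{i\to\infty}x_i/i=\lim_{i\to-\infty}x_i/i$ when both limits exist and agree. $\mathcal{M}_\alpha$ is the set of minimal configurations with rotation number $\alpha$. For $\alpha=p/q\in\mathbb{Q}$ in lowest terms ($q\in\mathbb{N}$, $p\in\mathbb{Z}$), $\mathcal{M}_\alpha^{\mathrm{per}}$ is the set of $x\in\mathcal{M}_\alpha$ that are $(q,p)$-periodic, i.e. $x_{i+q}=x_i+p$ for all $i\in\mathbb{Z}$. For configurations, $a<b$ means $a_i<b_i$ for all $i$. A neighboring pair of a set $A\subset\mathbb{R}^{\mathbb{Z}}$ is a pair $(a,b)$ with $a,b\in A$, $a<b$, such that no $x\in A$ satisfies $a<x<b$. For a neighboring pair $(x^0,x^1)$ of $\mathcal{M}_\alpha^{\mathrm{per}}$: $\mathcal{M}_\alpha^+(x^0,x^1)=\{x\in\mathcal{M}_\alpha: |x_i-x^0_i|\to0\ (i\to-\infty),\ |x_i-x^1_i|\to0\ (i\to\infty)\}$, $\mathcal{M}_\alpha^-(x^0,x^1)=\{x\in\mathcal{M}_\alpha: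 |x_i-x^0_i|\to0\ (i\to\infty),\ |x_i-x^1_i|\to0\ (i\to-\infty)\}$, $I_\alpha^\pm(x^0,x^1)=\{x_0\in\mathbb{R}: x=(x_i)_{i\in\mathbb{Z}}\in\mathcal{M}_\alpha^\pm(x^0,x^1)\}$. *)

(* Defs.v *)
From mathcomp Require Import all_boot all_order all_algebra.
From mathcomp Require Import all_classical all_reals all_analysis.

Set Implicit Arguments.
Unset Strict Implicit.
Unset Printing Implicit Defensive.

Import Order.TTheory GRing.Theory Num.Theory.
Import numFieldNormedType.Exports.

Local Open Scope classical_set_scope.
Local Open Scope ring_scope.

Definition configuration (R : realType) : Type := int -> R.

Section Definitions.
Variables (R : realType) (h : R * R -> R).
Implicit Types (x y a b : configuration R) (i n m : int).

(** Used only for [n0 <= n1], where it is the sum over [n0 <= i < n1]. *)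
Definition action (x : configuration R) (n0 n1 : int) : R :=
  \sum_(k < `|n1 - n0|%N) h (x (n0 + k%:Z), x (n0 + k%:Z + 1)).

(** A finite sequence with indices in [n, m] is represented by any
    configuration extending it: only its values on [n, m] matter here. *)
Definition minimal_segment (n m : int) (x : configuration R) : Prop :=
  forall (n0 n1 : int) (y : configuration R),
    n <= n0 -> n0 < n1 -> n1 <= m -> y n0 = x n0 -> y n1 = x n1 ->
    action x n0 n1 <= action y n0 n1.

Definition minimal (x : configuration R) : Prop :=
  forall n m, n < m -> minimal_segment n m x.

Definition diagonal_periodic : Prop :=
  forall xi eta : R, h (xi, eta) = h (xi + 1, eta + 1).

Definition uniformly_coercive : Prop :=
  forall M : R, exists B : R, forall xi eta : R,
    B <= `|eta| -> M <= h (xi, xi + eta).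

Definition strict_twist : Prop :=
  forall xi xi' eta eta' : R, xi < xi' -> eta < eta' ->
    h (xi, eta) + h (xi', eta') < h (xi, eta') + h (xi', eta).

Definition minimal_triples_cross : Prop :=
  forall x y : configuration R,
    minimal_segment (-1) 1 x -> minimal_segment (-1) 1 y -> x 0 = y 0 ->
    (x (-1), x 0, x 1) <> (y (-1), y 0, y 1) ->
    (x (-1) - y (-1)) * (x 1 - y 1) < 0.

Definition integral_twist : Prop :=
  exists p : R * R -> R,
    [/\ continuous p, (forall z, 0 < p z) &
        forall xi eta xi' eta' : R, xi < eta -> xi' < eta' ->
          \int[lebesgue_measure]_(s in `[xi, eta])
             \int[lebesgue_measure]_(t in `[xi', eta']) p (s, t)
          < h (xi, eta') + h (eta, xi') - h (xi, xi') - h (eta, eta')].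

Definition semiconcave_in_each_variable : Prop :=
  exists2 theta : R, 0 < theta &
    (forall xi' : R,
       convex_function setT
         ((fun xi => theta * xi ^+ 2 / 2 - h (xi, xi')) : R^o -> R^o)) /\
    (forall xi : R,
       convex_function setT
         ((fun xi' => theta * xi' ^+ 2 / 2 - h (xi, xi')) : R^o -> R^o)).

Definition is_left_derive (f : R -> R) (t l : R) : Prop :=
  (f s - f t) / (s - t) @[s --> t^'-] --> l.

(** The derivatives are left-sided throughout: where the partial derivatives
    of [h] exist, the left-sided ones coincide with them. *)
Definition stationary (x : configuration R) : Prop :=
  forall i, exists d2 d1 : R,
    [/\ is_left_derive (fun s => h (x (i - 1), s)) (x i) d2,
        is_left_derive (fun s => h (s, x (i + 1))) (x i) d1 &
        d2 + d1 = 0].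

Definition has_rotation_number (x : configuration R) (alpha : R) : Prop :=
  (x n%:Z / n%:R @[n --> \oo] --> alpha) /\
  (x (- n%:Z) / - n%:R @[n --> \oo] --> alpha).

Definition minimals (alpha : R) : set (configuration R) :=
  [set x | minimal x /\ has_rotation_number x alpha].

Definition periodic_minimals (alpha : rat) : set (configuration R) :=
  [set x | minimals (ratr alpha) x /\
           forall i, x (i + denq alpha) = x i + (numq alpha)%:~R].

Definition config_lt (a b : configuration R) : Prop := forall i, a i < b i.

Definition neighboring_pair (A : set (configuration R))
    (a b : configuration R) : Prop :=
  [/\ A a, A b, config_lt a b &
      ~ exists x, [/\ A x, config_lt a x & config_lt x b]].

Definition asymptotic_pinfty (x a : configuration R) : Prop :=
  `|x n%:Z - a n%:Z| @[n --> \oo] --> (0 : R).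

Definition asymptotic_ninfty (x a : configuration R) : Prop :=
  `|x (- n%:Z) - a (- n%:Z)| @[n --> \oo] --> (0 : R).

Definition heteroclinic_plus (alpha : rat) (x0 x1 : configuration R) :
    set (configuration R) :=
  [set x | [/\ minimals (ratr alpha) x,
               asymptotic_ninfty x x0 & asymptotic_pinfty x x1]].

Definition heteroclinic_minus (alpha : rat) (x0 x1 : configuration R) :
    set (configuration R) :=
  [set x | [/\ minimals (ratr alpha) x,
               asymptotic_pinfty x x0 & asymptotic_ninfty x x1]].

Definition I_plus (alpha : rat) (x0 x1 : configuration R) : set R :=
  [set x 0 | x in heteroclinic_plus alpha x0 x1].

Definition I_minus (alpha : rat) (x0 x1 : configuration R) : set R :=
  [set x 0 | x in heteroclinic_minus alpha x0 x1].

End Definitions.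

Definition alternating_pair (R : realType) (x0 x1 : configuration R) (j : int) :
    configuration R :=
  if (2 %| j)%Z then x0 else x1.

(* Main.v *)
Require Import Defs.
From mathcomp Require Import all_boot all_order all_algebra.
From mathcomp Require Import all_classical all_reals all_analysis.
From mathcomp Require Import zify ring lra.

Set Implicit Arguments.
Unset Strict Implicit.
Unset Printing Implicit Defensive.

Import Order.TTheory GRing.Theory Num.Theory.
Import numFieldNormedType.Exports.

Local Open Scope classical_set_scope.
Local Open Scope ring_scope.

(** Let [u = x0] and [v = x1] be the neighboring periodic configurations, of
    type (q, p), and let [g (s, t)] be the least action over one period of a
    configuration between [u] and [v] that starts at [s] and ends at [t + p],
    normalized so that [u] costs nothing. Then [g] satisfies the Monge
    inequality, and [g (s, s) > 0] strictly between the poles [a = u 0] and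
    [b = v 0] because the pair is neighboring. Cutting the largest entry out of
    a closed chain bounds its cost below by the sum of the [g (s, s)]. Hence
    chains of bounded cost spend a bounded time away from the poles, and loops
    at a pole that move away from it have a cost bounded away from [0].

    The hypothesis on I^+ (resp. I^-) yields a value [al] in (a, b) not taken at
    0 by a minimal heteroclinic chain. By compactness, every transition through
    [al] costs a definite amount more than the infimum. We minimize under the
    constraints of staying close to the prescribed pole on each block and of
    not having passed (resp. having passed) [al] at a time soon after (resp.
    before) the blocks. If the blocks are far apart, moving a nearly optimal
    transition into the free time shows that no constraint is active, since an
    active constraint would cost either an additional loop or a transition
    through [al]. The minimizer is thus a local minimizer. By (h5) and (h6) it
    does not touch [u] or [v], and by (h6) it is stationary. *)

(** * Pointwise topology and compactness *)

Section PointwiseTopology.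
Context {R : realType}.
Notation T := {ptws int -> R}.

(** The action over all times need not converge, and [eps] has no positive lower bound, so no global
    functional is minimized: minimality is tested on finite windows, and every constant carries the
    index of its block or transition. This is why [m i] depends only on data near [i]. The place of
    a transition has to be prescribed entry by entry, so that the admissible set is a product of
    compact sets and a single entry can be varied. One bound before and one after the free time
    suffice: a nearly optimal transition that is away from one pole at some time is close to the
    other pole a bounded time later, or was so a bounded time earlier. With one cost per period the
    poles are constants and the problem is autonomous, so that a transition can be moved anywhere.
    The price is the way back, by gluing minimizing blocks, and local minimality has to be recovered
    at times that are not multiples of [q]. The hypothesis only says that I^+ and I^- differ from
    the interval. A value is missing because both are contained in it, which takes an order argument
    for minimal heteroclinics. *)

Lemma entry_continuous (i : int) : continuous (fun x : T => x i : R).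
Proof. exact: (@proj_continuous int (fun=> R : topologicalType) i). Qed.

Lemma pair_continuous (X : topologicalType) (f : R * R -> R) (c1 c2 : X -> R) :
  continuous f -> continuous c1 -> continuous c2 ->
  continuous (fun x => f (c1 x, c2 x)).
Proof.
move=> cf cc1 cc2 x.
apply: (@continuous_comp _ _ _ (fun y => (c1 y, c2 y)) f x); last exact: cf.
exact: cvg_pair (cc1 x) (cc2 x).
Qed.

Lemma eval2_continuous (f : R * R -> R) (i j : int) :
  continuous f -> continuous (fun x : T => f (x i, x j)).
Proof.
by move=> cf; apply: pair_continuous => //; exact: entry_continuous.
Qed.

Lemma sum_continuous (X : topologicalType) (n : nat) (F : nat -> X -> R) :
  (forall i, continuous (F i)) -> continuous (fun x => \sum_(i < n) F i x).
Proof.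
move=> cF; elim: n => [|n IH].
  under eq_fun do rewrite big_ord0; exact: cst_continuous.
under eq_fun do rewrite big_ord_recr /=.
by move=> x; exact: (cvgD (IH x) (cF n x)).
Qed.

Lemma closed_ler (X : topologicalType) (f g : X -> R) :
  continuous f -> continuous g -> closed [set x | f x <= g x].
Proof.
move=> cf cg.
have -> : [set x | f x <= g x] = (fun x => g x - f x) @^-1` [set y | 0 <= y].
  by apply/seteqP; split => x /=; rewrite subr_ge0.
apply: preimage_closed; last exact: closed_ge.
move=> x _; exact: (cvgB (cg x) (cf x)).
Qed.

Lemma closed_eqr (X : topologicalType) (f g : X -> R) :
  continuous f -> continuous g -> closed [set x | f x = g x].
Proof.
move=> cf cg.
have -> : [set x | f x = g x] = [set x | f x <= g x] `&` [set x | g x <= f x].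
  apply/seteqP; split => x /= => [->|[fg gf]]; first by rewrite lexx.
  by apply/eqP; rewrite eq_le fg gf.
by apply: closedI; exact: closed_ler.
Qed.

Lemma near_closed (i : int) (w d : R) : closed [set x : T | `|x i - w| <= d].
Proof.
apply: closed_ler; last exact: cst_continuous.
move=> x; exact: (cvg_norm (cvgB (@entry_continuous i x) (@cvg_cst _ w _ _ _))).
Qed.

Lemma ge0_inv_eventually (e : R) : 0 < e ->
  exists k0 : nat, forall k : nat, (k0 <= k)%N -> k.+1%:R^-1 <= e.
Proof.
move=> e0; exists (Num.truncn e^-1) => k ke.
rewrite -[leRHS]invrK lef_pV2 ?posrE ?invr_gt0//.
by apply: ltW; apply: lt_le_trans (truncnS_gt _) _; rewrite ler_nat ltnS.
Qed.

Lemma box_compact (lo hi : int -> R) :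
  compact [set x : T | forall i, lo i <= x i <= hi i].
Proof.
have := @tychonoff int (fun=> R) (fun i => `[lo i, hi i]%classic)
  (fun i => @segment_compact R (lo i) (hi i)).
congr (compact _); apply/seteqP; split => x /= H i; move: (H i);
  by rewrite in_itv.
Qed.

(** A cluster point replaces the limit of a subsequence: the compactness arguments below only pass
    closed conditions to the limit. *)
Lemma compact_seq_cluster (X : topologicalType) (K : set X) (x_ : nat -> X) :
  compact K -> (forall n, K (x_ n)) ->
  exists y, K y /\
    forall C, closed C -> (exists k0, forall k, (k0 <= k)%N -> C (x_ k)) -> C y.
Proof.
move=> cK xK.
have [|y [Ky ycl]] := cK (x_ @ \oo) _.
  by exists 0%N => //= k _; exact: xK.
exists y; split => // C cC [k0 Ck]; apply: cC.
by move=> U Uy; apply: ycl => //; exists k0.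
Qed.

Lemma uniform_on_square (f : R * R -> R) (A B : R) (e : R) :
  continuous f -> 0 < e ->
  exists2 d, 0 < d & forall s t s' t' : R,
    A <= s <= B -> A <= t <= B -> A <= s' <= B -> A <= t' <= B ->
    `|s - s'| <= d -> `|t - t'| <= d -> `|f (s, t) - f (s', t')| <= e.
Proof.
move=> cf e0; apply: contrapT => nd.
(* The four numbers are stored as the entries 0 to 3 of one configuration, so that the compactness
   of the box applies to them. *)
have H (k : nat) : exists z : T, (forall i, A <= z i <= B) /\
   [/\ `|z 0 - z 2| <= k.+1%:R^-1, `|z 1 - z 3| <= k.+1%:R^-1 &
     e <= `|f (z 0, z 1) - f (z 2, z 3)|].
  apply: contrapT => nz; apply: nd; exists k.+1%:R^-1; first by rewrite invr_gt0.
  move=> s t s' t' sA tA sA' tA' ss tt; rewrite leNgt; apply/negP => fe.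
  apply: nz; exists (fun i : int => if i == 0 then s else if i == 1 then t else
     if i == 2 then s' else t'); split.
    by move=> i; case: ifP => // _; case: ifP => // _; case: ifP.
  by split => //=; exact: ltW.
have [z_ zP] := choice H.
have [y [Ky yP]] := compact_seq_cluster (@box_compact (fun=> A) (fun=> B))
  (fun n => (zP n).1).
have cdist (i j : int) : continuous (fun z : T => `|z i - z j|).
  by move=> z; exact: (cvg_norm (cvgB (@entry_continuous i z) (@entry_continuous j z))).
have small (i j : int) : (forall k, `|z_ k i - z_ k j| <= k.+1%:R^-1) -> y i = y j.
  move=> Hij; apply/eqP; rewrite -subr_eq0 -normr_le0; apply/ler_addgt0Pr => r r0.
  rewrite add0r.
  apply: (yP [set z | `|z i - z j| <= r]).
    by apply: closed_ler; [exact: cdist|exact: cst_continuous].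
  have [k0 k0P] := ge0_inv_eventually r0.
  by exists k0 => k kr /=; apply: le_trans (Hij k) (k0P _ kr).
have y02 : y 0 = y 2 by apply: small => k; case: (zP k) => _ [].
have y13 : y 1 = y 3 by apply: small => k; case: (zP k) => _ [].
have : e <= `|f (y 0, y 1) - f (y 2, y 3)|.
  apply: (yP [set z | e <= `|f (z 0, z 1) - f (z 2, z 3)|]).
    apply: closed_ler; first exact: cst_continuous.
    have c01 := @eval2_continuous f 0 1 cf; have c23 := @eval2_continuous f 2 3 cf.
    have cB : continuous (fun z : T => f (z 0, z 1) - f (z 2, z 3)).
      by move=> z; exact: (cvgB (c01 z) (c23 z)).
    by move=> z; exact: (cvg_norm (cB z)).
  by exists 0%N => k _; case: (zP k) => _ [].
by rewrite y02 y13 subrr normr0 leNgt e0.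
Qed.

End PointwiseTopology.

(** * Additivity, translation and continuity of the action *)

Section Action.
Context {R : realType}.
Implicit Types (f : R * R -> R) (x y : int -> R) (m n : int).

Lemma action_nn f x m : action f x m m = 0.
Proof. by rewrite /action subrr big_ord0. Qed.

Lemma action_addn f x m (N : nat) :
  action f x m (m + N%:Z) = \sum_(k < N) f (x (m + k%:Z), x (m + k%:Z + 1)).
Proof. by rewrite /action (_ : m + N%:Z - m = N%:Z) //; lia. Qed.

Lemma action1 f x m : action f x m (m + 1) = f (x m, x (m + 1)).
Proof. by rewrite (action_addn f x m 1) big_ord1 addr0. Qed.

Lemma int_leP m n : m <= n -> exists N : nat, n = m + N%:Z.
Proof. by move=> mn; exists (absz (n - m)); lia. Qed.

Lemma action_cat f x m n r : m <= n -> n <= r ->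
  action f x m r = action f x m n + action f x n r.
Proof.
move=> /int_leP[N ->] /int_leP[M ->].
rewrite (action_addn f x (m + N%:Z) M) (action_addn f x m N).
rewrite -addrA -PoszD action_addn big_split_ord /=; congr (_ + _).
by apply: eq_bigr => i _; rewrite PoszD !addrA.
Qed.

Lemma action_recl f x m n : m < n ->
  action f x m n = f (x m, x (m + 1)) + action f x (m + 1) n.
Proof. by move=> mn; rewrite (@action_cat _ _ m (m + 1)) ?action1//; lia. Qed.

Lemma action_recr f x m n : m < n ->
  action f x m n = action f x m (n - 1) + f (x (n - 1), x n).
Proof.
move=> mn; rewrite (@action_cat _ _ m (n - 1)); [|lia|lia].
by have := action1 f x (n - 1); rewrite subrK => ->.
Qed.

Lemma action_eq f x y m n : m <= n -> (forall i, m <= i <= n -> x i = y i) ->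
  action f x m n = action f y m n.
Proof.
move=> /int_leP[N ->] xy; rewrite !action_addn; apply: eq_bigr => i _.
by rewrite !xy//; have := ltn_ord i; lia.
Qed.

Lemma action_shift f x m n (j : int) :
  action f (fun i => x (i + j)) m n = action f x (m + j) (n + j).
Proof.
have E : n + j - (m + j) = n - m by lia.
rewrite /action E.
by apply: eq_bigr => -[i /= _] _; congr (f (x _, x _)); lia.
Qed.

Lemma action_continuous f m n : continuous f ->
  continuous (fun x : {ptws int -> R} => action f (x : int -> R) m n).
Proof.
move=> cf; rewrite /action.
apply: (sum_continuous (F := fun k (x : {ptws int -> R}) =>
   f (x (m + k%:Z), x (m + k%:Z + 1)))) => k.
exact: eval2_continuous.
Qed.

(** Closing a finite piece off by poles makes results on chains that end exactly at the poles
    available for arbitrary pieces, at the price of one step at each end. *)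
Definition with_tails x m n (w w' : R) : int -> R :=
  fun i => if i < m then w else if n < i then w' else x i.

Lemma action_with_tails f x m n w w' : m <= n ->
  action f (with_tails x m n w w') (m - 1) (n + 1) =
  f (w, x m) + action f x m n + f (x n, w').
Proof.
move=> mn; rewrite action_recl; last lia.
rewrite action_recr; last lia.
rewrite subrK addrK addrA; congr (_ + _ + _).
- by congr (f (_, _)); rewrite /with_tails; case: ifPn => ?; (try case: ifPn => ?) => //; lia.
- apply: action_eq => // i imn.
  by rewrite /with_tails; case: ifPn => ?; (try case: ifPn => ?) => //; lia.
- by congr (f (_, _)); rewrite /with_tails; case: ifPn => ?; (try case: ifPn => ?) => //; lia.
Qed.

End Action.

Lemma first_index (P : int -> Prop) (m n : int) : m <= n -> P n ->
  exists i : int, [/\ m <= i <= n, P i & forall j : int, m <= j < i -> ~ P j].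
Proof.
move=> /int_leP[N ->] PN.
have exP : exists k, `[< P (m + k%:Z) >] by exists N; apply/asboolP.
case: (ex_minnP exP) => k /asboolP Pk kmin; exists (m + k%:Z); split => //.
  by have := kmin N (asboolT PN); lia.
move=> j mj Pj; have := kmin (absz (j - m)).
have -> : m + `|j - m|%N%:Z = j by lia.
by move=> /(_ (asboolT Pj)); lia.
Qed.

(** * Chains with a Monge cost *)

Definition monge_on (R : realType) (g : R * R -> R) (a b : R) : Prop :=
  forall s s' t t', a <= s -> s <= s' -> s' <= b ->
    a <= t -> t <= t' -> t' <= b ->
    g (s, t) + g (s', t') <= g (s, t') + g (s', t).

(** All that the variational argument needs to know of the cost of one period. [chain_cross] is
    separate because the diagonal vanishes at both poles: the Monge bound alone does not see a chain
    that jumps from pole to pole. *)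
Record chain_cost (R : realType) (g : R * R -> R) (a b : R) : Prop := {
  chain_lt : a < b;
  chain_continuous : continuous g;
  chain_monge : monge_on g a b;
  chain_lo : g (a, a) = 0;
  chain_hi : g (b, b) = 0;
  chain_diag : forall s, a < s < b -> 0 < g (s, s);
  chain_cross : 0 < g (a, b) + g (b, a) }.

Section Chain.
Context {R : realType} (g : R * R -> R) (a b : R).
Implicit Types (s t x y z : R) (u v : int -> R) (m n i j r : int) (c : bool).

Definition chain_path u := forall i, a <= u i <= b.

(** The boolean index lets one argument serve both poles and both directions of transition; [~~ c]
    is the opposite pole. *)
Definition pole c := if c then b else a.

(** A list, unlike a chain indexed by integers, can be rotated; this brings the largest entry of a
    closed chain to the front. *)
Fixpoint walk x (l : seq R) : R :=
  if l is y :: l' then g (x, y) + walk y l' else 0.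

Lemma walk_cat x l l' : walk x (l ++ l') = walk x l + walk (last x l) l'.
Proof. by elim: l x => [|y l IH] x /=; rewrite ?add0r// IH addrA. Qed.

Lemma walk_rcons x l y : walk x (rcons l y) = walk x l + g (last x l, y).
Proof. by rewrite -cats1 walk_cat /= addr0. Qed.

Lemma action_walk u m (N : nat) :
  action g u m (m + N%:Z) = walk (u m) [seq u (m + (Posz k.+1)) | k <- iota 0 N].
Proof.
elim: N => [|N IH]; first by rewrite addr0 action_nn.
rewrite -addn1 iotaD map_cat cats1 walk_rcons add0n -IH.
rewrite action_recr; last lia.
rewrite (_ : m + _ - 1 = m + N%:Z); last lia.
congr (_ + g (_, u _)); last by rewrite addn1.
case: N {IH} => [|N]; first by rewrite addr0.
by rewrite -{2}[N.+1]addn1 iotaD map_cat cats1 last_rcons.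
Qed.

(* The Monge inequality lets one cut the largest entry out of a closed walk. *)
Lemma closed_walk x l : monge_on g a b -> (forall z, z \in x :: l -> a <= z <= b) ->
  \sum_(z <- x :: l) g (z, z) <= walk x (rcons l x).
Proof.
move=> monge; have [k] := ubnP (size l); elim: k x l => // k IH x l lk xI.
(* Rotating the closed walk changes neither side, so it may start at its maximum. *)
wlog xmax : x l lk xI / forall z, z \in l -> z <= x.
  move=> W.
  have [M Mxl Mmax] : exists2 M, M \in x :: l & forall z, z \in x :: l -> z <= M.
    elim: (l) x {W lk xI} => [|y l' IHl] x.
      by exists x; rewrite ?mem_head// => z; rewrite inE => /eqP ->.
    have [M Ml Mmax] := IHl y; have [xM|Mx] := leP x M.
      exists M; first by rewrite inE Ml orbT.
      by move=> z; rewrite inE => /predU1P[->//|/Mmax].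
    exists x; first exact: mem_head.
    move=> z; rewrite inE => /predU1P[->//|/Mmax/le_trans]; apply; exact: ltW.
  move: Mxl; rewrite inE => /predU1P[Mx|Ml].
    by apply: W => // z zl; rewrite -Mx; apply: Mmax; rewrite inE zl orbT.
  case/path.splitPr: Ml lk xI Mmax => p1 p2 lk xI Mmax.
  have P : perm_eq (x :: p1 ++ M :: p2) (M :: p2 ++ x :: p1).
    by rewrite -[x :: p1 ++ _]cat_cons perm_catC.
  rewrite (perm_big _ P) /=.
  have -> : walk x (rcons (p1 ++ M :: p2) x) = walk M (rcons (p2 ++ x :: p1) M).
    rewrite !rcons_cat !walk_cat !rcons_cons /= !walk_rcons.
    by ring.
  apply: W.
  - by move: lk; rewrite !size_cat /= !addnS addnC.
  - by move=> z zp; apply: xI; rewrite (perm_mem P).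
  - by move=> z zp; apply: Mmax; rewrite (perm_mem P) inE zp orbT.
case: l => [|y l] in lk xI xmax *.
  by rewrite big_seq1 /= addr0.
have /= yI : forall z, z \in y :: l -> a <= z <= b.
  by move=> z zl; apply: xI; rewrite inE zl orbT.
have := IH y l lk yI; rewrite big_cons /= !walk_rcons.
rewrite big_cons.
have lI := yI _ (mem_last y l); have xl := xmax _ (mem_last y l).
have yI0 := yI _ (mem_head y l); have xy := xmax _ (mem_head y l).
have := xI _ (mem_head x _); case/andP: lI => al _; case/andP: yI0 => ay _ /andP[_ xb].
(* The two steps into and out of the maximum [x] cost at least the step that skips it plus
   [g (x, x)]; the rest is the shorter closed walk. *)
have := monge (last y l) x y x.
by move=> /(_ al xl xb ay xy xb); lra.
Qed.

Lemma closed_action u m n : monge_on g a b -> chain_path u -> m <= n ->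
  \sum_(k < `|n - m|.+1) g (u (m + k%:Z), u (m + k%:Z)) <=
  action g u m n + g (u n, u m).
Proof.
move=> monge pu /int_leP[N ->].
have := @closed_walk (u m) [seq u (m + Posz k.+1) | k <- iota 0 N] monge.
rewrite walk_rcons -action_walk.
have -> : last (u m) [seq u (m + Posz k.+1) | k <- iota 0 N] = u (m + N%:Z).
  case: N => [|N]; first by rewrite addr0.
  by rewrite -{1}[N.+1]addn1 iotaD map_cat cats1 last_rcons.
have -> : m + N%:Z - m = N by lia.
move=> H; apply: le_trans (H _).
  rewrite big_cons big_ord_recl /= addr0 lerD2l big_map.
  by rewrite -[N in iota 0 N]subn0 big_mkord.
by move=> z; rewrite inE => /predU1P[->|/mapP[k _ ->]].
Qed.

Hypothesis G : chain_cost g a b.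

Let ab : a < b := chain_lt G.
Let aleb : a <= b := ltW ab.

Lemma pole_in c : a <= pole c <= b.
Proof. by case: c => /=; rewrite lexx aleb. Qed.

Lemma pole_diag c : g (pole c, pole c) = 0.
Proof. by case: c => /=; [exact: chain_hi G|exact: chain_lo G]. Qed.

Lemma diag_ge0 s : a <= s <= b -> 0 <= g (s, s).
Proof.
move=> /andP[]; rewrite le_eqVlt => /orP[/eqP <-|sa].
  by rewrite (chain_lo G).
rewrite le_eqVlt => /orP[/eqP ->|sb]; first by rewrite (chain_hi G).
by apply: ltW; apply: (chain_diag G); rewrite sa.
Qed.

Lemma with_tails_path u m n c c' : chain_path u ->
  chain_path (with_tails u m n (pole c) (pole c')).
Proof.
by move=> pu i; rewrite /with_tails; case: ifP => _; [exact: pole_in|];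
  case: ifP => _; [exact: pole_in|exact: pu].
Qed.

Lemma closed_action_ge0 u m n : chain_path u -> m <= n ->
  0 <= action g u m n + g (u n, u m).
Proof.
move=> pu mn; apply: le_trans (closed_action (chain_monge G) pu mn).
by apply: sumr_ge0 => k _; exact: diag_ge0.
Qed.

Lemma closed_action_diag u m n i : chain_path u -> m <= i -> i <= n ->
  g (u i, u i) <= action g u m n + g (u n, u m).
Proof.
move=> pu mi ni; apply: le_trans (closed_action (chain_monge G) pu _); last lia.
have ki : (`|i - m| < `|n - m|.+1)%N by lia.
rewrite (bigD1 (Ordinal ki))//= (_ : m + `|i - m|%N = i); last lia.
by rewrite lerDl; apply: sumr_ge0 => k _; exact: diag_ge0.
Qed.

Lemma closed_action_count u m n j (L : nat) (e : R) : chain_path u ->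
  m <= n -> m <= j -> j + L%:Z <= n + 1 ->
  (forall i, j <= i < j + L%:Z -> e <= g (u i, u i)) ->
  e *+ L <= action g u m n + g (u n, u m).
Proof.
move=> pu mn mj jn He; apply: le_trans (closed_action (chain_monge G) pu mn).
pose F (k : nat) := g (u (m + k%:Z), u (m + k%:Z)).
have F0 k : 0 <= F k by exact: diag_ge0.
rewrite -(big_mkord xpredT F).
have Aj : (`|j - m| <= `|j - m| + L)%N by lia.
rewrite (big_cat_nat (n := `|j - m| + L)) //=; last lia.
rewrite (big_cat_nat (n := `|j - m|)) //=.
rewrite -addrA ler_wpDl// ?sumr_ge0// ler_wpDr// ?sumr_ge0//.
have -> : e *+ L = \sum_(`|j - m| <= k < `|j - m| + L) e.
  by rewrite sumr_const_nat addnC addnK.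
by apply: ler_sum_nat => k kj; apply: He; lia.
Qed.

Lemma chain_bound : exists2 C : R, 0 < C &
  forall s t, a <= s <= b -> a <= t <= b -> `|g (s, t)| <= C.
Proof.
pose K : set {ptws int -> R} := [set x | forall i, a <= x i <= b].
have cK : compact K := @box_compact R (fun=> a) (fun=> b).
have K0 : K !=set0 by exists (fun=> a) => i /=; rewrite lexx.
have cf : continuous (fun x : {ptws int -> R} => `|g (x 0, x 1)|).
  by move=> x; exact: (cvg_norm (@eval2_continuous _ g 0 1 (chain_continuous G) x)).
have [x _ xmax] := compact_EVT_max K0 cK (continuous_subspaceT cf).
exists (`|g (x 0, x 1)| + 1); first by rewrite ltr_pwDr.
move=> s t sI tI; apply: (@le_trans _ _ `|g (x 0, x 1)|); last by rewrite lerDl.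
have := xmax (fun i : int => if i == 0 then s else t); rewrite /=; apply.
by rewrite inE => i /=; case: ifP.
Qed.

Lemma chain_modulus (e : R) : 0 < e -> exists2 d : R, 0 < d &
  forall s t s' t', a <= s <= b -> a <= t <= b -> a <= s' <= b -> a <= t' <= b ->
  `|s - s'| <= d -> `|t - t'| <= d -> `|g (s, t) - g (s', t')| <= e.
Proof. exact: uniform_on_square (chain_continuous G). Qed.

Lemma diag_away (d : R) : 0 < d -> exists2 e : R, 0 < e &
  forall s, a <= s <= b -> (forall c, d <= `|s - pole c|) -> e <= g (s, s).
Proof.
(* If [d] is so large that the middle interval is empty, no entry is away from both poles and any
   constant does. *)
move=> d0; have [dab|abd] := leP (a + d) (b - d); last first.
  exists 1 => // s /andP[sa sb] H; have := H true; have := H false => /=.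
  by rewrite ger0_norm ?subr_ge0// ler0_norm ?subr_le0//; lra.
have cf : {within `[a + d, b - d], continuous (fun s => g (s, s))}.
  apply: continuous_subspaceT => s.
  apply: (@continuous_comp _ _ _ (fun s => (s, s)) g); last exact: (chain_continuous G).
  have ci : (fun t : R => t) @ s --> s by exact: cvg_id.
  exact: (cvg_pair ci ci).
have [s0 s0I smin] := EVT_min dab cf.
move: s0I; rewrite in_itv/= => /andP[? ?].
exists (g (s0, s0)); first by apply: (chain_diag G); apply/andP; split; lra.
move=> s /andP[sa sb] H; apply: smin; rewrite in_itv/=.
have := H true; have := H false => /=.
by rewrite ger0_norm ?subr_ge0// ler0_norm ?subr_le0//; lra.
Qed.

(* A loop at a pole either has an entry away from both poles, or it jumps to
   the other pole and back. *)
Lemma loop_cost (d : R) : 0 < d -> exists2 k : R, 0 < k &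
  forall c u m n j, chain_path u -> u m = pole c -> u n = pole c ->
    m <= j -> j <= n -> d <= `|u j - pole c| -> k <= action g u m n.
Proof.
move=> d0; pose K := g (a, b) + g (b, a).
have K0 : 0 < K := chain_cross G.
(* Five costs are replaced by their values at the poles, with an error of [K / 10] each: the two
   jumps, and the closing steps of the pieces before, between and after them. Half of [K]
   remains. *)
have [s0 s00 s0P] := @chain_modulus (K / 10%:R) (divr_gt0 K0 (ltr0Sn _ _)).
(* A third of [b - a] prevents an entry from being [s]-close to both poles. *)
pose s := Num.min (Num.min s0 d) ((b - a) / 3%:R).
have s_gt0 : 0 < s.
  by rewrite !lt_min s00 d0 /= divr_gt0// subr_gt0.
have ss0 : s <= s0 by rewrite /s !ge_min lexx.
have sd : s <= d by rewrite /s !ge_min lexx orbT.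
have sab : s <= (b - a) / 3%:R by rewrite /s ge_min lexx orbT.
have [e e0 eP] := diag_away s_gt0.
exists (Num.min e (K / 2%:R)); first by rewrite lt_min e0 divr_gt0.
move=> c u m n j pu um un mj jn dj.
have [[i [mi ni /(eP _ (pu i)) H]]|far] := pselect (exists i, [/\ m <= i, i <= n &
    forall c, s <= `|u i - pole c|]).
  rewrite ge_min; apply/orP; left.
  have := closed_action_diag pu mi ni; rewrite um un pole_diag addr0.
  exact: le_trans.
rewrite ge_min; apply/orP; right.
have near i : m <= i -> i <= n -> exists c, `|u i - pole c| < s.
  move=> mi ni; apply: contrapT => nc; apply: far; exists i; split => // c'.
  by rewrite leNgt; apply/negP => H; apply: nc; exists c'.
have ppab c' : `|pole c' - pole (~~ c')| = b - a.
  by case: c' => /=; [rewrite ger0_norm|rewrite ler0_norm ?opprB]; rewrite ?subr_ge0 ?subr_le0.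
pose P i := `|u i - pole (~~ c)| < s.
have PN i : m <= i -> i <= n -> ~ P i -> `|u i - pole c| < s.
  move=> mi ni nP; have [c'] := near i mi ni.
  have [->//|nc H] := eqVneq c' c; exfalso; apply: nP; rewrite /P.
  by have -> : ~~ c = c' by case: (c) (c') nc => -[].
have s3 : 3%:R * s <= b - a by move: sab; lra.
have notP i : `|u i - pole c| < s -> ~ P i.
  move=> H1 H2; have := ler_distD (u i) (pole c) (pole (~~ c)).
  by rewrite ppab distrC; move: H1 H2; rewrite /P; lra.
have Pj : P j.
  by apply: contrapT => /(PN _ mj jn); lra.
(* No entry is in the middle, so the chain jumps: [i1] is the first time near the other pole and
   [i2] the first return. *)
have [i1 [/andP[mi1 i1j] Pi1 i1min]] := first_index (P := fun i => is_true (P i)) mj Pj.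
have nPn : ~ P n by apply: notP; rewrite un subrr normr0.
have i1n : i1 <= n := le_trans i1j jn.
have [i2 [/andP[i12 i2n] Pi2 i2min]] := first_index (P := fun i => ~ P i) i1n nPn.
have nPm : ~ P m by apply: notP; rewrite um subrr normr0.
have mi1' : m < i1.
  by rewrite lt_neqAle mi1 andbT; apply/eqP => E; rewrite E in nPm.
have i12' : i1 < i2.
  by rewrite lt_neqAle i12 andbT; apply/eqP => E; rewrite E in Pi1.
have a1 : m <= i1 - 1 by move: mi1'; clear; lia.
have a2 : i1 <= i2 - 1 by move: i12'; clear; lia.
have n1 : `|u (i1 - 1) - pole c| < s.
  by apply: PN => //; [move: i1n; clear; lia|apply: i1min; move: mi1'; clear; lia].
have n2 : P (i2 - 1).
  by apply: contrapT; apply: i2min; move: i12'; clear; lia.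
have n3 : `|u i2 - pole c| < s by apply: PN => //; exact: le_trans i12.
have close c1 c2 i i' : `|u i - pole c1| < s -> `|u i' - pole c2| < s ->
    `|g (u i, u i') - g (pole c1, pole c2)| <= K / 10%:R.
  by move=> H1 H2; apply: s0P; rewrite ?pu ?pole_in//;
     apply: le_trans ss0; apply: ltW.
have KE : g (pole c, pole (~~ c)) + g (pole (~~ c), pole c) = K.
  by rewrite /K; case: (c) => //=; rewrite addrC.
have cl_m : `|u m - pole c| < s by rewrite um subrr normr0.
have cl_n : `|u n - pole c| < s by rewrite un subrr normr0.
have := closed_action_ge0 pu a1.
have := closed_action_ge0 pu a2.
have := closed_action_ge0 pu i2n.
have := close _ _ _ _ n1 Pi1; have := close _ _ _ _ n2 n3.
have := close _ _ _ _ n1 cl_m; have := close _ _ _ _ cl_n n3.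
have := close _ _ _ _ n2 Pi1.
rewrite !pole_diag !ler_distl.
rewrite (@action_cat _ _ _ m i1 n)// (@action_cat _ _ _ i1 i2 n)//.
rewrite (@action_recr _ _ _ m i1)// (@action_recr _ _ _ i1 i2)//.
by clear -KE K0; lra.
Qed.

End Chain.

(** * Costs of loops and of transitions between the poles *)

Section Transit.
Context {R : realType} (g : R * R -> R) (a b : R).
Hypothesis G : chain_cost g a b.
Implicit Types (s t x y z : R) (u v : int -> R) (m n i j r : int) (c : bool).
Notation path := (chain_path a b).
Notation pole := (pole a b).

Lemma with_tails_l u m n w w' : m <= n -> with_tails u m n w w' (m - 1) = w.
Proof. by move=> mn; rewrite /with_tails ifT//; lia. Qed.

Lemma with_tails_r u m n w w' : m <= n -> with_tails u m n w w' (n + 1) = w'.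
Proof. by move=> mn; rewrite /with_tails ifF ?ifT//; lia. Qed.

Lemma with_tails_in u m n w w' i : m <= i -> i <= n -> with_tails u m n w w' i = u i.
Proof. by move=> mi ni; rewrite /with_tails ifF ?ifF//; lia. Qed.

Lemma loop_cost_open (d : R) : 0 < d -> exists2 k : R, 0 < k &
  forall c u m n j, path u -> m <= j -> j <= n -> d <= `|u j - pole c| ->
    k <= g (pole c, u m) + action g u m n + g (u n, pole c).
Proof.
move=> /(loop_cost G)[k k0 kP]; exists k => // c u m n j pu mj jn dj.
have mn := le_trans mj jn.
rewrite -action_with_tails//; apply: (kP c _ _ _ j).
- exact: (with_tails_path G).
- by rewrite with_tails_l.
- by rewrite with_tails_r.
- by move: mj; clear; lia.
- by move: jn; clear; lia.
- by rewrite with_tails_in.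
Qed.

Definition transit_cost c : R :=
  inf [set e | exists u m n, [/\ path u, m <= n, u m = pole c, u n = pole (~~ c)
    & e = action g u m n]].

Lemma transit_cost_le c u m n : path u -> m <= n ->
  u m = pole c -> u n = pole (~~ c) -> transit_cost c <= action g u m n.
Proof.
move=> pu mn um un; apply: ge_inf; last by exists u, m, n.
(* A transition followed by the jump back is a closed chain, of nonnegative cost; this bounds the
   set from below. *)
exists (- g (pole (~~ c), pole c)) => e [v [m' [n' [pv mn' vm vn ->]]]].
by rewrite -subr_ge0 opprK -vm -vn; exact: (closed_action_ge0 G).
Qed.

Lemma transit_cost_open c u m n : path u -> m <= n ->
  transit_cost c <= g (pole c, u m) + action g u m n + g (u n, pole (~~ c)).
Proof.
move=> pu mn; rewrite -action_with_tails//; apply: transit_cost_le.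
- exact: (with_tails_path G).
- by move: mn; clear; lia.
- by rewrite with_tails_l.
- by rewrite with_tails_r.
Qed.

Lemma transit_cost_adherent c (e : R) : 0 < e -> exists u (N : nat),
  [/\ path u, u 0 = pole c, u N%:Z = pole (~~ c) & action g u 0 N%:Z < transit_cost c + e].
Proof.
move=> e0.
pose S := [set e | exists u m n, [/\ path u, m <= n, u m = pole c,
  u n = pole (~~ c) & e = action g u m n]].
have hS : has_inf S.
  split; last first.
    exists (- g (pole (~~ c), pole c)) => _ [v [m' [n' [pv mn' vm vn ->]]]].
    by rewrite -subr_ge0 opprK -vm -vn; exact: (closed_action_ge0 G).
  pose v (i : int) := if i <= 0 then pole c else pole (~~ c).
  exists (action g v 0 1), v, 0, 1; split => //.
  by move=> i; rewrite /v; case: ifP => _; exact: (pole_in G).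
have [_ [u [m [n [pu mn um un ->]]]] lt] := inf_adherent e0 hS.
exists (fun i => u (i + m)), `|n - m|%N.
have E : `|n - m|%N%:Z + m = n by move: mn; clear; lia.
split => //.
- by rewrite -um; congr (u _); clear; lia.
- by rewrite -un; congr (u _); exact: E.
- by rewrite action_shift E (_ : 0 + m = m)//; clear; lia.
Qed.

Lemma visit_pole (d M : R) : 0 < d -> exists L : nat, (0 < L)%N /\
  forall u m n j, path u -> m <= j -> j + L%:Z <= n + 1 -> action g u m n <= M ->
  exists c i, [/\ j <= i, i < j + L%:Z & `|u i - pole c| < d].
Proof.
move=> /(diag_away G)[e e0 eP]; have [C C0 CP] := chain_bound G.
(* [C] pays for the step that closes the chain; [L] entries away from the poles would cost more than
   [M + C]. *)
have [L LP] : exists L : nat, (0 < L)%N /\ M + C < e *+ L.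
  exists (Num.truncn ((M + C) / e)).+1; split => //.
  by rewrite -mulr_natr mulrC -ltr_pdivrMr// truncnS_gt.
case: LP => L0 LP; exists L; split => // u m n j pu mj jn uM; apply: contrapT => nv.
have mn : m <= n by move: mj jn L0; clear; lia.
have : e *+ L <= action g u m n + g (u n, u m).
  apply: (closed_action_count G pu mn mj jn) => i /andP[ji iL].
  apply: eP => // c; rewrite leNgt; apply/negP => H.
  by apply: nv; exists c, i.
have := CP _ _ (pu n) (pu m); rewrite ler_norml => /andP[_].
by move: LP uM; clear; lra.
Qed.

(* Any other behaviour would cost an additional loop at one of the poles. *)
Lemma transit_tails (d d' : R) : 0 < d -> 0 < d' -> exists e : R, exists L : nat,
  0 < e /\ forall c u m n, path u -> m <= n -> u m = pole c -> u n = pole (~~ c) ->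
  action g u m n <= transit_cost c + e ->
  (forall j i, m <= j -> j + L%:Z <= i -> i <= n -> d <= `|u j - pole c| ->
     `|u i - pole (~~ c)| < d') /\
  (forall j i, m <= i -> i + L%:Z <= j -> j <= n -> d <= `|u j - pole (~~ c)| ->
     `|u i - pole c| < d').
Proof.
move=> d0 d'0.
have [k k0 kP] := loop_cost_open d0; have [k' k'0 k'P] := loop_cost_open d'0.
pose K := Num.min k k'.
have K0 : 0 < K by rewrite lt_min k0.
have Kk : K <= k by rewrite /K ge_min lexx.
have Kk' : K <= k' by rewrite /K ge_min lexx orbT.
(* The allowed excess and the two steps that connect to a pole make up [3 K / 4], less than the cost
   [K] of a loop. *)
have [s s0 sP] := @chain_modulus _ _ _ _ G (K / 4%:R) (divr_gt0 K0 (ltr0Sn _ _)).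
pose M := Num.max (transit_cost true) (transit_cost false) + K / 4%:R.
have [L [L0 LP]] := visit_pole M s0.
exists (K / 4%:R), L; split; first by rewrite divr_gt0.
move=> c u m n pu mn um un uE.
have uM : action g u m n <= M.
  apply: le_trans uE _; rewrite lerD2r le_max; case: (c); rewrite lexx ?orbT//.
have near c' i : `|u i - pole c'| < s ->
    `|g (pole c', u i)| <= K / 4%:R /\ `|g (u i, pole c')| <= K / 4%:R.
  move=> H; have P c'' := pole_diag G c''.
  have := sP (pole c') (u i) (pole c') (pole c').
  have := sP (u i) (pole c') (pole c') (pole c').
  rewrite !P !subr0 subrr normr0 (ltW H) (ltW s0) pu (pole_in G) => A B.
  by split; [apply: B|apply: A].
have um0 : g (pole c, u m) = 0 by rewrite um (pole_diag G).
have un0 : g (u n, pole (~~ c)) = 0 by rewrite un (pole_diag G).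
(* Up to [i] the chain has made a loop at the starting pole, and what follows is still a whole
   transition. The pair [d1], [k1] stays variable because the argument is applied to [d] and to
   [d']. *)
have late (d1 k1 : R) j i : K <= k1 ->
    (forall c u m n j, path u -> m <= j -> j <= n -> d1 <= `|u j - pole c| ->
      k1 <= g (pole c, u m) + action g u m n + g (u n, pole c)) ->
    m <= j -> j <= i -> i <= n -> d1 <= `|u j - pole c| ->
    `|u i - pole c| < s -> False.
  move=> Kk1 k1P mj ji ni dj /near[]; rewrite !ler_norml => /andP[_ ?] /andP[_ ?].
  have := k1P c u m i j pu mj ji dj.
  have := transit_cost_open c pu ni.
  move: uE; rewrite (@action_cat _ _ _ m i n)//; last exact: le_trans ji.
  by rewrite um0 un0; lra.
(* In the mirror situation the transition is complete at [i], and a loop at the target pole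
   follows. *)
have early (d1 k1 : R) j i : K <= k1 ->
    (forall c u m n j, path u -> m <= j -> j <= n -> d1 <= `|u j - pole c| ->
      k1 <= g (pole c, u m) + action g u m n + g (u n, pole c)) ->
    m <= i -> i <= j -> j <= n -> d1 <= `|u j - pole (~~ c)| ->
    `|u i - pole (~~ c)| < s -> False.
  move=> Kk1 k1P mi ij nj dj /near[]; rewrite !ler_norml => /andP[_ ?] /andP[_ ?].
  have := k1P (~~ c) u i n j pu ij nj dj.
  have := transit_cost_open c pu mi.
  move: uE; rewrite (@action_cat _ _ _ m i n)//; last exact: le_trans nj.
  by rewrite um0 un0; lra.
have cc c' : c' = c \/ c' = ~~ c by case: (c) (c') => -[]; auto.
split=> j i.
- move=> mj ji ni dj; rewrite ltNge; apply/negP => d'i.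
  have jn : j + L%:Z <= n + 1 by move: ji ni; clear; lia.
  have [c' [r [jr rL]]] := LP u m n j pu mj jn uM.
  have ri : r <= i by move: rL ji; clear; lia.
  case: (cc c') => -> H.
    by apply: (late _ _ j r Kk kP) => //; exact: le_trans ri ni.
  by apply: (early _ _ i r Kk' k'P) => //; exact: le_trans jr.
- move=> mi ij nj dj; rewrite ltNge; apply/negP => d'i.
  have [c' [r [jr rL]]] := LP u m n (i + 1) pu ltac:(move: mi; clear; lia)
    ltac:(move: ij nj; clear; lia) uM.
  have rj : r <= j by move: rL ij; clear; lia.
  have ir : i <= r by move: jr; clear; lia.
  case: (cc c') => -> H.
    by apply: (late _ _ i r Kk' k'P) => //; exact: le_trans nj.
  by apply: (early _ _ j r Kk kP) => //; exact: le_trans ir.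
Qed.

End Transit.

(** * Minimizers under constraints on the single entries *)

Section ConstrainedMinimal.
Context {R : realType}.
Implicit Types (g : R * R -> R) (u v : int -> R) (m n i j : int) (D : int -> set R).

Definition replace u v m n : int -> R := fun i => if m < i < n then v i else u i.

(** Competitors differ from [u] only inside a finite window, since only differences of actions over
    finite windows make sense on an infinite chain. *)
Definition constrained_minimal g D u :=
  (forall i, D i (u i)) /\
  forall m n v, m <= n -> (forall i, D i (v i)) ->
    (forall i, ~~ (m < i < n) -> v i = u i) -> action g u m n <= action g v m n.

Lemma replace_out u v m n i : ~~ (m < i < n) -> replace u v m n i = u i.
Proof. by rewrite /replace => /negbTE ->. Qed.

Lemma replace_action_continuous g v m n : continuous g ->
  continuous (fun u : {ptws int -> R} => action g (replace u v m n) m n).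
Proof.
move=> cg; rewrite /action.
have cr i : continuous (fun u : {ptws int -> R} => replace u v m n i).
  rewrite /replace; case: (m < i < n); first exact: cst_continuous.
  exact: entry_continuous.
apply: (sum_continuous (F := fun k (u : {ptws int -> R}) =>
  g (replace u v m n (m + k%:Z), replace u v m n (m + k%:Z + 1)))) => k.
by apply: pair_continuous.
Qed.

Lemma action_local g u v m n m' n' : m' <= m -> m <= n -> n <= n' ->
  (forall i, ~~ (m < i < n) -> v i = u i) ->
  action g v m' n' - action g u m' n' = action g v m n - action g u m n.
Proof.
move=> m'm mn nn' uv.
have mn' := le_trans mn nn'.
rewrite !(@action_cat _ _ _ m' m n')// !(@action_cat _ _ _ m n n')//.
have -> : action g v m' m = action g u m' m.
  by apply: action_eq => // i ?; apply: uv; lia.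
have -> : action g v n n' = action g u n n'.
  by apply: action_eq => // i ?; apply: uv; lia.
ring.
Qed.

(** Minimizers on the windows from [- k] to [k] exist by compactness. As soon as the window contains
    [m] and [n], they beat every admissible change between [m] and [n], and this passes to a cluster
    point. *)
Lemma constrained_minimal_exists g D u0 : continuous g ->
  (forall i, compact (D i)) -> (forall i, D i (u0 i)) ->
  exists u, constrained_minimal g D u.
Proof.
move=> cg cD u0D.
pose K : set {ptws int -> R} := [set u | forall i, D i (u i)].
have cK : compact K := @tychonoff int (fun=> R) D cD.
have K0 : K !=set0 by exists u0.
have win (k : nat) : exists u, K u /\
    forall v, K v -> action g u (- k%:Z) k%:Z <= action g v (- k%:Z) k%:Z.
  have [u uK umin] := compact_EVT_min K0 cK
    (continuous_subspaceT (@action_continuous _ _ (- k%:Z) k%:Z cg)).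
  exists u; split; first by rewrite inE in uK.
  by move=> v Kv; apply: umin; rewrite inE.
have [u_ uP] := choice win.
have [u [Ku clu]] := compact_seq_cluster cK (fun k => (uP k).1).
exists u; split=> // m n v mn vD vu.
(* The approximating minimizers have other values at [m] and [n] than [u]. Keeping the outer values
   of the chain itself turns the comparison into a closed condition on that chain. *)
have -> : action g v m n = action g (replace u v m n) m n.
  apply: action_eq => // i _; have [/negbTE E|E] := boolP (~~ (m < i < n)).
    by rewrite /replace E vu// E.
  by rewrite /replace (negbNE E).
apply: (clu [set u : {ptws int -> R} | action g u m n <= action g (replace u v m n) m n]).
  apply: closed_ler; first exact: action_continuous.
  exact: replace_action_continuous.
exists (`|m| + `|n|)%N => k mnk /=.
rewrite -subr_ge0 -(@action_local _ _ _ _ _ (- k%:Z) k%:Z)//; [|lia|lia|].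
  rewrite subr_ge0; apply: (uP k).2 => i; rewrite /replace.
  by case: ifP => _; [exact: vD|exact: (uP k).1].
by move=> i; exact: replace_out.
Qed.

Lemma action_const g u m n w : g (w, w) = 0 ->
  (forall i, m <= i <= n -> u i = w) -> m <= n -> action g u m n = 0.
Proof.
move=> gw uw mn; rewrite (@action_eq _ _ _ (fun=> w))// /action.
by apply: big1 => k _.
Qed.

Lemma action_const_tails g u m n m' n' w w' : g (w, w) = 0 -> g (w', w') = 0 ->
  u m = w -> u n = w' -> m' <= m -> m <= n -> n <= n' ->
  action g (with_tails u m n w w') m' n' = action g u m n.
Proof.
move=> gw gw' um un m'm mn nn'.
have mn' := le_trans mn nn'.
have H i : [/\ i <= m -> with_tails u m n w w' i = w,
  m <= i <= n -> with_tails u m n w w' i = u i &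
  n <= i -> with_tails u m n w w' i = w'].
  rewrite /with_tails -um -un; split=> hi.
  - case: ifPn => ?; [by []|case: ifPn => ?]; [lia|congr (u _); lia].
  - by case: ifPn => ?; [lia|case: ifPn => ?]; [lia|].
  - case: ifPn => ?; [lia|case: ifPn => ?]; [by []|congr (u _); lia].
rewrite (@action_cat _ _ _ m' m n')// (@action_cat _ _ _ m n n')//.
rewrite (@action_const _ _ m' m w)// ?add0r; last first.
  by move=> i /andP[_ im]; case: (H i) => + _ _; apply.
rewrite (@action_const _ _ n n' w')// ?addr0; last first.
  by move=> i /andP[im _]; case: (H i) => _ _; apply.
by apply: action_eq => // i imn; case: (H i) => _ + _; apply.
Qed.

End ConstrainedMinimal.

(** * The extra cost of a transition through a missing value *)

Section Gap.
Context {R : realType} (g : R * R -> R) (a b : R).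
Hypothesis G : chain_cost g a b.
Implicit Types (s t x y z : R) (u v : int -> R) (m n i j r : int) (c : bool).
Notation path := (chain_path a b).
Notation pole := (pole a b).

Definition chain_heteroclinic c u :=
  constrained_minimal g (fun=> [set s | a <= s <= b]) u /\
  forall d, 0 < d -> exists L : nat, forall i,
    (L%:Z <= i -> `|u i - pole (~~ c)| <= d) /\ (i <= - L%:Z -> `|u i - pole c| <= d).

(** Otherwise there are transitions through [s] with arbitrarily small excess. Moved so as to take
    the value [s] at time 0, they cluster at a chain that is minimal, because a gain in a window
    would push the cost below the infimum, and heteroclinic, because [transit_tails] controls the
    tails uniformly. *)
Lemma transit_gap c s : a < s < b -> (forall u, chain_heteroclinic c u -> u 0 <> s) ->
  exists2 e : R, 0 < e & forall u m n j, path u -> u m = pole c -> u n = pole (~~ c) ->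
    m <= j -> j <= n -> u j = s -> transit_cost g a b c + e <= action g u m n.
Proof.
move=> /andP[sa sb] nohet; apply: contrapT => ne.
pose K : set {ptws int -> R} := [set x | forall i, a <= x i <= b].
have cK : compact K := @box_compact R (fun=> a) (fun=> b).
have H (k : nat) : exists u : {ptws int -> R}, K u /\ u 0 = s /\
    exists m n, [/\ m <= 0, 0 <= n & forall m' n', m' <= m -> n <= n' ->
      [/\ u m' = pole c, u n' = pole (~~ c) &
      action g u m' n' < transit_cost g a b c + k.+1%:R^-1]].
  apply: contrapT => nu; apply: ne; exists k.+1%:R^-1; first by rewrite invr_gt0.
  move=> u m n j pu um un mj jn uj; rewrite leNgt; apply/negP => lt; apply: nu.
  have mn := le_trans mj jn.
  pose v := with_tails u m n (pole c) (pole (~~ c)).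
  exists (fun i => v (i + j)); split.
    by move=> i; exact: (with_tails_path G _ _ _ _ pu).
  split.
    have -> : 0 + j = j by lia.
    by rewrite /v with_tails_in.
  exists (m - j), (n - j); split; [lia|lia|] => m' n' mm' nn'; split.
  - rewrite /v /with_tails; case: ifPn => // ?; case: ifPn => ?; first lia.
    by rewrite -um; congr (u _); lia.
  - rewrite /v /with_tails; case: ifPn => ?; first lia; case: ifPn => // ?.
    by rewrite -un; congr (u _); lia.
  - rewrite (action_shift g v) /v action_const_tails//; try exact: pole_diag;
      by move: mm' nn'; clear; lia.
have [u_ uP] := choice H.
have [u [Ku clu]] := compact_seq_cluster cK (fun k => (uP k).1).
have u0 : u 0 = s.
  apply: (clu [set u : {ptws int -> R} | u 0 = s]); last by exists 0%N => k _; exact: (uP k).2.1.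
  by apply: closed_eqr; [exact: entry_continuous|exact: cst_continuous].
apply: (nohet u _ u0); split; first split=> //.
- move=> m n v mn vD vu.
  have -> : action g v m n = action g (replace u v m n) m n.
    apply: action_eq => // i _; have [/negbTE E|E] := boolP (~~ (m < i < n)).
      by rewrite /replace E vu// E.
    by rewrite /replace (negbNE E).
  apply/ler_addgt0Pr => e e0.
  apply: (clu [set u : {ptws int -> R} | action g u m n <= action g (replace u v m n) m n + e]).
    apply: closed_ler; first exact: (action_continuous (chain_continuous G)).
    have cr := @replace_action_continuous _ _ v m n (chain_continuous G).
    by move=> x; exact: (cvgD (cr x) (@cvg_cst _ e _ (nbhs x) _)).
  have [k0 k0P] := ge0_inv_eventually e0.
  exists k0 => k /k0P ke /=.
  have [Kuk [_ [m1 [n1 [m10 n10 uk]]]]] := uP k.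
  (* The window is enlarged until the chain sits at the poles at both ends, so that the modified
     chain is a transition as well. *)
  pose m' := Num.min m m1; pose n' := Num.max n n1.
  have mm' : m' <= m by rewrite /m' ge_min lexx.
  have mm1 : m' <= m1 by rewrite /m' ge_min lexx orbT.
  have nn' : n <= n' by rewrite /n' le_max lexx.
  have nn1 : n1 <= n' by rewrite /n' le_max lexx orbT.
  have [um un ult] := uk _ _ mm1 nn1.
  have loc := @action_local _ g (u_ k) (replace (u_ k) v m n) m n m' n' mm' mn nn'
    (fun i => @replace_out _ _ _ _ _ i).
  have : transit_cost g a b c <= action g (replace (u_ k) v m n) m' n'.
    apply: (transit_cost_le G).
    - move=> i; rewrite /replace; case: ifP => _; [exact: vD|exact: Kuk].
    - by apply: le_trans mm' _; apply: le_trans mn _.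
    - by rewrite replace_out//; move: mm'; clear; lia.
    - by rewrite replace_out//; move: nn'; clear; lia.
  have {}ult : action g (u_ k) m' n' < transit_cost g a b c + e.
    by apply: lt_le_trans ult _; rewrite lerD2l.
  by move: ult loc; clear; lra.
- move=> d d0.
  (* The value [s] at time 0 is [d1] away from both poles, so time 0 serves as the reference time
     for both tails. *)
  pose d1 := Num.min (s - a) (b - s).
  have d10 : 0 < d1 by rewrite lt_min !subr_gt0 sa.
  have d1c c' : d1 <= `|s - pole c'|.
    by case: c' => /=; rewrite /d1 ge_min; [rewrite ltr0_norm|rewrite gtr0_norm];
      rewrite ?subr_lt0 ?subr_gt0 // ?opprB lexx ?orbT.
  have [e [L [e0 eP]]] := transit_tails G d10 d0.
  exists L => i.
  suff [k0 k0P] : exists k0 : nat, forall k, (k0 <= k)%N ->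
     (L%:Z <= i -> `|u_ k i - pole (~~ c)| <= d) /\ (i <= - L%:Z -> `|u_ k i - pole c| <= d).
    split=> Li.
      apply: (clu [set u : {ptws int -> R} | `|u i - pole (~~ c)| <= d]).
        exact: near_closed.
      by exists k0 => k /k0P[+ _]; exact.
    apply: (clu [set u : {ptws int -> R} | `|u i - pole c| <= d]).
      exact: near_closed.
    by exists k0 => k /k0P[_]; exact.
  have [k0 k0P] := ge0_inv_eventually e0.
  exists k0 => k /k0P ke.
  have [Kuk [uk0 [m1 [n1 [m10 n10 uk]]]]] := uP k.
  pose m' := Num.min i m1; pose n' := Num.max i n1.
  have mm' : m' <= i by rewrite /m' ge_min lexx.
  have mm1 : m' <= m1 by rewrite /m' ge_min lexx orbT.
  have nn' : i <= n' by rewrite /n' le_max lexx.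
  have nn1 : n1 <= n' by rewrite /n' le_max lexx orbT.
  have [um un ult] := uk _ _ mm1 nn1.
  have m0 := le_trans mm1 m10; have n0 := le_trans n10 nn1.
  have uE : action g (u_ k) m' n' <= transit_cost g a b c + e.
    by apply: le_trans (ltW ult) _; rewrite lerD2l.
  have [A B] := eP c (u_ k) m' n' Kuk (le_trans m0 n0) um un uE.
  split=> Li; apply: ltW.
    by apply: (A 0) => //; rewrite ?add0r// uk0.
  by apply: (B 0) => //; rewrite ?uk0//; move: Li; clear; lia.
Qed.

End Gap.

(** * Transitions of a constrained minimizer *)

Section Transitions.
Context {R : realType} (g : R * R -> R) (a b : R).
Hypothesis G : chain_cost g a b.
Implicit Types (s t x y z : R) (u v : int -> R) (m n i j r T : int) (c : bool).
Notation path := (chain_path a b).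
Notation pole := (pole a b).

Lemma action_replace u v m n : m + 1 < n ->
  action g (replace u v m n) m n =
  g (u m, v (m + 1)) + action g v (m + 1) (n - 1) + g (v (n - 1), u n).
Proof.
move=> mn; rewrite action_recl; last lia.
rewrite action_recr; last lia.
rewrite addrA; congr (_ + _ + _).
- by congr (g (_, _)); rewrite /replace; case: ifPn => //; lia.
- by apply: action_eq => [|i imn]; [lia|rewrite /replace ifT//; lia].
- by congr (g (_, _)); rewrite /replace; case: ifPn => //; lia.
Qed.

Lemma pole_dist s c : a <= s <= b -> `|s - pole (~~ c)| = b - a - `|s - pole c|.
Proof.
move=> /andP[sa sb]; have A : `|s - a| = s - a by rewrite ger0_norm// subr_ge0.
have B : `|s - b| = b - s by rewrite ler0_norm ?opprB// subr_le0.
by case: c => /=; rewrite A B; lra.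
Qed.

Lemma pole_dist_inj s t c : a <= s <= b -> a <= t <= b ->
  `|s - pole c| = `|t - pole c| -> s = t.
Proof.
move=> /andP[sa sb] /andP[ta tb]; case: c => /=.
  by rewrite !ler0_norm ?subr_le0//; lra.
by rewrite !ger0_norm ?subr_ge0//; lra.
Qed.

Definition block_pole T : bool := ~~ (2 %| T)%Z.

Lemma block_pole_next T : block_pole (T + 1) = ~~ block_pole T.
Proof. by rewrite /block_pole; lia. Qed.

Section Constraints.
Variables (al : bool -> R) (delta : int -> R) (K : int -> int) (L : int -> nat).
Hypothesis al_in : forall c, a < al c < b.
Hypothesis delta_gt0 : forall T, 0 < delta T.
Hypothesis L_gt0 : forall T, (0 < L T)%N.
Hypothesis K_even : forall T, K (2 * T) < K (2 * T + 1).
Hypothesis K_odd : forall T, K (2 * T + 1) + (L T)%:Z < K (2 * T + 2) - (L T)%:Z.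

(* In the cell [K (2 T), K (2 T + 2)) the entries stay close to the pole of the
   block up to [K (2 T + 1)]; they have not passed the barrier [al] at [leave T]
   and have passed it at [arrive T]. *)
Definition leave T : int := K (2 * T + 1) + (L T)%:Z.
Definition arrive T : int := K (2 * T + 2) - (L T)%:Z.

(** Distances to a pole express the barriers for upward and downward transitions at once. The bounds
    are not strict, which keeps the set compact; strictness is a result about the minimizer. *)
Definition block_constraint (n : int) : set R := [set s | a <= s <= b /\ forall T,
  [/\ K (2 * T) <= n <= K (2 * T + 1) -> `|s - pole (block_pole T)| <= delta T,
      n = leave T ->
        `|s - pole (block_pole T)| <= `|al (block_pole T) - pole (block_pole T)| &
      n = arrive T ->
        `|s - pole (block_pole (T + 1))| <= `|al (block_pole T) - pole (block_pole (T + 1))|]].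

Lemma cell_step T : K (2 * T) < K (2 * (T + 1)).
Proof.
have := K_even T; have := K_odd T; rewrite (_ : 2 * (T + 1) = 2 * T + 2); last lia.
lia.
Qed.

Lemma cell_mono T T' : T <= T' -> K (2 * T) <= K (2 * T').
Proof.
move=> /int_leP[N ->]; elim: N => [|N IH]; first by rewrite addr0.
apply: le_trans IH _; have := ltW (cell_step (T + N%:Z)).
by congr (K _ <= K (2 * _)); lia.
Qed.

Lemma cell_uniq n T T' : K (2 * T) <= n -> n < K (2 * T + 2) ->
  K (2 * T') <= n -> n < K (2 * T' + 2) -> T = T'.
Proof.
have E X : 2 * X + 2 = 2 * (X + 1) :> int by lia.
rewrite !E => h1 h2 h3 h4; apply/eqP; rewrite eq_le; apply/andP; split.
  rewrite leNgt; apply/negP => H.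
  have /cell_mono H' : T' + 1 <= T by lia.
  by have := lt_le_trans h4 (le_trans H' h1); rewrite ltxx.
rewrite leNgt; apply/negP => H.
have /cell_mono H' : T + 1 <= T' by lia.
by have := lt_le_trans h2 (le_trans H' h3); rewrite ltxx.
Qed.

(** The cells are disjoint, so only the constraints with the index of the cell of [n] can concern
    [n]. *)
Lemma cell_constraint n T s : K (2 * T) <= n -> n < K (2 * T + 2) -> a <= s <= b ->
  (n <= K (2 * T + 1) -> `|s - pole (block_pole T)| <= delta T) ->
  (n = leave T ->
     `|s - pole (block_pole T)| <= `|al (block_pole T) - pole (block_pole T)|) ->
  (n = arrive T ->
     `|s - pole (block_pole (T + 1))| <= `|al (block_pole T) - pole (block_pole (T + 1))|) ->
  block_constraint n s.
Proof.
move=> n1 n2 sI c1 c2 c3; split => // T'.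
have := K_even T'; have := K_odd T'; have := L_gt0 T' => L0 Ko Ke.
split=> H.
- have E : T = T' by apply: (cell_uniq n1 n2); lia.
  by rewrite -E in H *; apply: c1; case/andP: H.
- have E : T = T' by apply: (cell_uniq n1 n2); rewrite H /leave; lia.
  by rewrite -E in H *; exact: c2.
- have E : T = T' by apply: (cell_uniq n1 n2); rewrite H /arrive; lia.
  by rewrite -E in H *; exact: c3.
Qed.

Lemma block_constraint_compact n : compact (block_constraint n).
Proof.
apply: (@subclosed_compact _ _ `[a, b]%classic); last 2 first.
- exact: segment_compact.
- by move=> s [sI _] /=; rewrite in_itv.
have cd w d : closed [set s : R | `|s - w| <= d].
  apply: closed_ler; last exact: cst_continuous.
  move=> x; exact: (cvg_norm (cvgB (@cvg_id _ (nbhs x)) (@cvg_cst _ w _ (nbhs x) _))).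
have cimp (P : Prop) (w d : R) : closed [set s : R | P -> `|s - w| <= d].
  have [p|np] := pselect P.
    rewrite (_ : mkset _ = [set s : R | `|s - w| <= d])//.
    by apply/seteqP; split => s //=; auto.
  rewrite (_ : mkset _ = setT); first exact: closedT.
  by apply/seteqP; split => s //=.
pose F T := [set s : R | K (2 * T) <= n <= K (2 * T + 1) -> `|s - pole (block_pole T)| <= delta T]
  `&` ([set s | n = leave T ->
        `|s - pole (block_pole T)| <= `|al (block_pole T) - pole (block_pole T)|] `&`
      [set s | n = arrive T ->
        `|s - pole (block_pole (T + 1))| <= `|al (block_pole T) - pole (block_pole (T + 1))|]).
rewrite (_ : block_constraint n = `[a, b]%classic `&` \bigcap_T F T).
  apply: closedI; first exact: interval_closed.
  by apply: closed_bigI => T _; apply: closedI; [exact: cimp|apply: closedI; exact: cimp].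
apply/seteqP; split => s /=.
  by move=> [sI H]; rewrite in_itv; split => // T _; case: (H T).
by rewrite in_itv => -[sI H]; split => // T; have [? []] := H T I.
Qed.

Lemma block_constraint_nonempty n : exists s, block_constraint n s.
Proof.
have [[T [n1 n2]]|nT] := pselect (exists T, K (2 * T) <= n /\ n < K (2 * T + 2)).
  have [nb|nb] := leP n (leave T).
    exists (pole (block_pole T)); apply: (cell_constraint n1 n2).
    - exact: (pole_in G).
    - by move=> _; rewrite subrr normr0 ltW.
    - by move=> _; rewrite subrr normr0.
    - by move=> H; have := K_odd T; move: nb; rewrite H /leave /arrive; lia.
  exists (pole (block_pole (T + 1))); apply: (cell_constraint n1 n2).
  - exact: (pole_in G).
  - by move=> H; move: nb; rewrite /leave; lia.
  - by move=> H; move: nb; rewrite H ltxx.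
  - by move=> _; rewrite subrr normr0.
(* A time outside all cells carries no constraint beyond the interval; this spares a proof that the
   cells exhaust the integers. *)
exists a; split; first by rewrite lexx (ltW (chain_lt G)).
move=> T; have := K_even T; have := K_odd T; have := L_gt0 T => L0 Ko Ke.
by split=> H; exfalso; apply: nT; exists T; split; rewrite ?H /leave /arrive; lia.
Qed.

Variable u : int -> R.
Hypothesis u_min : constrained_minimal g block_constraint u.

Lemma minimizer_path : path u.
Proof. by move=> i; case: (u_min.1 i). Qed.

Lemma block_replace T m n : K (2 * T) <= m -> m + 1 < n -> n <= K (2 * T + 1) ->
  action g u m n <= g (u m, pole (block_pole T)) + g (pole (block_pole T), u n).
Proof.
move=> Km mn nK; pose w := pole (block_pole T).
have := u_min.2 m n (replace u (fun=> w) m n).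
have A0 : action g (fun=> w) (m + 1) (n - 1) = 0.
  by apply: (action_const (w := w)) => //; [exact: (pole_diag G)|lia].
rewrite action_replace// A0 addr0; apply; first by lia.
- move=> i; rewrite /replace; case: ifPn => [imn|_]; last exact: u_min.1.
  have := K_odd T => Ko.
  have wI : a <= w <= b := pole_in G _.
  apply: (@cell_constraint i T) => //; try by lia.
  + by move=> _; rewrite subrr normr0 ltW.
  + by move=> H; have := L_gt0 T; move: H; rewrite /leave; lia.
  + by move=> H; move: H; rewrite /arrive; lia.
- by move=> i; exact: replace_out.
Qed.

(** A competitor that rests at the poles up to [leave T] and from [arrive T] on meets the barrier
    and block constraints at distance 0, wherever it crosses in between. *)
Lemma transit_replace T m n v : path v ->
  K (2 * T) <= m -> m <= K (2 * T + 1) -> K (2 * T + 2) <= n -> n <= K (2 * T + 3) ->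
  (forall i, i <= leave T -> v i = pole (block_pole T)) ->
  (forall i, arrive T <= i -> v i = pole (block_pole (T + 1))) ->
  action g u m n <= g (u m, pole (block_pole T)) + action g v (m + 1) (n - 1) +
    g (pole (block_pole (T + 1)), u n).
Proof.
move=> pv Km mK Kn nK vl vr.
have Ko := K_odd T; have L0 := L_gt0 T.
have := u_min.2 m n (replace u v m n).
rewrite action_replace; last by lia.
rewrite vl; last by rewrite /leave; lia.
rewrite vr; last by rewrite /arrive; lia.
apply; first by lia.
- move=> i; rewrite /replace; case: ifPn => [imn|_]; last exact: u_min.1.
  have [iK|Ki] := ltP i (K (2 * T + 2)).
    apply: (@cell_constraint i T) => //; try by lia.
    + by move=> H; rewrite vl ?subrr ?normr0 ?ltW// /leave; lia.
    + by move=> H; rewrite vl ?subrr ?normr0// H.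
    + by move=> H; rewrite vr ?subrr ?normr0// H.
  have E : 2 * (T + 1) = 2 * T + 2 by lia.
  have E1 : 2 * T + 3 = 2 * (T + 1) + 1 by lia.
  have Ko1 := K_odd (T + 1); have L01 := L_gt0 (T + 1).
  apply: (@cell_constraint i (T + 1)) => //.
  + by rewrite E.
  + by move: imn nK Ko1 L01; rewrite E1; lia.
  + by move=> H; rewrite vr ?subrr ?normr0 ?ltW// /arrive; lia.
  + by move=> H; move: imn nK; rewrite H /leave E1; lia.
  + by move=> H; move: imn nK; rewrite H /arrive E1; lia.
- by move=> i; exact: replace_out.
Qed.

(** Only the entry at [n] is varied, hence only the constraints at time [n] matter; where they are
    strict, all nearby values are admissible. *)
Lemma local_minimum n : 
  (forall T, K (2 * T) <= n -> n <= K (2 * T + 1) ->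
    `|u n - pole (block_pole T)| < delta T) ->
  (forall T, n = leave T ->
    `|u n - pole (block_pole T)| < `|al (block_pole T) - pole (block_pole T)|) ->
  (forall T, n = arrive T ->
    `|u n - pole (block_pole (T + 1))| < `|al (block_pole T) - pole (block_pole (T + 1))|) ->
  exists2 d : R, 0 < d & forall s, a <= s <= b -> `|s - u n| < d ->
    g (u (n - 1), u n) + g (u n, u (n + 1)) <= g (u (n - 1), s) + g (s, u (n + 1)).
Proof.
move=> c1 c2 c3.
have room w (r : R) : `|u n - w| < r -> exists2 d : R, 0 < d &
    forall s, `|s - u n| < d -> `|s - w| <= r.
  move=> H; exists (r - `|u n - w|); first by rewrite subr_gt0.
  by move=> s Hs; have := ler_distD (u n) s w; move: Hs; lra.
suff [d d0 dP] : exists2 d : R, 0 < d & forall s, a <= s <= b -> `|s - u n| < d ->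
    block_constraint n s.
  exists d => // s sI /(dP s sI) sD.
  pose v i := if i == n then s else u i.
  have vn : v n = s by rewrite /v eqxx.
  have v1 : v (n - 1) = u (n - 1) by rewrite /v ifF//; lia.
  have v2 : v (n + 1) = u (n + 1) by rewrite /v ifF//; lia.
  have := u_min.2 (n - 1) (n + 1) v.
  rewrite !(@action_recl _ _ _ (n - 1) (n + 1)); [|lia|lia].
  rewrite !subrK !action1 vn v1 v2; apply; first by lia.
    by move=> i; rewrite /v; case: eqP => [->//|_]; exact: u_min.1.
  by move=> i; rewrite /v; case: eqP => // ->; lia.
have [[T [n1 n2]]|nT] := pselect (exists T, K (2 * T) <= n /\ n < K (2 * T + 2)); last first.
  exists 1 => // s sI _; split => // T.
  have := K_even T; have := K_odd T; have := L_gt0 T => L0 Ko Ke.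
  by split=> H; exfalso; apply: nT; exists T; move: H; rewrite /leave /arrive; lia.
have Ko := K_odd T; have L0 := L_gt0 T.
have [nb|bn] := leP n (K (2 * T + 1)).
  have [d d0 dP] := room _ _ (c1 T n1 nb).
  exists d => // s sI /dP H; apply: (cell_constraint n1 n2) => //;
    by rewrite /leave /arrive; lia.
have [nl|nl] := eqVneq n (leave T).
  have [d d0 dP] := room _ _ (c2 T nl).
  exists d => // s sI /dP H; apply: (cell_constraint n1 n2) => //.
    by move: bn; clear; lia.
  by rewrite nl /leave /arrive; lia.
have [na|na] := eqVneq n (arrive T).
  have [d d0 dP] := room _ _ (c3 T na).
  exists d => // s sI /dP H; apply: (cell_constraint n1 n2) => //.
    by move: bn; clear; lia.
  by move=> H1; move: nl; rewrite H1 eqxx.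
exists 1 => // s sI _; apply: (cell_constraint n1 n2) => //.
- by move: bn; clear; lia.
- by move=> H1; move: nl; rewrite H1 eqxx.
- by move=> H1; move: na; rewrite H1 eqxx.
Qed.

End Constraints.

End Transitions.

Section ChainTransitions.
Context {R : realType} (g : R * R -> R) (a b : R).
Hypothesis G : chain_cost g a b.
Implicit Types (s t x y z : R) (u v : int -> R) (m n i j r T : int) (c : bool).
Notation path := (chain_path a b).
Notation pole := (pole a b).

Lemma near_pole (e : R) : 0 < e -> exists2 d : R, 0 < d & forall c s, a <= s <= b ->
  `|s - pole c| < d -> g (pole c, s) <= e /\ g (s, pole c) <= e.
Proof.
move=> /(chain_modulus G)[d d0 dP]; exists d => // c s sI sd.
have P := pole_diag G c; have pI := pole_in G c.
have := dP (pole c) s (pole c) (pole c) pI sI pI pI.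
have := dP s (pole c) (pole c) (pole c) sI pI pI pI.
rewrite !P !subr0 subrr normr0 (ltW sd) (ltW d0) => A B.
split; [have := B isT isT|have := A isT isT]; rewrite ler_norml => /andP[]; done.
Qed.

Lemma chain_transitions (al : bool -> R) (delta : int -> R) :
  (forall c, a < al c < b) ->
  (forall c u, chain_heteroclinic g a b c u -> u 0 <> al c) ->
  (forall T, 0 < delta T) ->
  exists M : int -> int, (forall i, 0 < M i) /\
  forall K : int -> int, (forall i, M i <= K (i + 1) - K i) ->
  exists u, [/\ path u,
    (forall T n, K (2 * T) <= n -> n <= K (2 * T + 1) ->
      `|u n - pole (block_pole T)| < delta T) &
    forall n, exists2 d : R, 0 < d & forall s, a <= s <= b -> `|s - u n| < d ->
      g (u (n - 1), u n) + g (u n, u (n + 1)) <= g (u (n - 1), s) + g (s, u (n + 1))].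
Proof.
move=> al_in nohet delta_gt0.
have ab : a < b := chain_lt G.
have /choice[eg egP] : forall c, exists e : R, 0 < e /\
    forall u m n j, path u -> u m = pole c -> u n = pole (~~ c) ->
    m <= j -> j <= n -> u j = al c -> transit_cost g a b c + e <= action g u m n.
  by move=> c; have [e e0 eP] := transit_gap G (al_in c) (@nohet c); exists e.
have [d1 d10 d1P] : exists2 d1 : R, 0 < d1 & forall c c', d1 <= `|al c - pole c'|.
  pose f c := Num.min (al c - a) (b - al c).
  have f0 c : 0 < f c by rewrite lt_min !subr_gt0 al_in.
  exists (Num.min (f true) (f false)); first by rewrite lt_min !f0.
  move=> c c'; apply: (@le_trans _ _ (f c)).
    by case: c; rewrite ge_min lexx ?orbT.
  have /andP[ac cb] := al_in c.
  by case: c' => /=; rewrite /f ge_min; [rewrite ltr0_norm|rewrite gtr0_norm];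
    rewrite ?subr_lt0 ?subr_gt0 // ?opprB lexx ?orbT.
(* A quarter of the width ensures that an entry of a block can be close only to the pole of that
   block. *)
pose dl T := Num.min (delta T) ((b - a) / 4%:R).
have dl0 T : 0 < dl T by rewrite lt_min delta_gt0 divr_gt0 ?subr_gt0.
have dlb T : dl T <= (b - a) / 4%:R by rewrite /dl ge_min lexx orbT.
have /choice[tT tP] : forall T, exists eL : R * nat, 0 < eL.1 /\
    forall c u m n, path u -> m <= n -> u m = pole c -> u n = pole (~~ c) ->
    action g u m n <= transit_cost g a b c + eL.1 ->
    (forall j i, m <= j -> j + eL.2%:Z <= i -> i <= n -> d1 <= `|u j - pole c| ->
       `|u i - pole (~~ c)| < Num.min (dl T) (dl (T + 1))) /\
    (forall j i, m <= i -> i + eL.2%:Z <= j -> j <= n -> d1 <= `|u j - pole (~~ c)| ->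
       `|u i - pole c| < Num.min (dl T) (dl (T + 1))).
  move=> T; have m0 : 0 < Num.min (dl T) (dl (T + 1)) by rewrite lt_min !dl0.
  by have [e [L eLP]] := transit_tails G d10 m0; exists (e, L).
(* The successor keeps [leave] and [arrive] strictly outside the blocks. *)
pose L T := (tT T).2.+1.
have L_gt0 T : (0 < L T)%N by [].
(* An excess below [eta T] both controls the tails of the transition and forbids it to take the
   barrier value. *)
pose eta T := Num.min (tT T).1 (eg (block_pole T)).
have eta0 T : 0 < eta T by rewrite lt_min (tP T).1 (egP _).1.
have /choice[kap kapP] : forall T, exists k : R, 0 < k /\
    forall c u m n j, path u -> m <= j -> j <= n -> dl T <= `|u j - pole c| ->
    k <= g (pole c, u m) + action g u m n + g (u n, pole c).
  by move=> T; have [k k0 kP] := loop_cost_open G (dl0 T); exists k.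
(* Each comparison below involves four steps between the chain and a pole. Their sum stays below the
   loop cost of block [T] and below a quarter of [eta] for the two transitions that border on it. *)
pose om T := Num.min (kap T / 8%:R) (Num.min (eta T / 16%:R) (eta (T - 1) / 16%:R)).
have om0 T : 0 < om T by rewrite !lt_min !divr_gt0 ?(kapP T).1.
have om1 T : om T <= kap T / 8%:R by rewrite /om ge_min lexx.
have om2 T : om T <= eta T / 16%:R by rewrite /om !ge_min lexx orbT.
have om3 T : om T <= eta (T - 1) / 16%:R by rewrite /om !ge_min lexx !orbT.
have /choice[sg sgP] : forall T, exists d : R, [/\ 0 < d, d <= (b - a) / 4%:R &
    forall c s, a <= s <= b -> `|s - pole c| < d ->
    g (pole c, s) <= om T /\ g (s, pole c) <= om T].
  move=> T; have [d d0 dP] := near_pole (om0 T).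
  exists (Num.min d ((b - a) / 4%:R)); split.
  - by rewrite lt_min d0 divr_gt0 ?subr_gt0.
  - by rewrite ge_min lexx orbT.
  - by move=> c s sI; rewrite lt_min => /andP[H _]; exact: dP.
have [C C0 CP] := chain_bound G.
(* The bound [C + C] is the cost of going to the pole of the block in one step, staying there, and
   leaving it in one step. *)
have /choice[W WP] : forall T, exists W : nat, (0 < W)%N /\
   forall u m n j, path u -> m <= j -> j + W%:Z <= n + 1 -> action g u m n <= C + C ->
   exists c i, [/\ j <= i, i < j + W%:Z & `|u i - pole c| < sg T].
  by move=> T; have [sg0 _ _] := sgP T; exact: (visit_pole G (C + C) sg0).
have /choice[pa paP] : forall T, exists vN : (int -> R) * nat,
    [/\ path vN.1, vN.1 0 = pole (block_pole T), vN.1 vN.2%:Z = pole (block_pole (T + 1)) &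
     action g vN.1 0 vN.2%:Z < transit_cost g a b (block_pole T) + eta T / 2%:R].
  move=> T; have e2 : 0 < eta T / 2%:R by rewrite divr_gt0.
  have [v [N [pv v0 vN vE]]] := transit_cost_adherent G (block_pole T) e2.
  by exists (v, N); rewrite block_pole_next.
(* A block has to hold two windows of length [W T], one at each end; a gap has to hold [L T] on both
   sides and a nearly optimal transition between. *)
pose MT T := (2 * W T + 2 * L T + (pa T).2 + 4)%N.
exists (fun i => (MT (i %/ 2)%Z)%:Z); split; first by move=> i; rewrite /MT; lia.
move=> K KM.
have KMe T : K (2 * T) + (MT T)%:Z <= K (2 * T + 1).
  have E : (2 * T %/ 2)%Z = T by lia.
  by have := KM (2 * T); rewrite /= E lerBrDl.
have KMo T : K (2 * T + 1) + (MT T)%:Z <= K (2 * T + 2).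
  have E : ((2 * T + 1) %/ 2)%Z = T by lia.
  have E2 : 2 * T + 1 + 1 = 2 * T + 2 by lia.
  by have := KM (2 * T + 1); rewrite /= E E2 lerBrDl.
have K_even T : K (2 * T) < K (2 * T + 1) by have := KMe T; rewrite /MT; lia.
have K_odd T : K (2 * T + 1) + (L T)%:Z < K (2 * T + 2) - (L T)%:Z.
  by have := KMo T; rewrite /MT; lia.
have [u0 u0P] := choice (block_constraint_nonempty G al dl0 L_gt0 K_even K_odd).
have [u umin] := constrained_minimal_exists (chain_continuous G)
  (fun n => @block_constraint_compact _ a b al dl K L n) u0P.
have pu := minimizer_path umin.
have uD n T := (umin.1 n).2 T.
have Eblock T : action g u (K (2 * T)) (K (2 * T + 1)) <= C + C.
  have K2 : K (2 * T) + 1 < K (2 * T + 1) by move: (KMe T); rewrite /MT; clear; lia.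
  apply: le_trans (block_replace G dl0 L_gt0 K_even K_odd umin (lexx _) K2 (lexx _)) _.
  by apply: lerD; apply: le_trans (ler_norm _) _; apply: CP => //; exact: (pole_in G).
(* Being close to the other pole as well would make the two distances, each at most a quarter of the
   width, add up to the whole width. *)
have visited T i c : K (2 * T) <= i -> i <= K (2 * T + 1) -> `|u i - pole c| < sg T ->
    `|u i - pole (block_pole T)| < sg T.
  move=> i1 i2 H; have [-> //|nc] := eqVneq (block_pole T) c.
  have [uT _ _] := uD i T; have {}uT := uT (introT andP (conj i1 i2)).
  have E : block_pole T = ~~ c by case: (block_pole T) (c) nc => -[].
  move: uT; rewrite E (pole_dist c (pu i)) => uT.
  have [_ sb _] := sgP T; exfalso.
  by move: H uT sb (dlb T) ab; clear; lra.
have /choice[rl rlP] : forall T, exists r, [/\ K (2 * T) <= r, r < K (2 * T) + (W T)%:Z &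
    `|u r - pole (block_pole T)| < sg T].
  move=> T; have [W0 WT] := WP T.
  have [|c [i [i1 i2 ic]]] := WT u _ _ (K (2 * T)) pu (lexx _) _ (Eblock T).
    by move: (KMe T); rewrite /MT; clear; lia.
  exists i; split => //; apply: visited ic => //.
  by move: (KMe T) i2; rewrite /MT; clear; lia.
have /choice[rr rrP] : forall T, exists r, [/\ K (2 * T + 1) - (W T)%:Z < r, r <= K (2 * T + 1) &
    `|u r - pole (block_pole T)| < sg T].
  move=> T; have [W0 WT] := WP T.
  have [||c [i [i1 i2 ic]]] := WT u _ _ (K (2 * T + 1) - (W T)%:Z + 1) pu _ _ (Eblock T).
  - by move: (KMe T); rewrite /MT; clear; lia.
  - by clear; lia.
  have iK : i <= K (2 * T + 1) by move: i2; clear; lia.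
  exists i; split => //; first by move: i1; clear; lia.
  by apply: visited ic => //; move: (KMe T) i1; rewrite /MT; clear; lia.
(* Resting at the pole between [rl T] and [rr T] is admissible and costs four small steps; an entry
   far from the pole would cost a loop. *)
have inblock T n : rl T <= n -> n <= rr T -> `|u n - pole (block_pole T)| < dl T.
  move=> n1 n2; have [l1 l2 l3] := rlP T; have [r1 r2 r3] := rrP T.
  rewrite ltNge; apply/negP => H.
  have lr : rl T + 1 < rr T by move: l2 r1 (KMe T); rewrite /MT; clear; lia.
  have := block_replace G dl0 L_gt0 K_even K_odd umin l1 lr r2.
  have [k0 kP] := kapP T; have := kP (block_pole T) u _ _ n pu n1 n2 H.
  have [_ _ sP] := sgP T.
  have [A1 A2] := sP _ _ (pu (rl T)) l3; have [B1 B2] := sP _ _ (pu (rr T)) r3.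
  by move: A1 A2 B1 B2 k0 (om1 T); clear; lra.
have transit T : [/\ forall n, K (2 * T + 2) <= n -> n <= rl (T + 1) ->
      `|u n - pole (block_pole (T + 1))| < dl (T + 1),
    forall n, rr T <= n -> n <= K (2 * T + 1) -> `|u n - pole (block_pole T)| < dl T,
    `|u (leave K L T) - pole (block_pole T)| < `|al (block_pole T) - pole (block_pole T)| &
    `|u (arrive K L T) - pole (block_pole (T + 1))| < `|al (block_pole T) - pole (block_pole (T + 1))|].
  have E2 : 2 * (T + 1) = 2 * T + 2 by clear; lia.
  have E3 : 2 * T + 2 + 1 = 2 * T + 3 by clear; lia.
  have [r1 r2 r3] := rrP T; have [l1 l2 l3] := rlP (T + 1).
  have KT := KMe T; have KT1 := KMe (T + 1); have KoT := KMo T.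
  rewrite E2 in l1 l2 KT1; rewrite E3 in KT1.
  pose c := block_pole T; have c' : block_pole (T + 1) = ~~ c := block_pole_next T.
  have [pv v0 vN vE] := paP T.
  pose N := (pa T).2.
  pose lv := leave K L T; pose ar := arrive K L T.
  have lvN : lv + N%:Z <= ar by move: KoT; rewrite /lv /ar /leave /arrive /MT /N; clear; lia.
  (* The nearly optimal transition is moved to start at [leave T]; it is over by [arrive T]. *)
  pose t i := (pa T).1 (i - lv).
  pose v := with_tails t lv (lv + N%:Z) (pole c) (pole (~~ c)).
  have tlv : t lv = pole c by rewrite /t subrr.
  have tN : t (lv + N%:Z) = pole (~~ c).
    by rewrite /t -c' (_ : lv + N%:Z - lv = N%:Z)//; clear; lia.
  have pt : path t by move=> i; exact: pv.
  have pvv : path v := with_tails_path G _ _ _ _ pt.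
  have vl i : i <= lv -> v i = pole (block_pole T).
    rewrite le_eqVlt => /orP[/eqP ->|ilv]; last by rewrite /v /with_tails ilv.
    by rewrite /v with_tails_in// lerDl.
  have vr i : ar <= i -> v i = pole (block_pole (T + 1)).
    move=> /(le_trans lvN); rewrite le_eqVlt => /orP[/eqP <-|ilv].
      by rewrite /v with_tails_in// ?tN ?c'// lerDl.
    rewrite /v /with_tails ilv ifF ?c'//.
    by move: ilv; clear; lia.
  have rrlv : rr T + 1 <= lv by move: r2; rewrite /lv /leave /L; clear; lia.
  have arrl : ar <= rl (T + 1) - 1.
    by move: l1; rewrite /ar /arrive /L; clear; lia.
  have K2r : K (2 * T) <= rr T by move: r1 KT; rewrite /MT; clear; lia.
  have lK3 : rl (T + 1) <= K (2 * T + 3) by move: l2 KT1; rewrite /MT; clear; lia.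
  have := transit_replace dl0 L_gt0 K_even K_odd umin pvv K2r r2 l1 lK3 vl vr.
  have lvlvN : lv <= lv + N%:Z by clear; lia.
  rewrite /v (action_const_tails (pole_diag G c) (pole_diag G (~~ c)) tlv tN rrlv lvlvN
    (le_trans lvN arrl)).
  rewrite /t.
  have -> : action g (fun i => (pa T).1 (i - lv)) lv (lv + N%:Z) = action g (pa T).1 0 N%:Z.
    rewrite (action_shift g (pa T).1 _ _ (- lv)) subrr (_ : lv + N%:Z - lv = N%:Z)//.
    by clear; lia.
  rewrite c' -/c => uE.
  have [_ _ sP] := sgP T; have [_ _ sP1] := sgP (T + 1).
  have [A1 A2] := sP _ _ (pu (rr T)) r3; have [B1 B2] := sP1 _ _ (pu (rl (T + 1))) l3.
  have o3 := om3 (T + 1); rewrite addrK in o3.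
  rewrite c' -/c in A1 A2 B1 B2 l3.
  have rl_rr : rr T <= rl (T + 1) by move: rrlv arrl lvN; clear; lia.
  (* Closed off by poles, the minimizer between two blocks is a transition of excess less than
     [eta T], so the results on tails and on the gap apply to it. *)
  pose U := with_tails u (rr T) (rl (T + 1)) (pole c) (pole (~~ c)).
  have Uu i : rr T <= i -> i <= rl (T + 1) -> U i = u i by exact: with_tails_in.
  have UE : action g U (rr T - 1) (rl (T + 1) + 1) < transit_cost g a b c + eta T.
    rewrite action_with_tails//.
    by move: uE vE A1 A2 B1 B2 (om2 T) o3 (eta0 T); rewrite -/c -/N; clear; lra.
  have pU : path U := with_tails_path G _ _ _ _ pu.
  have Um : U (rr T - 1) = pole c by exact: with_tails_l.
  have Un : U (rl (T + 1) + 1) = pole (~~ c) by exact: with_tails_r.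
  have mn : rr T - 1 <= rl (T + 1) + 1 by move: rl_rr; clear; lia.
  have UeT : action g U (rr T - 1) (rl (T + 1) + 1) <= transit_cost g a b c + (tT T).1.
    by apply: le_trans (ltW UE) _; rewrite lerD2l /eta ge_min lexx.
  have [TA TB] := (tP T).2 c U _ _ pU mn Um Un UeT.
  have lv1 : rr T <= lv by move: rrlv; clear; lia.
  have lv2 : lv <= rl (T + 1) by move: arrl lvN; clear; lia.
  have ar1 : rr T <= ar by move: rrlv lvN; clear; lia.
  have ar2 : ar <= rl (T + 1) by move: arrl; clear; lia.
  have [_ + _] := uD lv T => /(_ erefl); rewrite -/c => ulv.
  have [_ _ +] := uD ar T => /(_ erefl); rewrite c' -/c => uar.
  have alI d : a <= al d <= b by have /andP[/ltW -> /ltW ->] := al_in d.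
  (* This makes the barrier constraints strict: equality at [leave T] or [arrive T] would mean that
     the entry is the barrier value itself. *)
  have al_avoid j : rr T <= j -> j <= rl (T + 1) -> u j <> al c.
    move=> j1 j2 uj; have := (egP c).2 U (rr T - 1) (rl (T + 1) + 1) j pU Um Un.
    rewrite Uu// => /(_ _ _ uj) H.
    have : transit_cost g a b c + eg c <= action g U (rr T - 1) (rl (T + 1) + 1).
      by apply: H; [move: j1|move: j2]; clear; lia.
    rewrite leNgt => /negP; apply; apply: lt_le_trans UE _.
    by rewrite lerD2l /eta ge_min lexx orbT.
  split.
  - move=> n n1 n2.
    have nr : rr T <= n by move: n1 ar1; rewrite /ar /arrive; clear; lia.
    rewrite -(Uu n)//.
    (* At [arrive T] the entry has passed the barrier, so it is at least [d1] away from the starting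
       pole, and [n] comes at least [L T] later. *)
    apply: lt_le_trans (TA ar n _ _ _ _) _.
    + by move: ar1; clear; lia.
    + by move: n1; rewrite /ar /arrive /L; clear; lia.
    + by move: n2; clear; lia.
    + rewrite Uu//; apply: le_trans (d1P c c) _.
      move: uar; rewrite (pole_dist c (pu ar)) (pole_dist c (alI c)).
      by clear; lra.
    + by rewrite ge_min lexx orbT.
  - move=> n n1 n2.
    have nr : n <= rl (T + 1) by move: n2 lv2; rewrite /lv /leave; clear; lia.
    rewrite -(Uu n)//.
    apply: lt_le_trans (TB lv n _ _ _ _) _.
    + by move: n1; clear; lia.
    + by move: n2; rewrite /lv /leave /L; clear; lia.
    + by move: lv2; clear; lia.
    + rewrite Uu// (pole_dist c (pu lv)); apply: le_trans (d1P c (~~ c)) _.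
      rewrite (pole_dist c (alI c)).
      by move: ulv; clear; lra.
    + by rewrite ge_min lexx.
  - rewrite lt_neqAle ulv andbT; apply/eqP => H.
    by apply: (al_avoid lv) => //; exact: (pole_dist_inj (pu lv) (alI c) H).
  - rewrite lt_neqAle uar andbT; apply/eqP => H.
    by apply: (al_avoid ar) => //; exact: (pole_dist_inj (pu ar) (alI c) H).
have block T n : K (2 * T) <= n -> n <= K (2 * T + 1) -> `|u n - pole (block_pole T)| < dl T.
  move=> n1 n2; have [nl|ln] := leP n (rl T).
    have [+ _ _ _] := transit (T - 1).
    by rewrite subrK => /(_ n); apply => //; rewrite (_ : 2 * (T - 1) + 2 = 2 * T)//; lia.
  have [nr|rn] := leP n (rr T); first exact: inblock (ltW ln) nr.
  by have [_ + _ _] := transit T; apply => //; exact: ltW.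
exists u; split=> //.
  move=> T n n1 n2; apply: lt_le_trans (block T n n1 n2) _.
  by rewrite /dl ge_min lexx.
move=> n; apply: (local_minimum L_gt0 K_even K_odd umin).
- by move=> T; exact: block.
- by move=> T ->; case: (transit T).
- by move=> T ->; case: (transit T).
Qed.

End ChainTransitions.

(** * Minimal configurations of a twist map *)

Section Twist.
Context {R : realType} (h : R * R -> R).
Implicit Types (s t : R) (x y z u v : int -> R) (m n i j r : int).
Hypothesis h1 : diagonal_periodic h.
Hypothesis h3 : strict_twist h.
Hypothesis h4 : minimal_triples_cross h.

Lemma diagonal_int s t (k : int) : h (s + k%:~R, t + k%:~R) = h (s, t).
Proof.
have H (n : nat) s' t' : h (s' + n%:R, t' + n%:R) = h (s', t').
  elim: n => [|n IH]; first by rewrite !addr0.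
  by rewrite -natr1 !addrA -h1.
case: k => n; first exact: H.
by rewrite NegzE !mulrNz; have := H n.+1 (s - n.+1%:R) (t - n.+1%:R); rewrite !subrK.
Qed.

Lemma minimal_shift x j : minimal h x -> minimal h (fun i => x (i + j)).
Proof.
move=> mx n m nm n0 n1 y nn0 n01 n1m y0 y1.
rewrite action_shift.
have := mx (n + j) (m + j) _ (n0 + j) (n1 + j) (fun i => y (i - j)).
rewrite (action_shift h y _ _ (- j)) !addrK; apply=> //; by rewrite ?lerD2r ?ltrD2r.
Qed.

Lemma minimal_neighbors x y i : minimal h x -> minimal h y -> x i = y i ->
  0 <= (x (i - 1) - y (i - 1)) * (x (i + 1) - y (i + 1)) ->
  x (i - 1) = y (i - 1) /\ x (i + 1) = y (i + 1).
Proof.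
move=> mx my xyi H; apply: contrapT => ne.
have N z : minimal h z -> minimal_segment h (-1) 1 (fun k => z (k + i)).
  by move=> mz; apply: minimal_shift.
have := h4 (N x mx) (N y my); rewrite /= !add0r => /(_ xyi).
rewrite ![-1 + i]addrC ![1 + i]addrC ltNge H => F.
suff : false by [].
by apply: F => -[e1 _ e2]; apply: ne.
Qed.

Lemma int_spread (P : int -> Prop) i : P i ->
  (forall j, P j -> P (j - 1) /\ P (j + 1)) -> forall j, P j.
Proof.
move=> Pi step.
have R1 (N : nat) : P (i + N%:Z).
  elim: N => [|N IH]; first by rewrite addr0.
  by have [_] := step _ IH; rewrite -addrA (_ : N%:Z + 1 = N.+1)//; lia.
have L1 (N : nat) : P (i - N%:Z).
  elim: N => [|N IH]; first by rewrite subr0.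
  by have [+ _] := step _ IH; rewrite -addrA (_ : - N%:Z - 1 = - N.+1%:Z)//; lia.
move=> j; have [ij|ji] := leP i j.
  by rewrite (_ : j = i + `|j - i|%N%:Z)//; lia.
by rewrite (_ : j = i - `|i - j|%N%:Z)//; lia.
Qed.

(** At a contact the order puts both neighbors on the same side, which [h4] allows only if they
    agree; so the contact spreads. *)
Lemma minimal_touch x y i : minimal h x -> minimal h y ->
  (forall j, x j <= y j) -> x i = y i -> x = y.
Proof.
move=> mx my xy xyi; apply/funext.
apply: (int_spread (P := fun j => x j = y j) xyi) => j xyj.
by apply: minimal_neighbors => //; apply: mulr_le0; rewrite subr_le0.
Qed.

Lemma twist_minmax s t s' t' :
  h (Num.min s s', Num.min t t') + h (Num.max s s', Num.max t t') <=
  h (s, t) + h (s', t').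
Proof.
have [ss|ss] := leP s s'; have [tt|tt] := leP t t'; rewrite //.
- move: ss; rewrite le_eqVlt => /orP[/eqP ->|ss]; first by rewrite addrC.
  exact: ltW (h3 ss tt).
- move: tt; rewrite le_eqVlt => /orP[/eqP ->|tt]; first by rewrite addrC.
  by rewrite [leRHS]addrC; exact: ltW (h3 ss tt).
- by rewrite addrC.
Qed.

Lemma action_minmax x y m n : m <= n ->
  action h (fun i => Num.min (x i) (y i)) m n +
  action h (fun i => Num.max (x i) (y i)) m n <= action h x m n + action h y m n.
Proof.
move=> mn; rewrite /action -!big_split /=; apply: ler_sum => k _.
exact: twist_minmax.
Qed.

Lemma minimal_action x y m n : minimal h x -> m <= n ->
  y m = x m -> y n = x n -> action h x m n <= action h y m n.
Proof.
move=> mx; rewrite le_eqVlt => /orP[/eqP ->|mn]; first by rewrite !action_nn.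
by move=> ym yn; exact: (mx m n mn m n y).
Qed.

(** Cutting off at minimal [u] and [v] does not raise the action, so minimality has to be tested
    only against competitors between them. *)
Definition clamp u v y : int -> R := fun i => Num.max (u i) (Num.min (y i) (v i)).

Lemma clamp_action u v y m n : minimal h u -> minimal h v -> m <= n ->
  u m <= y m <= v m -> u n <= y n <= v n ->
  action h (clamp u v y) m n <= action h y m n.
Proof.
move=> mu mv mn /andP[um vm] /andP[un vn].
pose y' i := Num.min (y i) (v i).
have y'm : y' m = y m by rewrite /y' min_l.
have y'n : y' n = y n by rewrite /y' min_l.
apply: (@le_trans _ _ (action h y' m n)).
  have := action_minmax u y' mn.
  have : action h u m n <= action h (fun i => Num.min (u i) (y' i)) m n.
    by apply: minimal_action => //; rewrite ?y'm ?y'n min_l.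
  by rewrite /clamp /y'; lra.
have := action_minmax y v mn.
have : action h v m n <= action h (fun i => Num.max (y i) (v i)) m n.
  by apply: minimal_action => //; rewrite max_r.
by rewrite /y'; lra.
Qed.

End Twist.

(** * The cost of one period between two periodic minimal configurations *)

Record periodic_pair (R : realType) (h : R * R -> R) (q : nat) (p : int)
    (u v : int -> R) : Prop := {
  pair_continuous_h : continuous h;
  pair_h1 : diagonal_periodic h;
  pair_h3 : strict_twist h;
  pair_h4 : minimal_triples_cross h;
  pair_q : (0 < q)%N;
  pair_minimal_l : minimal h u;
  pair_minimal_r : minimal h v;
  pair_periodic_l : forall i, u (i + q%:Z) = u i + p%:~R;
  pair_periodic_r : forall i, v (i + q%:Z) = v i + p%:~R;
  pair_lt : forall i, u i < v i }.

Section BlockCost.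
Context {R : realType} (h : R * R -> R) (q : nat) (p : int) (u v : int -> R).
Hypothesis H : periodic_pair h q p u v.
Let h_continuous := pair_continuous_h H.
Let h1 := pair_h1 H.
Let q_gt0 := pair_q H.
Let u_periodic := pair_periodic_l H.
Let v_periodic := pair_periodic_r H.
Let uv := pair_lt H.
Implicit Types (s t : R) (x y z : int -> R) (m n i j r : int).

Definition between x := forall i, u i <= x i <= v i.

Notation a := (u 0).
Notation b := (v 0).

Definition shift_block (n : int) x : int -> R := fun i => x (i + n * q%:Z) - (n * p)%:~R.

Lemma periodic_iter x n i : (forall i, x (i + q%:Z) = x i + p%:~R) ->
  x (i + n * q%:Z) = x i + (n * p)%:~R.
Proof.
move=> px; have HN (N : nat) j : x (j + N%:Z * q%:Z) = x j + (N%:Z * p)%:~R.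
  elim: N => [|N IH]; first by rewrite !mul0r !addr0.
  rewrite (_ : j + N.+1%:Z * q%:Z = j + N%:Z * q%:Z + q%:Z); last by rewrite -addn1 PoszD; ring.
  by rewrite px IH -addrA -intrD; congr (_ + _%:~R); rewrite -addn1 PoszD; ring.
case: n => N; first exact: HN.
rewrite NegzE !mulNr mulrNz; apply/eqP; rewrite -subr_eq opprK -HN; apply/eqP.
by congr x; ring.
Qed.

Lemma shift_block_between n x : between x -> between (shift_block n x).
Proof.
move=> xK i; rewrite /shift_block; have := xK (i + n * q%:Z).
by rewrite (periodic_iter n i u_periodic) (periodic_iter n i v_periodic) lerBrDr lerBlDr.
Qed.

Lemma shift_block_action n x m m' :
  action h (shift_block n x) m m' = action h x (m + n * q%:Z) (m' + n * q%:Z).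
Proof.
rewrite -action_shift /action; apply: eq_bigr => k _.
by rewrite /shift_block -mulrNz diagonal_int.
Qed.

Definition base_action := action h u 0 q%:Z.

Definition pinned s t x := [/\ between x, x 0 = s & x q%:Z = t + p%:~R].

Definition squeeze s := Num.max a (Num.min s b).

(* The least action over one period between the given end values, normalized so
   that [u] costs [0]. It is extended continuously to the plane by [squeeze]. *)
Definition block_cost (z : R * R) : R :=
  inf [set action h x 0 q%:Z - base_action | x in
    [set x | pinned (squeeze z.1) (squeeze z.2) x]].

Lemma squeeze_in s : a <= squeeze s <= b.
Proof. by rewrite /squeeze le_max lexx /= ge_max ge_min lexx orbT (ltW (uv 0)). Qed.

Lemma squeeze_id s : a <= s <= b -> squeeze s = s.
Proof. by move=> /andP[sa sb]; rewrite /squeeze (min_idPl sb) (max_idPr sa). Qed.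

Lemma between_compact : compact (between : set {ptws int -> R}).
Proof. exact: box_compact. Qed.

Lemma pinned_nonempty s t : a <= s <= b -> a <= t <= b -> exists x, pinned s t x.
Proof.
move=> sI tI; exists (fun i => if i == 0 then s else if i == q%:Z then t + p%:~R else u i).
have q0 : q%:Z != 0 by lia.
split=> [i||]; rewrite ?eqxx ?(negbTE q0)//.
case: eqP => [->//|_]; case: eqP => [->|_]; last by rewrite lexx ltW.
by rewrite -[q%:Z]add0r u_periodic v_periodic !lerD2r.
Qed.

Lemma block_cost_attained s t : a <= s <= b -> a <= t <= b ->
  exists x, pinned s t x /\ action h x 0 q%:Z - base_action = block_cost (s, t) /\
    forall y, pinned s t y -> block_cost (s, t) <= action h y 0 q%:Z - base_action.
Proof.
move=> sI tI; pose K : set {ptws int -> R} := [set x | pinned s t x].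
have cK : compact K.
  have -> : K = (between : set {ptws int -> R}) `&` ([set x : {ptws int -> R} | x 0 = s] `&`
      [set x : {ptws int -> R} | x q%:Z = t + p%:~R]).
    by apply/seteqP; split => x /=; [by case|by move=> [? [? ?]]].
  apply: compact_closedI; first exact: between_compact.
  by apply: closedI; apply: closed_eqr; try exact: entry_continuous; exact: cst_continuous.
have K0 : K !=set0 by have [x xP] := pinned_nonempty sI tI; exists x.
have [x xK xmin] := compact_EVT_min K0 cK
  (continuous_subspaceT (@action_continuous _ _ 0 q%:Z h_continuous)).
have {}xK : pinned s t x by rewrite inE in xK.
have lb : lbound [set action h x 0 q%:Z - base_action | x in [set x | pinned s t x]]
   (action h x 0 q%:Z - base_action).
  by move=> _ [y yK <-]; rewrite lerD2r; apply: xmin; rewrite inE.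
have E : block_cost (s, t) = action h x 0 q%:Z - base_action.
  rewrite /block_cost /= !squeeze_id//; apply/eqP; rewrite eq_le; apply/andP; split.
    by apply: ge_inf; [exists (action h x 0 q%:Z - base_action)|exists x].
  by apply: lb_le_inf => //; exists (action h x 0 q%:Z - base_action), x.
by exists x; split=> //; split=> // y yK; rewrite E; apply: lb; exists y.
Qed.

Lemma block_cost_le x : between x ->
  block_cost (x 0, x q%:Z - p%:~R) <= action h x 0 q%:Z - base_action.
Proof.
move=> xK; have qI : a <= x q%:Z - p%:~R <= b.
  by have := xK (0 + q%:Z); rewrite u_periodic v_periodic add0r lerBrDr lerBlDr.
have [y [_ [_ ymin]]] := block_cost_attained (xK 0) qI.
by apply: ymin; split => //; rewrite subrK.
Qed.

End BlockCost.

(** * Reduction to a chain *)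

Section Interpolation.
Context {R : realType} (h : R * R -> R) (q : nat) (p : int) (u v : int -> R).
Hypothesis H : periodic_pair h q p u v.
Let h3 := pair_h3 H.
Let q_gt0 := pair_q H.
Let u_periodic := pair_periodic_l H.
Let v_periodic := pair_periodic_r H.
Implicit Types (s t : R) (x y z : int -> R) (m n i j r : int) (N : nat).
Notation a := (u 0).
Notation b := (v 0).
Notation between := (between u v).
Notation g := (block_cost h q p u v).
Notation A0 := (base_action h q u).
Notation pinned := (pinned q p u v).
Notation path := (chain_path a b).

Let qz : 0 < q%:Z. Proof. by move: q_gt0; clear; lia. Qed.

(** Reading every [q]-th entry and removing the drift [p] per period turns [u] and [v] into the
    constant chains at the poles. *)
Definition sample x n : R := x (n * q%:Z) - (n * p)%:~R.

Lemma sample_path x : between x -> path (sample x).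
Proof.
move=> xK n; have := shift_block_between H n xK 0.
by rewrite /shift_block add0r.
Qed.

Lemma block_cost_le_block x n : between x ->
  g (sample x n, sample x (n + 1)) <= action h x (n * q%:Z) ((n + 1) * q%:Z) - A0.
Proof.
move=> xK; have := block_cost_le H (shift_block_between H n xK).
rewrite (shift_block_action H) /shift_block !add0r /sample.
have -> : q%:Z + n * q%:Z = (n + 1) * q%:Z by ring.
have -> : ((n + 1) * p)%:~R = (n * p)%:~R + p%:~R :> R by rewrite mulrDl mul1r intrD.
by rewrite opprD addrA.
Qed.

Lemma mulz_le m n : m <= n -> m * q%:Z <= n * q%:Z.
Proof. by rewrite ler_pM2r. Qed.

Lemma sample_action_le x m N : between x ->
  action g (sample x) m (m + N%:Z) + A0 *+ N <=
  action h x (m * q%:Z) ((m + N%:Z) * q%:Z).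
Proof.
move=> xK; elim: N => [|N IH]; first by rewrite mulr0n !addr0 !action_nn.
have E : m + N.+1%:Z = m + N%:Z + 1 by clear; lia.
rewrite E (@action_cat _ g _ m (m + N%:Z)) ?action1; [|clear; lia|clear; lia].
rewrite (@action_cat _ h _ (m * q%:Z) ((m + N%:Z) * q%:Z));
  [|apply: mulz_le; clear; lia|apply: mulz_le; clear; lia].
rewrite mulrSr; have := block_cost_le_block (m + N%:Z) xK.
by move: IH; lra.
Qed.

Lemma glue_blocks (s : int -> R) (X : int -> int -> R) :
  (forall n, pinned (s n) (s (n + 1)) (X n) /\
     action h (X n) 0 q%:Z - A0 = g (s n, s (n + 1))) ->
  exists x, [/\ between x, (forall n, sample x n = s n),
  (forall m N, action h x (m * q%:Z) ((m + N%:Z) * q%:Z) =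
     action g s m (m + N%:Z) + A0 *+ N) &
  forall n r, 0 <= r -> r <= q%:Z -> x (r + n * q%:Z) = X n r + (n * p)%:~R].
Proof.
move=> Xn.
pose x i := X (i %/ q%:Z)%Z (i %% q%:Z)%Z + ((i %/ q%:Z)%Z * p)%:~R.
have xin n r : 0 <= r -> r < q%:Z -> x (r + n * q%:Z) = X n r + (n * p)%:~R.
  move=> r0 rq; rewrite /x.
  have -> : ((r + n * q%:Z) %/ q%:Z)%Z = n.
    by rewrite (addrC r) divzMDl ?gt_eqF// divz_small ?addr0// r0.
  by rewrite (addrC r) modzMDl modz_small// r0.
(* The formula for [x] switches to the next block at its right end; the two values agree because
   consecutive blocks share the value [s (n + 1)] up to the drift. *)
have xend n : x (q%:Z + n * q%:Z) = X n q%:Z + (n * p)%:~R.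
  have -> : q%:Z + n * q%:Z = 0 + (n + 1) * q%:Z by ring.
  rewrite xin//; have [[_ -> _] _] := Xn (n + 1); have [[_ _ ->] _] := Xn n.
  by rewrite mulrDl mul1r intrD /=; ring.
have xall n r : 0 <= r -> r <= q%:Z -> x (r + n * q%:Z) = X n r + (n * p)%:~R.
  by move=> r0; rewrite le_eqVlt => /orP[/eqP ->|]; [exact: xend|exact: xin].
have xK : between x.
  move=> i; have Ei := divz_eq i q%:Z.
  have r0 := modz_ge0 i (lt0r_neq0 qz); have rq := ltz_pmod i qz.
  rewrite Ei addrC xin// (periodic_iter _ _ u_periodic) (periodic_iter _ _ v_periodic).
  by rewrite !lerD2r; have [[+ _ _] _] := Xn (i %/ q%:Z)%Z; apply.
have xs n : sample x n = s n.
  by rewrite /sample -[n * q%:Z]add0r xin// addrK; have [[_ -> _] _] := Xn n.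
exists x; split=> // m N; elim: N => [|N IH].
  by rewrite mulr0n !addr0 !action_nn.
have E : m + N.+1%:Z = m + N%:Z + 1 by clear; lia.
rewrite E (@action_cat _ g _ m (m + N%:Z)) ?action1; [|clear; lia|clear; lia].
rewrite (@action_cat _ h _ (m * q%:Z) ((m + N%:Z) * q%:Z));
  [|apply: mulz_le; clear; lia|apply: mulz_le; clear; lia].
rewrite IH mulrSr; set n := m + N%:Z.
have -> : action h x (n * q%:Z) ((n + 1) * q%:Z) = action h (X n) 0 q%:Z.
  have -> : (n + 1) * q%:Z = q%:Z + n * q%:Z by ring.
  rewrite -[X in action h x X]add0r -(shift_block_action H).
  apply: action_eq; first exact: ltW.
  by move=> i /andP[i0 iq]; rewrite /shift_block xall// addrK.
by have [_ <-] := Xn n; ring.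
Qed.

Lemma interpolation (s : int -> R) : path s -> exists x, [/\ between x,
  (forall n, sample x n = s n),
  (forall m N, action h x (m * q%:Z) ((m + N%:Z) * q%:Z) =
     action g s m (m + N%:Z) + A0 *+ N) &
  (forall n, s (n + 1) = s n) -> forall i, x (i + q%:Z) = x i + p%:~R].
Proof.
move=> ps.
(* The block is chosen as a function of its two end values, so that a constant chain gets a periodic
   interpolation. Outside the square [u] is a dummy value. *)
have /choice[X XP] : forall z : R * R, exists x, a <= z.1 <= b -> a <= z.2 <= b ->
    pinned z.1 z.2 x /\ action h x 0 q%:Z - A0 = g z.
  move=> [s1 s2] /=; have [s1I|] := pselect (a <= s1 <= b); last by exists u.
  have [s2I|] := pselect (a <= s2 <= b); last by exists u.
  by have [x [xp [xe _]]] := block_cost_attained H s1I s2I; exists x.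
have [x [xK xs xE xX]] := glue_blocks (fun n => XP (s n, s (n + 1)) (ps n) (ps (n + 1))).
exists x; split=> // sc i; have Ei := divz_eq i q%:Z.
have r0 := modz_ge0 i (lt0r_neq0 qz); have rq := ltW (ltz_pmod i qz).
have -> : i + q%:Z = (i %% q%:Z)%Z + ((i %/ q%:Z)%Z + 1) * q%:Z.
  by rewrite {1}Ei; ring.
have xi := xX (i %/ q%:Z)%Z _ r0 rq; rewrite addrC -Ei in xi.
by rewrite xi xX// !sc mulrDl mul1r intrD addrA.
Qed.

(** Take minimizing blocks for the crossed ends [(s, t')] and [(s', t)]. Their minimum and maximum
    are admissible for [(s, t)] and [(s', t')], and the twist condition does not let the total
    action grow. *)
Lemma block_monge : monge_on g a b.
Proof.
move=> s s' t t' sa ss sb ta tt tb.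
have [sI sI'] : a <= s <= b /\ a <= s' <= b.
  by rewrite sa sb (le_trans sa ss) (le_trans ss sb).
have [tI tI'] : a <= t <= b /\ a <= t' <= b.
  by rewrite ta tb (le_trans ta tt) (le_trans tt tb).
have [x [[xK x0 xq] [<- _]]] := block_cost_attained H sI tI'.
have [y [[yK y0 yq] [<- _]]] := block_cost_attained H sI' tI.
have [_ [_ [_ l1]]] := block_cost_attained H sI tI.
have [_ [_ [_ l2]]] := block_cost_attained H sI' tI'.
have := action_minmax h3 x y (ltW qz).
have := l1 (fun i => Num.min (x i) (y i)).
have := l2 (fun i => Num.max (x i) (y i)) => B A.
have {}A := A _; have {}B := B _.
have A' : pinned s t (fun i => Num.min (x i) (y i)).
  split=> [i||]; last 2 first.
  - by rewrite x0 y0 min_l.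
  - by rewrite xq yq min_r// lerD2r.
  by move: (xK i) (yK i) => /andP[? ?] /andP[? ?]; rewrite le_min ge_min; apply/andP; split; apply/andP + apply/orP; auto.
have B' : pinned s' t' (fun i => Num.max (x i) (y i)).
  split=> [i||]; last 2 first.
  - by rewrite x0 y0 max_r.
  - by rewrite xq yq max_l// lerD2r.
  by move: (xK i) (yK i) => /andP[? ?] /andP[? ?]; rewrite le_max ge_max; apply/andP; split; apply/andP + apply/orP; auto.
by move: (A A') (B B'); lra.
Qed.

End Interpolation.

Lemma natmul_bounded_le0 (R : realType) (c C : R) : (forall N : nat, c *+ N <= C) -> c <= 0.
Proof.
move=> H; rewrite leNgt; apply/negP => c0.
have := H (Num.truncn (C / c)).+1; rewrite leNgt => /negP; apply.
by rewrite -mulr_natr mulrC -ltr_pdivrMr// truncnS_gt.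
Qed.

Lemma segment_bounded (R : realType) (f : int -> R) (N : nat) :
  exists B, forall i, 0 <= i -> i <= N%:Z -> `|f i| <= B.
Proof.
exists (\sum_(k < N.+1) `|f k|) => i i0 iN.
have k : (`|i| < N.+1)%N by lia.
rewrite (bigD1 (Ordinal k))//= (_ : Posz `|i| = i); last lia.
by rewrite lerDl sumr_ge0.
Qed.

Section MinimalInterpolation.
Context {R : realType} (h : R * R -> R) (q : nat) (p : int) (u v : int -> R).
Hypothesis H : periodic_pair h q p u v.
Let h_continuous := pair_continuous_h H.
Let h3 := pair_h3 H.
Let q_gt0 := pair_q H.
Let u_minimal := pair_minimal_l H.
Let v_minimal := pair_minimal_r H.
Let u_periodic := pair_periodic_l H.
Let v_periodic := pair_periodic_r H.
Let uv := pair_lt H.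
Implicit Types (s t : R) (x y z : int -> R) (m n i j r : int) (N : nat).
Notation a := (u 0).
Notation b := (v 0).
Notation between := (between u v).
Notation g := (block_cost h q p u v).
Notation A0 := (base_action h q u).
Notation pinned := (pinned q p u v).
Notation sample := (sample q p).

Let ab : a <= b := ltW (uv 0).

(** Changing only the two end values of a minimizing block makes it admissible for the other ends;
    the error is spread as [e / q] over the steps. *)
Lemma block_cost_uniform (e : R) : 0 < e -> exists2 d : R, 0 < d &
  forall s t s' t', a <= s <= b -> a <= t <= b -> a <= s' <= b -> a <= t' <= b ->
  `|s - s'| <= d -> `|t - t'| <= d -> g (s', t') <= g (s, t) + e.
Proof.
move=> e0; have [Bu BuP] := segment_bounded u q; have [Bv BvP] := segment_bounded v q.
pose B := Bu + Bv.
have inB i (t : R) : u i <= t <= v i -> 0 <= i -> i <= q%:Z -> - B <= t <= B.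
  move=> /andP[ux xv] i0 iq; have := BuP i i0 iq; have := BvP i i0 iq.
  have := normr_ge0 (u i); have := normr_ge0 (v i).
  rewrite ler_norml => ? ? /andP[? ?]; rewrite ler_norml => /andP[? ?].
  by rewrite /B; apply/andP; split; lra.
have eq0 : 0 < e / q%:R by rewrite divr_gt0// ltr0n.
have [d d0 dP] := uniform_on_square (- B) B h_continuous eq0.
exists d => // s t s' t' sI tI sI' tI' ss tt.
have [x [[xK x0 xq] [<- _]]] := block_cost_attained H sI tI.
have [_ [_ [_ l1]]] := block_cost_attained H sI' tI'.
pose y i := if i == 0 then s' else if i == q%:Z then t' + p%:~R else x i.
have qn0 : (q%:Z == 0) = false by move: q_gt0; clear; lia.
have yK : between y.
  move=> i; rewrite /y; case: eqP => [->//|_]; case: eqP => [->|_]; last exact: xK.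
  by rewrite -[q%:Z]add0r u_periodic v_periodic !lerD2r.
have yp : pinned s' t' y by split; rewrite /y ?eqxx ?qn0.
apply: le_trans (l1 y yp) _; rewrite addrAC lerD2r.
have yx i : `|x i - y i| <= d.
  rewrite /y; case: eqP => [->|_]; first by rewrite x0.
  case: eqP => [->|_]; last by rewrite subrr normr0 ltW.
  by rewrite xq opprD addrACA subrr addr0.
have -> : e = \sum_(k < `|q%:Z - 0|) (e / q%:R).
  by rewrite sumr_const card_ord subr0 absz_nat -[RHS]mulr_natr divfK// pnatr_eq0 -lt0n.
rewrite /action -big_split /=; apply: ler_sum => -[k kq] _ /=.
rewrite !add0r; have kq' : (k < q)%N by move: kq; clear; lia.
have k1 : k%:Z <= q%:Z by move: kq'; clear; lia.
have k2 : k%:Z + 1 <= q%:Z by move: kq'; clear; lia.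
have k3 : 0 <= k%:Z + 1 by clear; lia.
have := dP _ _ _ _ (inB _ _ (xK k) isT k1) (inB _ _ (xK (k%:Z + 1)) k3 k2)
  (inB _ _ (yK k) isT k1) (inB _ _ (yK (k%:Z + 1)) k3 k2) (yx _) (yx _).
by rewrite ler_norml => /andP[? _]; lra.
Qed.

Lemma squeeze_lipschitz s t : `|squeeze u v s - squeeze u v t| <= `|s - t|.
Proof.
wlog st : s t / s <= t.
  move=> W; have [|/ltW] := leP s t; first exact: W.
  by move=> /W; rewrite distrC (distrC t).
rewrite (ler0_norm (_ : s - t <= 0)) ?subr_le0// ler_norml /squeeze.
have ab' := ab.
by case: (leP s b) => sb; case: (leP t b) => tb; rewrite ?(max_r ab);
  case: (leP a s) => sa; case: (leP a t) => ta; apply/andP; split; lra.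
Qed.

Lemma block_cost_continuous : continuous g.
Proof.
move=> z; apply/cvgrPdist_le => e e0.
have [d d0 dP] := block_cost_uniform e0.
have zd : nbhs z (ball z d) by exact: nbhsx_ballx.
apply: filterS zd => z' [/= zz1 zz2].
have E w : g w = g (squeeze u v w.1, squeeze u v w.2).
  by rewrite /block_cost /= !(squeeze_id (squeeze_in H _)).
have I := squeeze_in H.
have l1 := le_trans (squeeze_lipschitz z.1 z'.1) (ltW zz1).
have l2 := le_trans (squeeze_lipschitz z.2 z'.2) (ltW zz2).
rewrite (E z) (E z') ler_norml.
have := dP _ _ _ _ (I z.1) (I z.2) (I z'.1) (I z'.2) l1 l2.
rewrite distrC in l1; rewrite distrC in l2.
have := dP _ _ _ _ (I z'.1) (I z'.2) (I z.1) (I z.2) l1 l2.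
by move=> ? ?; apply/andP; split; lra.
Qed.

Definition interpolates (s : int -> R) x := [/\ between x,
  (forall n, sample x n = s n) &
  (forall m N, action h x (m * q%:Z) ((m + N%:Z) * q%:Z) =
     action g s m (m + N%:Z) + A0 *+ N)].

(** A competitor is clamped between [u] and [v] and then sampled. Neither raises the normalized
    cost, and for [x] the sampling is exact, so the minimality of the chain decides. *)
Lemma minimal_interpolation (s : int -> R) x : interpolates s x ->
  constrained_minimal g (fun=> [set t | a <= t <= b]) s -> minimal h x.
Proof.
move=> [xK xs xE] [_ smin] n m nm n0 n1 y nn0 n01 n1m y0 y1.
pose N := (`|n0| + `|n1| + 1)%N; pose M := - (N%:Z * q%:Z).
have q1 : 1 <= q%:Z by move: q_gt0; clear; lia.
have NM : N%:Z <= N%:Z * q%:Z by rewrite ler_peMr.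
have Mn0 : M <= n0 by move: NM; rewrite /M /N; clear; lia.
have n1M : n1 <= - M by move: NM; rewrite /M /N; clear; lia.
have n01' := ltW n01.
pose y' := replace x y n0 n1; pose z := clamp u v y'.
have y'out i : ~~ (n0 < i < n1) -> y' i = x i by exact: replace_out.
have zK : between z by move=> i; rewrite /z /clamp le_max lexx /= ge_max ge_min lexx orbT (ltW (uv i)).
have zout i : ~~ (n0 < i < n1) -> z i = x i.
  move=> /y'out E; rewrite /z /clamp E; case/andP: (xK i) => ux xv.
  by rewrite (min_idPl xv) (max_idPr ux).
have y'y : action h y' n0 n1 = action h y n0 n1.
  apply: action_eq => // i; rewrite le_eqVlt => /andP[/orP[/eqP <- _|n0i]].
    by rewrite y'out ?ltxx.
  rewrite le_eqVlt => /orP[/eqP ->|in1]; first by rewrite y'out ?ltxx ?andbF.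
  by rewrite /y' /replace n0i in1.
rewrite -y'y; apply: (@le_trans _ _ (action h z n0 n1)); last first.
  apply: (clamp_action h3) => //; rewrite y'out ?ltxx ?andbF//; exact: xK.
rewrite -subr_ge0 -(@action_local _ h x z n0 n1 M (- M))// subr_ge0.
have EM : M = (- N%:Z) * q%:Z by rewrite /M mulNr.
have EM' : - M = (- N%:Z + (N + N)%N%:Z) * q%:Z by rewrite /M PoszD; ring.
rewrite EM' {1 2}EM xE.
apply: le_trans (sample_action_le H (- N%:Z) (N + N) zK).
rewrite lerD2r; apply: smin; first by clear; lia.
- by move=> i; exact: (sample_path H zK).
- move=> i iN; rewrite -xs /sample; congr (_ - _); apply: zout.
  have [iN'|iN'] : i <= - N%:Z \/ N%:Z <= i by move: iN; clear; lia.
    have := mulz_le H iN'; rewrite mulNr -/M => le1.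
    by move: (le_trans le1 Mn0); clear; lia.
  have := mulz_le H iN' => le1.
  by move: n1M le1; rewrite /M opprK; clear; lia.
Qed.

End MinimalInterpolation.

Section BlockChain.
Context {R : realType} (h : R * R -> R) (q : nat) (p : int) (u v : int -> R).
Hypothesis H : periodic_pair h q p u v.
Let h4 := pair_h4 H.
Let u_minimal := pair_minimal_l H.
Let v_minimal := pair_minimal_r H.
Let u_periodic := pair_periodic_l H.
Let v_periodic := pair_periodic_r H.
Let uv := pair_lt H.
Implicit Types (s t : R) (x y z : int -> R) (m n i j r : int) (N : nat).
Notation a := (u 0).
Notation b := (v 0).
Notation between := (between u v).
Notation g := (block_cost h q p u v).
Notation A0 := (base_action h q u).
Notation path := (chain_path a b).
Notation sample := (sample q p).

Let ab : a <= b := ltW (uv 0).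

Lemma periodic_action x m N : (forall i, x (i + q%:Z) = x i + p%:~R) ->
  action h x (m * q%:Z) ((m + N%:Z) * q%:Z) = action h x 0 q%:Z *+ N.
Proof.
move=> px; elim: N => [|N IH]; first by rewrite mulr0n !addr0 !action_nn.
have E : m + N.+1%:Z = m + N%:Z + 1 by clear; lia.
rewrite E (@action_cat _ h _ (m * q%:Z) ((m + N%:Z) * q%:Z));
  [|apply: (mulz_le H); clear; lia|apply: (mulz_le H); clear; lia].
rewrite IH mulrSr; congr (_ + _); set n := m + N%:Z.
have -> : (n + 1) * q%:Z = q%:Z + n * q%:Z by ring.
rewrite -[X in action h x X]add0r -(shift_block_action H); congr action.
by apply/funext => i; rewrite /shift_block (periodic_iter n i px) addrK.
Qed.

Let uq : u q%:Z = a + p%:~R. Proof. by rewrite -[q%:Z]add0r u_periodic. Qed.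
Let vq : v q%:Z = b + p%:~R. Proof. by rewrite -[q%:Z]add0r v_periodic. Qed.

Lemma between_l : between u. Proof. by move=> i; rewrite lexx ltW. Qed.
Lemma between_r : between v. Proof. by move=> i; rewrite lexx ltW. Qed.

Lemma periodic_sample x n : (forall i, x (i + q%:Z) = x i + p%:~R) -> sample x n = x 0.
Proof. by move=> px; rewrite /sample -[n * q%:Z]add0r (periodic_iter n 0 px) addrK. Qed.

(** The interpolation of the chain is a competitor for [w] over [N] periods. *)
Lemma closed_chain_ge (w : int -> R) (s : int -> R) m N : minimal h w ->
  (forall i, w (i + q%:Z) = w i + p%:~R) -> path s ->
  s m = w 0 -> s (m + N%:Z) = w 0 ->
  action h w 0 q%:Z *+ N <= action g s m (m + N%:Z) + A0 *+ N.
Proof.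
move=> mw pw ps sm sn; have [x [xK xs xE _]] := interpolation H ps.
rewrite -xE -(periodic_action m N pw); apply: minimal_action => //.
- by apply: (mulz_le H); clear; lia.
- by have := xs m; rewrite sm -(periodic_sample m pw) => /addIr.
- by have := xs (m + N%:Z); rewrite sn -(periodic_sample (m + N%:Z) pw) => /addIr.
Qed.

Lemma block_cost_lo : g (a, a) = 0.
Proof.
apply/eqP; rewrite eq_le; apply/andP; split.
  have := block_cost_le H between_l; rewrite uq addrK.
  by rewrite /base_action subrr.
have := @closed_chain_ge u (fun=> a) 0 1 u_minimal u_periodic _ erefl erefl.
rewrite !mulr1n action1 -/(base_action h q u) => K.
have : A0 <= g (a, a) + A0 by apply: K => i; rewrite lexx.
by rewrite lerDr.
Qed.

Lemma action_excursion s t N : g (t, t) = 0 ->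
  action g (with_tails (fun=> t) 0 N%:Z s s) (- 1) (N%:Z + 1) = g (s, t) + g (t, s).
Proof.
move=> gt; rewrite -[- 1]add0r action_with_tails//.
by rewrite (action_const (w := t)) ?addr0.
Qed.

(** Going from [a] to [s], staying there [N] steps and returning costs at least 0. The two jumps
    have a fixed cost, so for large [N] the stay cannot have a negative rate. *)
Lemma block_cost_diag_ge0 s : a <= s <= b -> 0 <= g (s, s).
Proof.
move=> sI; rewrite -oppr_le0.
apply: (@natmul_bounded_le0 _ _ (g (a, s) + g (s, a))) => N.
pose w := with_tails (fun=> s) 0 N%:Z a a.
have pw : path w by move=> i; rewrite /w /with_tails; do 2 (case: ifP => _; rewrite ?lexx ?ab//).
have := @closed_chain_ge u w (- 1) (N + 2) u_minimal u_periodic pw _ _.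
have -> : - 1 + (N + 2)%N%:Z = N%:Z + 1 :> int by clear; lia.
rewrite -/(base_action h q u) lerDr => K.
have : 0 <= action g w (- 1) (N%:Z + 1).
  by apply: K; [exact: (@with_tails_l R _ 0 N%:Z _ _ isT)|exact: with_tails_r].
rewrite /w -[- 1]add0r action_with_tails//.
have -> : action g (fun=> s) 0 N%:Z = g (s, s) *+ N.
  by rewrite /action sumr_const card_ord subr0 absz_nat.
by rewrite (mulNrn (g (s, s))); move: (g (s, s) *+ N) => X /=; lra.
Qed.

(* A long stay at [u] between two visits of [v] shows that [v] cannot have a
   larger action per period. *)
Lemma pair_actions_eq : action h v 0 q%:Z = A0.
Proof.
have vA : 0 <= action h v 0 q%:Z - A0.
  apply: le_trans (block_cost_diag_ge0 (_ : a <= b <= b)) _; first by rewrite ab lexx.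
  have := block_cost_le H between_r.
  by rewrite vq addrK.
apply/eqP; rewrite eq_le -(subr_ge0 A0) vA andbT -subr_le0.
apply: (@natmul_bounded_le0 _ _ (g (b, a) + g (a, b))) => N.
pose w := with_tails (fun=> a) 0 N%:Z b b.
have pw : path w by move=> i; rewrite /w /with_tails; do 2 (case: ifP => _; rewrite ?lexx ?ab//).
have := @closed_chain_ge v w (- 1) (N + 2) v_minimal v_periodic pw _ _.
have -> : - 1 + (N + 2)%N%:Z = N%:Z + 1 :> int by clear; lia.
rewrite /w action_excursion ?block_cost_lo// -lerBlDr -mulrnBl => K.
apply: le_trans (K _ _).
- by rewrite mulrnDr lerDl mulrn_wge0.
- exact: (@with_tails_l R _ 0 N%:Z _ _ isT).
- exact: with_tails_r.
Qed.

Lemma block_cost_hi : g (b, b) = 0.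
Proof.
apply/eqP; rewrite eq_le; apply/andP; split.
  have := block_cost_le H between_r; rewrite vq addrK.
  by rewrite pair_actions_eq subrr.
by apply: block_cost_diag_ge0; rewrite ab lexx.
Qed.

Lemma between_touch x i : between x -> minimal h x -> x i = u i \/ x i = v i ->
  x = u \/ x = v.
Proof.
move=> xK mx [xi|xi]; [left|right].
  by apply/esym; apply: (minimal_touch h4 (i := i)) => // j; have /andP[] := xK j.
by apply: (minimal_touch h4 (i := i)) => // j; have /andP[] := xK j.
Qed.

(** A competitor closed by the same step as [s] is a closed chain, hence costs at least 0, while [s]
    closed in this way costs at most 0. *)
Lemma diag_closed_chain (s : int -> R) : path s ->
  (forall m n, m <= n -> action g s m n + g (s n, s m) <= 0) ->
  constrained_minimal g (fun=> [set t | a <= t <= b]) s.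
Proof.
move=> ps sE; split => // m n w mn pw ws.
have wm : w m = s m by apply: ws; rewrite ltxx.
have wn : w n = s n by apply: ws; rewrite ltxx andbF.
have := closed_action (block_monge H) pw mn.
have : 0 <= \sum_(k < `|n - m|.+1) g (w (m + k%:Z), w (m + k%:Z)).
  by apply: sumr_ge0 => k _; apply: block_cost_diag_ge0; exact: pw.
by rewrite wm wn; have := sE m n mn; lra.
Qed.

Hypothesis no_periodic_between : ~ exists x, [/\ minimal h x,
  forall i, x (i + q%:Z) = x i + p%:~R & forall i, u i < x i < v i].

(** If the cost vanished, the constant chain [s] would be minimal and its interpolation a periodic
    minimal configuration. Touching [u] or [v] would force equality, so it would lie strictly
    between them. *)
Lemma block_cost_diag_gt0 s : a < s < b -> 0 < g (s, s).
Proof.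
move=> /andP[sa sb]; have sI : a <= s <= b by rewrite !ltW.
rewrite lt_neqAle block_cost_diag_ge0// andbT; apply/eqP => gs; apply: no_periodic_between.
have ps : path (fun=> s) by [].
have [x [xK xs xE xp]] := interpolation H ps.
have mx : minimal h x.
  apply: (@minimal_interpolation _ _ _ _ _ _ H (fun=> s)) => //.
  by apply: diag_closed_chain => // m n mn; rewrite (action_const (w := s)) ?add0r -?gs.
have px := xp (fun=> erefl).
have x0 : x 0 = s by rewrite -(periodic_sample 0 px) xs.
exists x; split=> // i.
have /andP[] := xK i; rewrite !le_eqVlt => /orP[/eqP ui|->]; last first.
  move=> /orP[/eqP vi|->//].
  by have [E|E] := between_touch xK mx (or_intror vi); move: sa sb; rewrite -x0 E ltxx.
by have [E|E] := between_touch xK mx (or_introl (esym ui)); move: sa sb; rewrite -x0 E ltxx.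
Qed.

(* Otherwise the chain a, b, a, b, ... is minimal, and its interpolation is a
   minimal configuration that touches [u] without being equal to it. *)
Lemma block_cost_cross : 0 < g (a, b) + g (b, a).
Proof.
rewrite ltNge; apply/negP => K.
pose s (n : int) := if (2 %| n)%Z then a else b.
have ps : path s by move=> n; rewrite /s; case: ifP => _; rewrite ?lexx ab.
have s1 n : s (n + 1) = if (2 %| n)%Z then b else a.
  by rewrite /s; have [E|E] := boolP (2 %| n)%Z; case: ifPn => //; move: E; clear; lia.
have cl : constrained_minimal g (fun=> [set t | a <= t <= b]) s.
  apply: diag_closed_chain => // m n /int_leP[N ->].
  (* Lengthening the chain by one step before closing it does not raise the closed cost; if the ends
     are at the same pole, this is [K]. *)
  have E n' m' : g (s n', s (n' + 1)) + g (s (n' + 1), s m') <= g (s n', s m').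
    rewrite s1 /s; case: (2 %| n')%Z; case: (2 %| m')%Z;
      rewrite ?block_cost_lo ?block_cost_hi ?addr0 ?add0r//.
    by rewrite addrC.
  elim: N => [|N IH].
    rewrite addr0 action_nn add0r /s; case: ifP => _; by rewrite ?block_cost_lo ?block_cost_hi.
  have E1 : m + N.+1%:Z = m + N%:Z + 1 by clear; lia.
  rewrite E1 (@action_cat _ g _ m (m + N%:Z)) ?action1; [|clear; lia|clear; lia].
  by have := E (m + N%:Z) m; move: IH; lra.
have [x [xK xs xE _]] := interpolation H ps.
have mx : minimal h x by apply: (@minimal_interpolation _ _ _ _ _ _ H s).
have x0 : x 0 = a by have := xs 0; rewrite /sample !mul0r subr0.
have xq : x q%:Z = b + p%:~R by have := xs 1; rewrite /sample !mul1r => /eqP; rewrite subr_eq => /eqP.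
have := uv 0; have [E|E] := between_touch xK mx (or_introl x0).
  have := xq; rewrite E uq => /addIr ->.
  by rewrite ltxx.
by move: x0; rewrite E => ->; rewrite ltxx.
Qed.

Lemma block_chain_cost : chain_cost g a b.
Proof.
split; [exact: uv|exact: (block_cost_continuous H)|exact: (block_monge H)|
  exact: block_cost_lo|exact: block_cost_hi|exact: block_cost_diag_gt0|exact: block_cost_cross].
Qed.

End BlockChain.

(** * From closeness of chains to closeness of configurations *)

Section Closeness.
Context {R : realType} (h : R * R -> R) (q : nat) (p : int) (u v : int -> R).
Hypothesis H : periodic_pair h q p u v.
Let h_continuous := pair_continuous_h H.
Let q_gt0 := pair_q H.
Let u_periodic := pair_periodic_l H.
Let v_periodic := pair_periodic_r H.
Let uv := pair_lt H.
Implicit Types (s t : R) (x y z : int -> R) (m n i j r : int) (N : nat).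
Notation a := (u 0).
Notation b := (v 0).
Notation between := (between u v).
Notation g := (block_cost h q p u v).
Notation A0 := (base_action h q u).
Notation pinned := (pinned q p u v).
Notation path := (chain_path a b).
Notation sample := (sample q p).
Notation interpolates := (interpolates h q p u v).

Let ab : a <= b := ltW (uv 0).
Let qz : 0 < q%:Z. Proof. by move: q_gt0; clear; lia. Qed.

Definition is_bound (w : int -> R) := w = u \/ w = v.

Lemma bound_diag w : is_bound w -> g (w 0, w 0) = 0.
Proof. by case=> ->; [exact: (block_cost_lo H)|exact: (block_cost_hi H)]. Qed.

Lemma bound_periodic w : is_bound w -> forall i, w (i + q%:Z) = w i + p%:~R.
Proof. by case=> ->. Qed.

Lemma bound_in w : is_bound w -> a <= w 0 <= b.
Proof. by case=> ->; rewrite lexx ab. Qed.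

Lemma between_touch_bound w x : is_bound w -> between x -> minimal h x ->
  x 0 = w 0 -> x = w.
Proof.
move=> [->|->] xK mx xw.
  by have [|E] := between_touch H xK mx (or_introl xw) => //; have := uv 0; rewrite -xw E ltxx.
by have [E|] := between_touch H xK mx (or_intror xw) => //; have := uv 0; rewrite -xw E ltxx.
Qed.

(* In the limit, a minimizing block pinned at [w] extends periodically to a
   minimal configuration touching [w], which must be [w]. *)
Lemma block_close w (e : R) : is_bound w -> 0 < e -> exists2 d : R, 0 < d &
  forall x, between x -> action h x 0 q%:Z - A0 = g (x 0, x q%:Z - p%:~R) ->
    `|x 0 - w 0| <= d -> `|x q%:Z - p%:~R - w 0| <= d ->
    forall i, 0 <= i -> i <= q%:Z -> `|x i - w i| <= e.
Proof.
move=> bw e0; apply: contrapT => nd.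
pose dist x := \sum_(k < q.+1) `|x k%:Z - w k%:Z|.
have le_dist x i : 0 <= i -> i <= q%:Z -> `|x i - w i| <= dist x.
  move=> i0 iq; have ki : (`|i| < q.+1)%N by move: i0 iq; clear; lia.
  have E : Posz `|i| = i by move: i0; clear; lia.
  by rewrite /dist (bigD1 (Ordinal ki))//= E lerDl sumr_ge0.
have P (k : nat) : exists x : {ptws int -> R}, between x /\
    [/\ action h x 0 q%:Z - A0 = g (x 0, x q%:Z - p%:~R),
        `|x 0 - w 0| <= k.+1%:R^-1, `|x q%:Z - (p%:~R + w 0)| <= k.+1%:R^-1 & e <= dist x].
  apply: contrapT => nx; apply: nd; exists k.+1%:R^-1; first by rewrite invr_gt0.
  move=> x xK xE x0 xq i i0 iq; rewrite leNgt; apply/negP => ei; apply: nx.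
  exists x; split=> //; split=> //; first by rewrite opprD addrA.
  exact: le_trans (ltW ei) (le_dist x i i0 iq).
have [x_ xP] := choice P.
have [y [yK ycl]] := compact_seq_cluster (@between_compact _ u v) (fun k => (xP k).1).
have near (i : int) (c : R) : (forall k, `|x_ k i - c| <= k.+1%:R^-1) -> y i = c.
  move=> Hk; apply/eqP; rewrite -subr_eq0 -normr_le0; apply/ler_addgt0Pr => r r0.
  rewrite add0r; apply: (ycl [set x : {ptws int -> R} | `|x i - c| <= r]).
    exact: near_closed.
  have [k0 k0P] := ge0_inv_eventually r0.
  by exists k0 => k /k0P; apply: le_trans.
have y0 : y 0 = w 0 by apply: near => k; have [_ []] := xP k.
have yq : y q%:Z = w 0 + p%:~R.
  by rewrite addrC; apply: near => k; have [_ []] := xP k.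
have yE : action h y 0 q%:Z - A0 = g (y 0, y q%:Z - p%:~R).
  apply: (ycl [set x : {ptws int -> R} | action h x 0 q%:Z - A0 = g (x 0, x q%:Z - p%:~R)]);
    last by exists 0%N => k _; have [_ []] := xP k.
  apply: closed_eqr.
    have cA := @action_continuous _ h 0 q%:Z h_continuous.
    by move=> x; exact: (cvgB (cA x) (@cvg_cst _ A0 _ (nbhs x) _)).
  apply: pair_continuous; [exact: (block_cost_continuous H)|exact: entry_continuous|].
  have cq := @entry_continuous R q%:Z.
  by move=> x; exact: (cvgB (cq x) (@cvg_cst _ (p%:~R : R) _ (nbhs x) _)).
have ey : e <= dist y.
  apply: (ycl [set x : {ptws int -> R} | e <= dist x]);
    last by exists 0%N => k _; have [_ []] := xP k.
  apply: closed_ler; first exact: cst_continuous.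
  apply: (sum_continuous (F := fun k (x : {ptws int -> R}) => `|x k%:Z - w k%:Z|)) => k.
  have ck := @entry_continuous R k%:Z.
  by move=> x; exact: (cvg_norm (cvgB (ck x) (@cvg_cst _ (w k%:Z) _ (nbhs x) _))).
have yg : action h y 0 q%:Z - A0 = g (w 0, w 0) by rewrite yE y0 yq addrK.
have ypin : pinned (w 0) (w 0) y by [].
have [x [xK xs xE xX]] := glue_blocks H (s := fun=> w 0) (fun=> conj ypin yg).
have pw : path (fun=> w 0) by move=> ?; exact: bound_in.
have mx : minimal h x.
  apply: (@minimal_interpolation _ _ _ _ _ _ H (fun=> w 0)) => //.
  by apply: (diag_closed_chain H) => // m n mn;
    rewrite (action_const (w := w 0)) ?add0r ?bound_diag.
have xw : x = w.
  apply: between_touch_bound => //.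
  by have := xX 0 0 (lexx _) (ltW qz); rewrite !mul0r !addr0 y0.
have yw i : 0 <= i -> i <= q%:Z -> y i = w i.
  by move=> i0 iq; have := xX 0 i i0 iq; rewrite !mul0r !addr0 xw => ->.
have : dist y = 0.
  rewrite /dist big1// => k _; rewrite yw ?subrr ?normr0//.
  by have := ltn_ord k; clear; lia.
by move=> dy; move: ey; rewrite dy leNgt e0.
Qed.

Lemma interpolates_block (s : int -> R) x n : interpolates s x ->
  action h x (n * q%:Z) ((n + 1) * q%:Z) - A0 = g (s n, s (n + 1)).
Proof.
move=> [_ _ xE]; have := xE n 1; rewrite -[1%N%:Z]/(1 : int) => ->.
by rewrite action1 mulr1n addrK.
Qed.

Lemma interpolates_close w (e : R) : is_bound w -> 0 < e -> exists2 d : R, 0 < d &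
  forall (s : int -> R) x n, interpolates s x -> `|s n - w 0| <= d -> `|s (n + 1) - w 0| <= d ->
    forall i, n * q%:Z <= i -> i <= (n + 1) * q%:Z -> `|x i - w i| <= e.
Proof.
move=> bw e0; have [d d0 dP] := block_close bw e0.
exists d => // s x n sx sn sn1 i in1 in2; have [xK xs xE] := sx.
pose y := shift_block q p n x.
have y0 : y 0 = s n by rewrite -xs /y /shift_block add0r.
have yq : y q%:Z - p%:~R = s (n + 1).
  rewrite /y /shift_block -xs /sample -addrA -opprD -intrD.
  by congr (x _ - _%:~R); ring.
have := dP y (shift_block_between H n xK); rewrite yq y0.
rewrite (shift_block_action H) add0r => /(_ _ sn sn1 (i - n * q%:Z)).
have -> : q%:Z + n * q%:Z = (n + 1) * q%:Z by ring.
rewrite (interpolates_block n sx) => /(_ erefl).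
rewrite {1}/y /shift_block subrK => K.
have wi : w i = w (i - n * q%:Z) + (n * p)%:~R.
  by rewrite -(periodic_iter n _ (bound_periodic bw)) subrK.
rewrite wi opprD addrA addrAC; apply: K.
- by rewrite subr_ge0.
- by move: in2; rewrite mulrDl mul1r; clear; lia.
Qed.

Lemma block_of i : exists n, n * q%:Z <= i /\ i < (n + 1) * q%:Z.
Proof.
exists (i %/ q%:Z)%Z; have Ei := divz_eq i q%:Z.
have r0 := modz_ge0 i (lt0r_neq0 qz); have rq := ltz_pmod i qz.
by rewrite mulrDl mul1r; move: Ei r0 rq; clear; lia.
Qed.

Definition bound (c : bool) := if c then v else u.

Lemma bound_is c : is_bound (bound c).
Proof. by case: c; [right|left]. Qed.

Lemma pole_bound c : pole a b c = bound c 0.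
Proof. by case: c. Qed.

Lemma heteroclinic_interpolation (c : bool) (s : int -> R) x : interpolates s x -> chain_heteroclinic g a b c s ->
  [/\ minimal h x, x 0 = s 0 & forall e : R, 0 < e -> exists L : nat, forall i,
    (L%:Z <= i -> `|x i - bound (~~ c) i| <= e) /\ (i <= - L%:Z -> `|x i - bound c i| <= e)].
Proof.
move=> sx [smin stail]; have [xK xs xE] := sx; split.
- exact: (minimal_interpolation H sx smin).
- by have := xs 0; rewrite /sample !mul0r subr0.
move=> e e0.
have [d1 d10 d1P] := interpolates_close (bound_is (~~ c)) e0.
have [d2 d20 d2P] := interpolates_close (bound_is c) e0.
have [L1 L1P] := stail _ d10; have [L2 L2P] := stail _ d20.
(* [L1] and [L2] count periods; one more period is needed because [i] may lie anywhere in its block,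
   both ends of which must be in the tail. *)
exists ((L1 + L2 + 1) * q)%N => i; have [n [n1 n2]] := block_of i.
have q1 : 1 <= q%:Z by move: q_gt0; clear; lia.
split=> iL.
- have Ln : L1%:Z <= n.
    rewrite leNgt; apply/negP => nL.
    have := mulz_le H (_ : n + 1 <= L1%:Z + L2%:Z + 1).
    move=> /(_ ltac:(move: nL; clear; lia)).
    by move: iL n2; rewrite PoszM !PoszD; clear; lia.
  apply: (d1P s x n sx _ _ i n1 (ltW n2)); rewrite -pole_bound.
    by have [+ _] := L1P n; apply.
  by have [+ _] := L1P (n + 1); apply; move: Ln; clear; lia.
- have Ln : n + 1 <= - L2%:Z.
    rewrite leNgt; apply/negP => nL.
    have := mulz_le H (_ : - (L1%:Z + L2%:Z + 1) + 1 <= n).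
    move=> /(_ ltac:(move: nL; clear; lia)).
    have -> : (- (L1%:Z + L2%:Z + 1) + 1) * q%:Z = - ((L1%:Z + L2%:Z + 1) * q%:Z) + q%:Z by ring.
    by move: iL n1 q1; rewrite PoszM !PoszD; clear; lia.
  apply: (d2P s x n sx _ _ i n1 (ltW n2)); rewrite -pole_bound.
    by have [_] := L2P n; apply; move: Ln; clear; lia.
  by have [_] := L2P (n + 1); apply.
Qed.

End Closeness.

(** * Minimal heteroclinics lie in the gap *)

Section Lattice.
Context {R : realType} (h : R * R -> R).
Hypothesis h3 : strict_twist h.
Implicit Types (x y w : int -> R) (m n i j : int) (e : R).

Definition max_conf x y : int -> R := fun i => Num.max (x i) (y i).
Definition min_conf x y : int -> R := fun i => Num.min (x i) (y i).

(* Changing the end values of [max_conf x y] and [min_conf x y] at [m]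
   (resp. [n]) into those of [x] and [y] costs at most [e]. *)
Definition left_good x y e m :=
  h (x m, max_conf x y (m + 1)) <= h (max_conf x y m, max_conf x y (m + 1)) + e /\
  h (y m, min_conf x y (m + 1)) <= h (min_conf x y m, min_conf x y (m + 1)) + e.

Definition right_good x y e n :=
  h (max_conf x y (n - 1), x n) <= h (max_conf x y (n - 1), max_conf x y n) + e /\
  h (min_conf x y (n - 1), y n) <= h (min_conf x y (n - 1), min_conf x y n) + e.

(** On a window with good ends, a competitor of the maximum is inserted into [x] and the minimum
    into [y]. The minimality of [x] and [y] and the twist inequality for minimum and maximum give
    the claim up to four end errors of [e / 4]. *)
Lemma max_minimal x y : minimal h x -> minimal h y ->
  (forall e n, 0 < e -> exists m, m + 1 <= n /\ left_good x y e m) ->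
  (forall e n, 0 < e -> exists m, n <= m - 1 /\ right_good x y e m) ->
  minimal h (max_conf x y).
Proof.
move=> mx my L Rt k l kl n0 n1 Y _ n01 _ Y0 Y1.
set w := max_conf x y; set z := min_conf x y.
pose W := replace w Y n0 n1.
have WY : action h W n0 n1 = action h Y n0 n1.
  apply: action_eq => [|i]; first exact: ltW.
  rewrite /W /replace le_eqVlt => /andP[/orP[/eqP <- _|n0i]]; first by rewrite ltxx.
  by rewrite le_eqVlt => /orP[/eqP ->|in1]; rewrite ?ltxx ?andbF// n0i in1.
rewrite -WY; apply/ler_addgt0Pr => e e0.
have e4 : 0 < e / 4%:R by rewrite divr_gt0.
have [m [mn0 [l1 l2]]] := L _ n0 e4; have [n [nn1 [r1 r2]]] := Rt _ n1 e4.
have mn : m + 1 < n by move: mn0 nn1 n01; clear; lia.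
have mn' : m < n by move: mn; clear; lia.
have Wout i : ~~ (n0 < i < n1) -> W i = w i by exact: replace_out.
have W1 : W m = w m by apply: Wout; move: mn0; clear; lia.
have W2 : W (m + 1) = w (m + 1) by apply: Wout; move: mn0; clear; lia.
have W3 : W (n - 1) = w (n - 1) by apply: Wout; move: nn1; clear; lia.
have W4 : W n = w n by apply: Wout; move: nn1; clear; lia.
have split3 (f : int -> R) : action h f m n =
    h (f m, f (m + 1)) + action h f (m + 1) (n - 1) + h (f (n - 1), f n).
  rewrite action_recl//; rewrite (action_recr h f mn) addrA//.
have A1 : action h x m n <= action h (replace x W m n) m n.
  by apply: minimal_action => //; [exact: ltW|rewrite replace_out// ltxx|
     rewrite replace_out// ltxx andbF].
have A2 : action h y m n <= action h (replace y z m n) m n.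
  by apply: minimal_action => //; [exact: ltW|rewrite replace_out// ltxx|
     rewrite replace_out// ltxx andbF].
have A3 := action_minmax h3 x y (ltW mn').
have n0m : m <= n0 by move: mn0; clear; lia.
have n1n : n1 <= n by move: nn1; clear; lia.
have A4 := @action_local _ h w W n0 n1 m n n0m (ltW n01) n1n Wout.
rewrite !action_replace// in A1 A2.
rewrite -/w -/z in l1 l2 r1 r2 A3.
rewrite W2 W3 in A1.
have := split3 W; rewrite W1 W2 W3 W4 => A5.
have A6 := split3 z.
have {}A3 : action h z m n + action h w m n <= action h x m n + action h y m n := A3.
move: A1 A2 A3 A4 A5 A6 l1 l2 r1 r2; clear; lra.
Qed.

Lemma max_confE x y i : y i <= x i -> max_conf x y i = x i /\ min_conf x y i = y i.
Proof. by move=> yx; rewrite /max_conf /min_conf (max_idPl yx) (min_idPr yx). Qed.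

Lemma left_good_exact x y e m : 0 < e -> y m <= x m -> left_good x y e m.
Proof. by move=> e0 /max_confE[E1 E2]; rewrite /left_good E1 E2 !lerDl ltW. Qed.

Lemma right_good_exact x y e m : 0 < e -> y m <= x m -> right_good x y e m.
Proof. by move=> e0 /max_confE[E1 E2]; rewrite /right_good E1 E2 !lerDl ltW. Qed.

End Lattice.

Section HeteroclinicOrder.
Context {R : realType} (h : R * R -> R) (q : nat) (p : int) (u v : int -> R).
Hypothesis H : periodic_pair h q p u v.
Let h_continuous := pair_continuous_h H.
Let h1 := pair_h1 H.
Let h3 := pair_h3 H.
Let h4 := pair_h4 H.
Let q_gt0 := pair_q H.
Let u_minimal := pair_minimal_l H.
Let v_minimal := pair_minimal_r H.
Let u_periodic := pair_periodic_l H.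
Let v_periodic := pair_periodic_r H.
Let uv := pair_lt H.
Implicit Types (s t : R) (x y z : int -> R) (m n i j r : int) (N : nat).
Notation a := (u 0).
Notation b := (v 0).

Implicit Types (w : int -> R) (e : R).
Notation is_bound := (is_bound u v).

Definition tail_lo x w := forall e, 0 < e -> exists L : nat, forall i,
  i <= - L%:Z -> `|x i - w i| <= e.
Definition tail_hi x w := forall e, 0 < e -> exists L : nat, forall i,
  L%:Z <= i -> `|x i - w i| <= e.

(** Diagonal periodicity moves the steps that start at multiples of [q] back to one compact square
    around [(w 0, w 1)], where [h] is uniformly continuous. *)
Lemma bound_modulus w e : is_bound w -> 0 < e -> exists2 d : R, 0 < d &
  forall n s t s' t',
    `|s - w (n * q%:Z)| <= d -> `|t - w (n * q%:Z + 1)| <= d ->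
    `|s' - w (n * q%:Z)| <= d -> `|t' - w (n * q%:Z + 1)| <= d ->
    h (s, t) <= h (s', t') + e.
Proof.
move=> bw e0; pose B := `|w 0| + `|w 1| + 1.
have [d d0 dP] := uniform_on_square (- B) B h_continuous e0.
exists (Num.min 1 (d / 2%:R)); first by rewrite lt_min ltr01 divr_gt0.
move=> n s t s' t' H1 H2 H3 H4.
have E1 : w (n * q%:Z) = w 0 + (n * p)%:~R.
  by rewrite -(periodic_iter n 0 (bound_periodic H bw)) add0r.
have E2 : w (n * q%:Z + 1) = w 1 + (n * p)%:~R.
  by rewrite -(periodic_iter n 1 (bound_periodic H bw)) addrC.
rewrite E1 in H1 H3; rewrite E2 in H2 H4.
set P := (n * p)%:~R in H1 H2 H3 H4.
have HP (r r' : R) : h (r - P, r' - P) = h (r, r').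
  by rewrite -[RHS](diagonal_int h1 _ _ (- (n * p))) mulrNz.
rewrite -(HP s t) -(HP s' t').
have key (k r : R) : `|k| <= `|w 0| + `|w 1| -> `|r - (k + P)| <= Num.min 1 (d / 2%:R) ->
    (- B <= r - P <= B) /\ (`|r - P - k| <= d / 2%:R).
  move=> k1; rewrite le_min => /andP[H5 H6].
  have E : r - (k + P) = r - P - k by rewrite opprD addrA addrAC.
  rewrite E in H5 H6; split=> //.
  by move: k1 H5; rewrite !ler_norml /B => /andP[? ?] /andP[? ?]; apply/andP; split; lra.
have k0 : `|w 0| <= `|w 0| + `|w 1| by rewrite lerDl.
have k1 : `|w 1| <= `|w 0| + `|w 1| by rewrite lerDr.
have [I1 D1] := key _ _ k0 H1; have [I2 D2] := key _ _ k1 H2.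
have [I3 D3] := key _ _ k0 H3; have [I4 D4] := key _ _ k1 H4.
have close (k r r' : R) : `|r - k| <= d / 2%:R -> `|r' - k| <= d / 2%:R -> `|r - r'| <= d.
  by move=> D D'; rewrite (splitr d); apply: le_trans (ler_distD k _ _) _;
    apply: lerD => //; rewrite distrC.
have := dP _ _ _ _ I1 I2 I3 I4 (close _ _ _ D1 D3) (close _ _ _ D2 D4).
by rewrite ler_norml lerBlDl => /andP[].
Qed.

Lemma minmax_close (s t d : R) : `|s - t| <= d ->
  [/\ `|t - t| <= d, `|Num.max s t - t| <= d & `|Num.min s t - t| <= d].
Proof.
move=> H1; have d0 : 0 <= d := le_trans (normr_ge0 _) H1.
by case: (leP s t) => _; split; rewrite ?subrr ?normr0.
Qed.

Lemma max_confC x y : max_conf x y = max_conf y x.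
Proof. by apply/funext => i; rewrite /max_conf maxC. Qed.

Lemma min_confC x y : min_conf x y = min_conf y x.
Proof. by apply/funext => i; rewrite /min_conf minC. Qed.

Lemma left_good_tail x w e n : is_bound w -> tail_lo x w -> 0 < e ->
  exists m, m + 1 <= n /\ (left_good h x w e m /\ left_good h w x e m).
Proof.
move=> bw tx e0; have [d d0 dP] := bound_modulus bw e0.
have [L LP] := tx d d0; pose N := (L + `|n| + 1)%N.
have q1 : 1 <= q%:Z by move: q_gt0; clear; lia.
have NM : N%:Z <= N%:Z * q%:Z by rewrite ler_peMr.
exists (- N%:Z * q%:Z).
have mn : - N%:Z * q%:Z + 1 <= n by rewrite mulNr; move: NM; rewrite /N; clear; lia.
have m0 : - N%:Z * q%:Z <= - L%:Z by rewrite mulNr; move: NM; rewrite /N; clear; lia.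
have m1 : - N%:Z * q%:Z + 1 <= - L%:Z by rewrite mulNr; move: NM; rewrite /N; clear; lia.
split=> //.
have X0 := LP _ m0; have X1 := LP _ m1.
have [Y0 Z0 W0] := minmax_close X0; have [Y1 Z1 W1] := minmax_close X1.
rewrite /left_good (max_confC w) (min_confC w).
by split; split; apply: (dP (- N%:Z)).
Qed.

Lemma right_good_tail x w e n : is_bound w -> tail_hi x w -> 0 < e ->
  exists m, n <= m - 1 /\ (right_good h x w e m /\ right_good h w x e m).
Proof.
move=> bw tx e0; have [d d0 dP] := bound_modulus bw e0.
have [L LP] := tx d d0; pose N := (L + `|n| + 1)%N.
have q1 : 1 <= q%:Z by move: q_gt0; clear; lia.
have NM : N%:Z <= N%:Z * q%:Z by rewrite ler_peMr.
exists (N%:Z * q%:Z + 1); rewrite addrK.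
have mn : n <= N%:Z * q%:Z by move: NM; rewrite /N; clear; lia.
have m0 : L%:Z <= N%:Z * q%:Z by move: NM; rewrite /N; clear; lia.
have m1 : L%:Z <= N%:Z * q%:Z + 1 by move: NM; rewrite /N; clear; lia.
split=> //.
have X0 := LP _ m0; have X1 := LP _ m1.
have [Y0 Z0 W0] := minmax_close X0; have [Y1 Z1 W1] := minmax_close X1.
rewrite /right_good (max_confC w) (min_confC w) addrK.
by split; split; apply: (dP N%:Z).
Qed.

Lemma between_width n : v (n * q%:Z) - u (n * q%:Z) = b - a.
Proof.
rewrite -[n * q%:Z]add0r (periodic_iter n 0 u_periodic) (periodic_iter n 0 v_periodic).
by rewrite opprD addrACA subrr addr0.
Qed.

Lemma far_multiple (L : nat) n : exists N : nat,
  L%:Z <= N%:Z * q%:Z /\ `|n|%N%:Z + 1 <= N%:Z * q%:Z.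
Proof.
exists (L + `|n| + 1)%N; have q1 : 1 <= q%:Z by move: q_gt0; clear; lia.
have := ler_peMr (isT : 0 <= (L + `|n| + 1)%N%:Z) q1.
by clear; lia.
Qed.

(** At multiples of [q] the bounds are exactly [b - a] apart, so being within half of that of one
    bound means being on the inner side of the other. *)
Lemma tail_lo_side x n : (tail_lo x u -> exists m, m + 1 <= n /\ x m < v m) /\
  (tail_lo x v -> exists m, m + 1 <= n /\ u m < x m).
Proof.
have d0 : 0 < (b - a) / 2%:R by rewrite divr_gt0 ?subr_gt0.
split=> /(_ _ d0)[L LP]; have [N [NL Nn]] := far_multiple L n;
  have W := between_width (- N%:Z);
  have m1 : - N%:Z * q%:Z <= - L%:Z by [rewrite mulNr lerN2];
  have m2 : - N%:Z * q%:Z + 1 <= n by [rewrite mulNr; move: Nn; clear; lia];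
  exists (- N%:Z * q%:Z); (split; first exact: m2);
  by have := LP _ m1; rewrite ler_norml => /andP[? ?]; lra.
Qed.

Lemma tail_hi_side x n : (tail_hi x u -> exists m, n <= m - 1 /\ x m < v m) /\
  (tail_hi x v -> exists m, n <= m - 1 /\ u m < x m).
Proof.
have d0 : 0 < (b - a) / 2%:R by rewrite divr_gt0 ?subr_gt0.
split=> /(_ _ d0)[L LP]; have [N [NL Nn]] := far_multiple L n;
  have W := between_width N%:Z;
  have m2 : n <= N%:Z * q%:Z - 1 by [move: Nn; clear; lia];
  exists (N%:Z * q%:Z); (split; first exact: m2);
  by have := LP _ NL; rewrite ler_norml => /andP[? ?]; lra.
Qed.

Lemma above_of_max x w i0 : minimal h w -> minimal h (max_conf x w) -> w i0 < x i0 ->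
  forall i, w i < x i.
Proof.
move=> mw mm wx i; rewrite ltNge; apply/negP => xi.
have E : w = max_conf x w.
  apply: (minimal_touch h4 (i := i)) => // [j|].
    by rewrite /max_conf le_max lexx orbT.
  by rewrite /max_conf (max_idPr xi).
have E0 : x i0 <= w i0 by rewrite E /max_conf le_max lexx.
by move: wx; rewrite ltNge E0.
Qed.

(** An entry above [w] would by [above_of_max] put all entries above it, against the one at [i0];
    contact is then excluded by [minimal_touch]. *)
Lemma below_of_max x w i0 : minimal h w -> minimal h x -> minimal h (max_conf w x) ->
  x i0 < w i0 -> forall i, x i < w i.
Proof.
move=> mw mx mm xw i; have xw' j : x j <= w j.
  rewrite leNgt; apply/negP => wxj.
  have := @above_of_max x w j mw _ wxj i0.
  by rewrite max_confC => /(_ mm); rewrite ltNge ltW.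
rewrite lt_neqAle xw' andbT; apply/eqP => E.
have Exw := minimal_touch h4 mx mw xw' E.
by move: xw; rewrite Exw ltxx.
Qed.

(** With respect to a given bound, one tail of [x] is asymptotic to it and has good ends up to [e];
    the other lies on the correct side and has exactly good ends. So the maximum with the bound is
    minimal, and the order follows from the absence of contacts. *)
Lemma heteroclinic_between x : minimal h x ->
  (tail_lo x u /\ tail_hi x v) \/ (tail_lo x v /\ tail_hi x u) ->
  forall i, u i < x i < v i.
Proof.
have bu : is_bound u by left. have bv : is_bound v by right.
move=> mx [[lo hi]|[lo hi]] i; apply/andP; split.
- have [m0 [_ s0]] := (tail_hi_side x 0).2 hi.
  apply: (above_of_max _ _ s0) => //; apply: (max_minimal h3) => // e n e0.
    by have [m [mn [+ _]]] := left_good_tail n bu lo e0; exists m.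
  have [m [mn sm]] := (tail_hi_side x n).2 hi; exists m; split=> //.
  by apply: right_good_exact => //; exact: ltW.
- have [m0 [_ s0]] := (tail_lo_side x 0).1 lo.
  apply: (below_of_max _ _ _ s0) => //; apply: (max_minimal h3) => // e n e0.
    have [m [mn sm]] := (tail_lo_side x n).1 lo; exists m; split=> //.
    by apply: left_good_exact => //; exact: ltW.
  by have [m [mn [_ +]]] := right_good_tail n bv hi e0; exists m.
- have [m0 [_ s0]] := (tail_lo_side x 0).2 lo.
  apply: (above_of_max _ _ s0) => //; apply: (max_minimal h3) => // e n e0.
    have [m [mn sm]] := (tail_lo_side x n).2 lo; exists m; split=> //.
    by apply: left_good_exact => //; exact: ltW.
  by have [m [mn [+ _]]] := right_good_tail n bu hi e0; exists m.
- have [m0 [_ s0]] := (tail_hi_side x 0).1 hi.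
  apply: (below_of_max _ _ _ s0) => //; apply: (max_minimal h3) => // e n e0.
    by have [m [mn [_ +]]] := left_good_tail n bv lo e0; exists m.
  have [m [mn sm]] := (tail_hi_side x n).1 hi; exists m; split=> //.
  by apply: right_good_exact => //; exact: ltW.
Qed.

End HeteroclinicOrder.

(** * One-sided derivatives and rigidity *)

Section IntegralTwist.
Context {R : realType}.
Local Notation mu := (@lebesgue_measure R).

Lemma Rintegral_le_shift (f g : R -> R) (x y c : R) : x < y ->
  continuous f -> continuous g -> (forall t, x <= t <= y -> f t <= g t + c) ->
  \int[mu]_(t in `[x, y]) f t <= \int[mu]_(t in `[x, y]) g t + c * (y - x).
Proof.
move=> xy cf cg fg.
have int (k : R -> R) : continuous k -> mu.-integrable `[x, y] (EFin \o k).
  move=> ck; apply: continuous_compact_integrable; first exact: segment_compact.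
  exact: continuous_subspaceT.
have mxy : fine (mu `[x, y]%classic) = y - x.
  by rewrite lebesgue_measure_itv /= lte_fin xy -EFinB.
have intc : mu.-integrable `[x, y] (EFin \o (fun=> c)) by apply: int; exact: cst_continuous.
have intg := int g cg; have intf := int f cf.
rewrite -mxy -(Rintegral_cst mu (measurable_itv `[x, y])) -RintegralD//.
apply: le_Rintegral => //.
  by apply: int => t; exact: (cvgD (cg t) (@cvg_cst _ c _ (nbhs t) _)).
Qed.

Lemma twist_lower_bound (h : R * R -> R) (B : R) : integral_twist h ->
  exists2 c : R, 0 < c & forall x y x' y', - B <= x -> x < y -> y <= B ->
    - B <= x' -> x' < y' -> y' <= B ->
    c * (y - x) * (y' - x') < h (x, y') + h (y, x') - h (x, x') - h (y, y').
Proof.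
move=> [p [cp p0 ph]].
have [B0|B0] := ltP (- B) B; last first.
  exists 1 => // x y x' y' Bx xy yB; exfalso.
  by have := lt_le_trans (le_lt_trans Bx xy) (le_trans yB B0); rewrite ltxx.
pose K : set {ptws int -> R} := [set x | forall i, - B <= x i <= B].
have cK : compact K := @box_compact R (fun=> - B) (fun=> B).
have K0 : K !=set0 by exists (fun=> B) => i /=; rewrite lexx ltW.
have [z zK zmin] := compact_EVT_min K0 cK
  (continuous_subspaceT (@eval2_continuous _ p 0 1 cp)).
pose c := p (z 0, z 1).
have pc s t : - B <= s <= B -> - B <= t <= B -> c <= p (s, t).
  move=> sB tB; have := zmin (fun i : int => if i == 0 then s else t); rewrite /=; apply.
  by rewrite inE => i /=; case: ifP.
exists c; first exact: p0.
move=> x y x' y' Bx xy yB Bx' xy' yB'; apply: le_lt_trans (ph x y x' y' xy xy').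
have cps s : continuous (fun t => p (s, t)).
  by apply: pair_continuous => // t; [exact: cvg_cst|exact: cvg_id].
pose F s := \int[mu]_(t in `[x', y']) p (s, t).
have cst0 : continuous (fun _ : R => 0 : R) by exact: cst_continuous.
have d0 : 0 < y' - x' by rewrite subr_gt0.
(* Continuity makes the inner integral integrable, so that the outer integral can be compared with
   that of a constant. *)
have cF : continuous F.
  move=> s; apply/cvgrPdist_le => e e0.
  pose M := Num.max (Num.max `|x'| `|y'|) (`|s| + 1).
  have [d dd dP] := @uniform_on_square R p (- M) M _ cp (divr_gt0 e0 d0).
  have m0 : 0 < Num.min 1 d by rewrite lt_min ltr01.
  have sball : nbhs s (ball s (Num.min 1 d)) by exact: nbhsx_ballx.
  apply: filterS sball => s' /=; rewrite /ball /= lt_min => /andP[s1 sd].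
  have inM t : x' <= t <= y' -> - M <= t <= M.
    move=> /andP[xt ty]; rewrite -ler_norml /M !le_max.
    have [t0|t0] := leP 0 t.
      by rewrite (ger0_norm t0) (le_trans ty (ler_norm _)) orbT.
    by rewrite (ltr0_norm t0) -[`|x'|]normrN (le_trans _ (ler_norm _)) ?lerN2.
  have sM : - M <= s <= M by rewrite -ler_norml /M le_max lerDl ler01 orbT.
  have s'M : - M <= s' <= M.
    rewrite -ler_norml /M le_max; apply/orP; right.
    by have := ler_distD s' 0 s; have := ler_distD s 0 s'; rewrite !sub0r !normrN; move: s1; lra.
  have close r r' : - M <= r <= M -> - M <= r' <= M -> `|r - r'| <= d -> F r <= F r' + e.
    move=> rM r'M rd; have -> : e = e / (y' - x') * (y' - x') by rewrite divfK// gt_eqF.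
    apply: Rintegral_le_shift => // t tI.
    have := dP _ _ _ _ rM (inM t tI) r'M (inM t tI) rd.
    by rewrite subrr normr0 ler_norml lerBlDl => /(_ (ltW dd))/andP[].
  have := close s s' sM s'M (ltW sd); rewrite distrC in sd.
  have := close s' s s'M sM (ltW sd).
  by rewrite ler_distl lerBlDr => -> ->.
have int0 r r' : \int[mu]_(t in `[r, r']) (fun=> 0 : R) t = 0.
  by rewrite /= (Rintegral_cst mu (measurable_itv `[r, r'])) mul0r.
have Fc s : x <= s <= y -> c * (y' - x') <= F s.
  move=> /andP[xs sy].
  have sB : - B <= s <= B by rewrite (le_trans Bx xs) (le_trans sy yB).
  have := @Rintegral_le_shift (fun=> 0) (fun t => p (s, t)) x' y' (- c) xy' cst0 (cps s).
  rewrite int0 mulNr subr_ge0; apply=> t /andP[xt ty].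
  by rewrite subr_ge0; apply: pc => //; rewrite (le_trans Bx' xt) (le_trans ty yB').
have := @Rintegral_le_shift (fun=> 0) F x y (- (c * (y' - x'))) xy cst0 cF.
rewrite int0 mulNr subr_ge0 => H.
have -> : c * (y - x) * (y' - x') = c * (y' - x') * (y - x) by ring.
by apply: H => s sI; rewrite subr_ge0; exact: Fc.
Qed.

End IntegralTwist.

Section Semiconcave.
Context {R : realType}.
Implicit Types (k f : R -> R) (s t r d theta : R).

Definition semiconcave k theta :=
  convex_function setT ((fun s => theta * s ^+ 2 / 2 - k s) : R^o -> R^o).

Lemma convex_combination (G : R -> R) s t l : convex_function setT (G : R^o -> R^o) ->
  0 <= l -> l <= 1 -> G (l * s + (1 - l) * t) <= l * G s + (1 - l) * G t.
Proof.
move=> cG l0 l1; have := cG (Itv01 l0 l1) s t; rewrite !inE => /(_ I I).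
by rewrite !convRE.
Qed.

Lemma semiconcave_midpoint k theta t r : semiconcave k theta ->
  k (t + r) + k (t - r) <= 2 * k t + theta * r ^+ 2.
Proof.
move=> ck; have h0 : 0 <= 2^-1 :> R by rewrite invr_ge0.
have h1 : 2^-1 <= 1 :> R by rewrite invf_le1// ler1n.
have := convex_combination (t + r) (t - r) ck h0 h1.
have -> : 2^-1 * (t + r) + (1 - 2^-1) * (t - r) = t by field.
by move=> /=; nra.
Qed.

Lemma semiconcave_left_derive k theta t : semiconcave k theta ->
  exists d, is_left_derive k t d.
Proof.
move=> ck; pose G s := theta * s ^+ 2 / 2 - k s.
pose Q s := (G s - G t) / (s - t).
have cG l x y : 0 <= l -> l <= 1 -> G (l * x + (1 - l) * y) <= l * G x + (1 - l) * G y.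
  exact: convex_combination.
have QE s : Q s = (G t - G s) / (t - s).
  by rewrite /Q -(opprB (G t)) -(opprB t s) invrN mulrNN.
have mono x y : x <= y -> y < t -> Q x <= Q y.
  move=> xy yt; have xt := le_lt_trans xy yt.
  pose l := (t - y) / (t - x).
  have tx : 0 < t - x by rewrite subr_gt0.
  have ty : 0 < t - y by rewrite subr_gt0.
  have l0 : 0 <= l by rewrite divr_ge0 ?ltW.
  have l1 : l <= 1 by rewrite ler_pdivrMr// mul1r lerB.
  have := cG l x t l0 l1.
  have -> : l * x + (1 - l) * t = y by rewrite /l; field; rewrite gt_eqF.
  have El : l * (t - x) = t - y by rewrite divfK// gt_eqF.
  move=> Gy; rewrite !QE ler_pdivrMr// mulrAC ler_pdivlMr// -El mulrA ler_pM2r//.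
  by move: Gy; lra.
(* The chord from [t] to [t + 1] bounds the slopes on the left of [t], so the monotone quotients
   converge. *)
have bound x : x < t -> Q x <= G (t + 1) - G t.
  move=> xt; have tx : 0 < t - x by rewrite subr_gt0.
  have tx1 : 0 < t - x + 1 by rewrite addr_gt0.
  pose l := (t - x + 1)^-1.
  have l0 : 0 <= l by rewrite invr_ge0 ltW.
  have l1 : l <= 1 by rewrite invf_le1// lerDr ltW.
  have := cG l x (t + 1) l0 l1.
  have -> : l * x + (1 - l) * (t + 1) = t by rewrite /l; field; rewrite gt_eqF.
  have El : l * (t - x + 1) = 1 by rewrite mulVf// gt_eqF.
  move=> Gt; rewrite QE ler_pdivrMr//.
  have : (t - x + 1) * G t <= (t - x + 1) * (l * G x + (1 - l) * G (t + 1)).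
    by rewrite ler_pM2l.
  have -> : (t - x + 1) * (l * G x + (1 - l) * G (t + 1)) =
    (l * (t - x + 1)) * G x + (t - x + 1 - l * (t - x + 1)) * G (t + 1) by ring.
  by rewrite El; lra.
have /cvg_ex[l Ql] : cvg (Q s @[s --> t^'-]).
  apply: nondecreasing_at_left_is_cvgr.
    near=> x; move=> y z; rewrite !in_itv/= => /andP[_ yt] /andP[_ zt] yz.
    exact: mono.
  near=> x; exists (G (t + 1) - G t) => _ /= [y + <-].
  by rewrite in_itv/= => /andP[_ yt]; exact: bound.
(* [k] is the quadratic term minus the convex [G]; [l] is the left slope of [G]. *)
exists (theta * t - l); rewrite /is_left_derive.
have lin : (theta * (s + t) / 2) @[s --> t^'-] --> theta * t.
  apply: cvg_at_left_filter.
  have -> : theta * t = theta * (t + t) / 2 by field.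
  have ci : (fun s : R => s) @ t --> t by exact: cvg_id.
  have cc (r : R) : (fun _ : R => r) @ t --> r by exact: cvg_cst.
  exact: (cvgM (cvgM (cc theta) (cvgD ci (cc t))) (cc 2^-1)).
apply: cvg_trans (cvgB lin Ql); apply: near_eq_cvg; near=> s.
have st : s < t by [].
transitivity (theta * (s + t) / 2 - Q s); first by [].
rewrite /Q /G; field.
by rewrite subr_eq0 lt_eqF.
Unshelve. all: by end_near. Qed.

End Semiconcave.

Section Stationary.
Context {R : realType}.
Implicit Types (f k : R -> R) (s t r d theta : R).

(** Minimality on the left gives a sum of left derivatives at most 0. Conversely, minimality at
    [t + r] and the midpoint inequalities bound the value at [t - r] by the minimum plus
    [2 * theta * r ^+ 2]: semiconcavity excludes a corner at a minimum. *)
Lemma local_min_left_derive f1 f2 theta t d : semiconcave f1 theta -> semiconcave f2 theta ->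
  0 < d -> (forall s, `|s - t| < d -> f1 t + f2 t <= f1 s + f2 s) ->
  exists d1 d2, [/\ is_left_derive f1 t d1, is_left_derive f2 t d2 & d1 + d2 = 0].
Proof.
move=> c1 c2 d0 fmin.
have [d1 D1] := semiconcave_left_derive t c1.
have [d2 D2] := semiconcave_left_derive t c2.
exists d1, d2; split => //.
have nearb : \forall s \near t^'-, t - d < s /\ s < t.
  near=> s; split; last by [].
  by near: s; apply: nbhs_left_gt; rewrite ltrBlDr ltrDl.
pose Q s := (f1 s - f1 t) / (s - t) + (f2 s - f2 t) / (s - t).
have QD : Q s @[s --> t^'-] --> d1 + d2 by exact: (cvgD D1 D2).
have QE s : Q s = (f1 t + f2 t - (f1 s + f2 s)) / (t - s).
  by rewrite /Q -mulrDl -(opprB t s) invrN mulrN -mulNr; congr (_ / _); ring.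
apply/eqP; rewrite eq_le; apply/andP; split.
  apply: (@cvgr_to_le _ _ _ _ Q) QD _.
  apply: filterS nearb => s [s1 s2]; rewrite QE ler_pdivrMr ?subr_gt0// mul0r subr_le0.
  by apply: fmin; rewrite ltr0_norm ?subr_lt0// opprB ltrBlDr -ltrBlDl.
have lin : (2 * theta * (t - s)) @[s --> t^'-] --> 2 * theta * (t - t).
  apply: cvg_at_left_filter.
  have ci : (fun s : R => s) @ t --> t by exact: cvg_id.
  have cc (r : R) : (fun _ : R => r) @ t --> r by exact: cvg_cst.
  exact: (cvgM (cc (2 * theta)) (cvgB (cc t) ci)).
have Q2 : (Q s + 2 * theta * (t - s)) @[s --> t^'-] --> d1 + d2 + 2 * theta * (t - t).
  exact: (cvgD QD lin).
rewrite subrr mulr0 addr0 in Q2.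
apply: (@cvgr_to_ge _ _ _ _ (fun s => Q s + 2 * theta * (t - s))) Q2 _.
apply: filterS nearb => s [s1 s2]; rewrite QE.
have ts : 0 < t - s by rewrite subr_gt0.
rewrite -(pmulr_lge0 _ ts) mulrDl divfK ?gt_eqF//.
have m1 := semiconcave_midpoint t (t - s) c1.
have m2 := semiconcave_midpoint t (t - s) c2.
have := fmin (t + (t - s)).
rewrite addrAC subrr add0r gtr0_norm// => /(_ _) F.
have {}F : f1 t + f2 t <= f1 (t + (t - s)) + f2 (t + (t - s)) by apply: F; lra.
rewrite (_ : t - (t - s) = s) in m1 m2; last by ring.
by nra.
Unshelve. all: by end_near. Qed.

Lemma linear_le_quadratic (K theta d : R) : 0 < d ->
  (forall r, 0 < r -> r < d -> K * r <= theta * r ^+ 2) -> K <= 0.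
Proof.
move=> d0 Kr; apply/ler_addgt0Pr => e e0; rewrite add0r.
pose r := Num.min (d / 2) (e / (`|theta| + 1)).
have t1 : 0 < `|theta| + 1 by rewrite ltr_pwDr.
have r0 : 0 < r by rewrite lt_min !divr_gt0.
have rd : r < d.
  by rewrite (@le_lt_trans _ _ (d / 2))// ?ge_min ?lexx// ltr_pdivrMr// ltr_pMr// ltr1n.
have re : r * (`|theta| + 1) <= e by rewrite -ler_pdivlMr// ge_min lexx orbT.
have := Kr r r0 rd; rewrite expr2 mulrA ler_pM2r// => /le_trans; apply.
apply: le_trans re; rewrite mulrC ler_pM2l//.
by rewrite (le_trans (ler_norm _))// lerDl.
Qed.

End Stationary.

Section Rigid.
Context {R : realType} (h : R * R -> R).
Hypothesis h5 : integral_twist h.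
Hypothesis h6 : semiconcave_in_each_variable h.
Implicit Types (A C t s r d : R).

(** Minimality is used at the reflected point [t - r], so that the midpoint inequality becomes an
    upper bound at [t + r]. *)
Lemma triple_min_quadratic A C t : 
  (forall s, h (A, t) + h (t, C) <= h (A, s) + h (s, C)) ->
  exists theta : R, forall r, h (A, t + r) + h (t + r, C) <=
    h (A, t) + h (t, C) + theta * r ^+ 2.
Proof.
move=> tmin; have [theta t0 [s1 s2]] := h6; exists (2 * theta) => r.
have m1 := @semiconcave_midpoint _ (fun s => h (A, s)) theta t r (s2 A).
have m2 := @semiconcave_midpoint _ (fun s => h (s, C)) theta t r (s1 C).
by have := tmin (t - r); rewrite /= in m1 m2; lra.
Qed.

Lemma square_bound (l : seq R) : exists B : R, forall z, z \in l -> - B <= z <= B.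
Proof.
elim: l => [|x l [B BP]]; first by exists 0.
exists (`|x| + `|B|) => z; rewrite -ler_norml inE => /predU1P[->|/BP].
  by rewrite lerDl.
by rewrite -ler_norml => /le_trans; apply; rewrite (le_trans (ler_norm _))// lerDr.
Qed.

(** If a neighbor moves up, the twist makes raising the middle entry by [r] cheaper by an amount
    linear in [r], while for the minimal triple raising it costs at most a quadratic amount. Only
    upward variations are assumed, since none other stay between the bounds at a contact. *)
Lemma touch_rigid_lo A C A' C' t d : A <= A' -> C <= C' -> 0 < d ->
  (forall s, h (A, t) + h (t, C) <= h (A, s) + h (s, C)) ->
  (forall s, t <= s -> s - t < d -> h (A', t) + h (t, C') <= h (A', s) + h (s, C')) ->
  A' = A /\ C' = C.
Proof.
move=> AA CC d0 tmin lmin.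
have [B BP] := square_bound [:: A; A'; C; C'; t; t + d].
have [c c0 cP] := twist_lower_bound B h5.
have IB z : z \in [:: A; A'; C; C'; t; t + d] -> - B <= z /\ z <= B.
  by move=> /BP/andP[].
have [[A1 A2] [A3 A4]] : (- B <= A /\ A <= B) /\ (- B <= A' /\ A' <= B).
  by split; apply: IB; rewrite !inE eqxx ?orbT.
have [[C1 C2] [C3 C4]] : (- B <= C /\ C <= B) /\ (- B <= C' /\ C' <= B).
  by split; apply: IB; rewrite !inE eqxx ?orbT.
have [[t1 t2] [t3 t4]] : (- B <= t /\ t <= B) /\ (- B <= t + d /\ t + d <= B).
  by split; apply: IB; rewrite !inE eqxx ?orbT.
have [theta tP] := triple_min_quadratic tmin.
have : c * ((A' - A) + (C' - C)) <= 0.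
  apply: (@linear_le_quadratic _ _ theta d) => // r r0 rd.
  have tr : t < t + r by rewrite ltrDl.
  have trB : t + r <= B by apply: le_trans t4; rewrite lerD2l ltW.
  have eA : c * (A' - A) * r <= h (A, t + r) + h (A', t) - h (A, t) - h (A', t + r).
    move: AA; rewrite le_eqVlt => /orP[/eqP <-|AA]; first by rewrite subrr mulr0 mul0r; lra.
    by have := cP A A' t (t + r) A1 AA A4 t1 tr trB; rewrite [t + r - t]addrAC subrr add0r => /ltW.
  have eC : c * r * (C' - C) <= h (t, C') + h (t + r, C) - h (t, C) - h (t + r, C').
    move: CC; rewrite le_eqVlt => /orP[/eqP <-|CC]; first by rewrite subrr mulr0; lra.
    by have := cP t (t + r) C C' t1 tr trB C1 CC C4; rewrite [t + r - t]addrAC subrr add0r => /ltW.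
  have := lmin (t + r) (ltW tr); rewrite addrAC subrr add0r => /(_ rd).
  by have := tP r; lra.
rewrite pmulr_rle0// => S.
by split; apply/eqP; rewrite eq_le; apply/andP; split; lra.
Qed.

Lemma touch_rigid_hi A C A' C' t d : A' <= A -> C' <= C -> 0 < d ->
  (forall s, h (A, t) + h (t, C) <= h (A, s) + h (s, C)) ->
  (forall s, s <= t -> t - s < d -> h (A', t) + h (t, C') <= h (A', s) + h (s, C')) ->
  A' = A /\ C' = C.
Proof.
move=> AA CC d0 tmin lmin.
have [B BP] := square_bound [:: A; A'; C; C'; t; t - d].
have [c c0 cP] := twist_lower_bound B h5.
have IB z : z \in [:: A; A'; C; C'; t; t - d] -> - B <= z /\ z <= B.
  by move=> /BP/andP[].
have [[A1 A2] [A3 A4]] : (- B <= A /\ A <= B) /\ (- B <= A' /\ A' <= B).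
  by split; apply: IB; rewrite !inE eqxx ?orbT.
have [[C1 C2] [C3 C4]] : (- B <= C /\ C <= B) /\ (- B <= C' /\ C' <= B).
  by split; apply: IB; rewrite !inE eqxx ?orbT.
have [[t1 t2] [t3 t4]] : (- B <= t /\ t <= B) /\ (- B <= t - d /\ t - d <= B).
  by split; apply: IB; rewrite !inE eqxx ?orbT.
have [theta tP] := triple_min_quadratic tmin.
have : c * ((A - A') + (C - C')) <= 0.
  apply: (@linear_le_quadratic _ _ theta d) => // r r0 rd.
  have tr : t - r < t by rewrite ltrBlDr ltrDl.
  have trB : - B <= t - r by apply: le_trans t3 _; rewrite lerD2l lerN2 ltW.
  have E : t - (t - r) = r by ring.
  have eA : c * (A - A') * r <= h (A', t) + h (A, t - r) - h (A', t - r) - h (A, t).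
    move: AA; rewrite le_eqVlt => /orP[/eqP <-|AA]; first by rewrite subrr mulr0 mul0r; lra.
    by have := cP A' A (t - r) t A3 AA A2 trB tr t2; rewrite E => /ltW.
  have eC : c * r * (C - C') <= h (t - r, C) + h (t, C') - h (t - r, C') - h (t, C).
    move: CC; rewrite le_eqVlt => /orP[/eqP <-|CC]; first by rewrite subrr mulr0; lra.
    by have := cP (t - r) t C' C trB tr t2 C3 CC C2; rewrite E => /ltW.
  have := lmin (t - r) (ltW tr); rewrite E => /(_ rd).
  by have := tP (- r); rewrite sqrrN; lra.
rewrite pmulr_rle0// => S.
by split; apply/eqP; rewrite eq_le; apply/andP; split; lra.
Qed.

End Rigid.

(** * From local minima of the chain to stationary configurations *)

Section LocalMinima.
Context {R : realType} (h : R * R -> R) (q : nat) (p : int) (u v : int -> R).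
Hypothesis H : periodic_pair h q p u v.
Let q_gt0 := pair_q H.
Let u_minimal := pair_minimal_l H.
Let v_minimal := pair_minimal_r H.
Let uv := pair_lt H.
Implicit Types (s t : R) (x y z : int -> R) (m n i j r : int) (N : nat).
Notation a := (u 0).
Notation b := (v 0).
Notation between := (between u v).
Notation g := (block_cost h q p u v).
Notation sample := (sample q p).
Notation interpolates := (interpolates h q p u v).

(** Changing one entry of [x] changes at most one sample. The chain cost of the samples bounds the
    new action over two periods from below, with equality for [x]. *)
Lemma interpolates_local_min (s : int -> R) x : interpolates s x ->
  (forall n, exists2 d : R, 0 < d & forall t, a <= t <= b -> `|t - s n| < d ->
    g (s (n - 1), s n) + g (s n, s (n + 1)) <= g (s (n - 1), t) + g (t, s (n + 1))) ->
  forall i, exists2 d : R, 0 < d & forall t, u i <= t <= v i -> `|t - x i| < d ->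
    h (x (i - 1), x i) + h (x i, x (i + 1)) <= h (x (i - 1), t) + h (t, x (i + 1)).
Proof.
move=> [xK xs xE] smin i; have [n [n1 n2]] := block_of H i.
have [d d0 dP] := smin n; exists d => // t tI td.
pose y j := if j == i then t else x j.
have yi : y i = t by rewrite /y eqxx.
have yx j : j != i -> y j = x j by rewrite /y => /negbTE ->.
have yK : between y.
  by move=> j; rewrite /y; case: eqP => [->//|_]; exact: xK.
have q0 : 0 < q%:Z by [].
have m1 : (n - 1) * q%:Z <= i - 1.
  by move: n1 q0; rewrite mulrBl mul1r; clear; lia.
have m2 : i + 1 <= (n + 1) * q%:Z by move: n2; clear; lia.
have s1 : sample y (n - 1) = s (n - 1).
  by rewrite -xs /sample yx//; move: m1; clear; lia.
have s2 : sample y (n + 1) = s (n + 1).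
  by rewrite -xs /sample yx//; move: n2; clear; lia.
have s0 : g (s (n - 1), s n) + g (s n, s (n + 1)) <=
    g (s (n - 1), sample y n) + g (sample y n, s (n + 1)).
  (* Unless [i] is a sampling time, no sample changes and the two sides agree. *)
  have [E|E] := eqVneq (n * q%:Z) i; last first.
    by have -> : sample y n = s n by rewrite -xs /sample yx.
  apply: dP; first exact: (sample_path H yK).
  by rewrite -(xs n) /sample E yi opprD addrACA subrr addr0.
have two (f : int -> R) : action g f (n - 1) (n + 1) = g (f (n - 1), f n) + g (f n, f (n + 1)).
  rewrite (@action_recl _ _ _ (n - 1)); last by clear; lia.
  by rewrite subrK action1.
have En : n - 1 + 2%N%:Z = n + 1 :> int by clear; lia.
have := sample_action_le H (n - 1) 2 yK; rewrite En two s1 s2.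
have := xE (n - 1) 2; rewrite En two => xA yA.
have ii : i - 1 <= i + 1 by clear; lia.
have yout j : ~~ (i - 1 < j < i + 1) -> y j = x j.
  by move=> jP; apply: yx; apply/eqP => Ej; move: jP; rewrite Ej; clear; lia.
have loc := @action_local _ h x y (i - 1) (i + 1) ((n - 1) * q%:Z) ((n + 1) * q%:Z) m1 ii m2 yout.
have three (f : int -> R) : action h f (i - 1) (i + 1) = h (f (i - 1), f i) + h (f i, f (i + 1)).
  rewrite (@action_recl _ _ _ (i - 1)); last by clear; lia.
  by rewrite subrK action1.
have y1 : y (i - 1) = x (i - 1) by apply: yx; clear; lia.
have y2 : y (i + 1) = x (i + 1) by apply: yx; clear; lia.
rewrite !three yi y1 y2 in loc.
by move: xA yA s0 loc; lra.
Qed.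

Lemma minimal_triple w i t : minimal h w ->
  h (w (i - 1), w i) + h (w i, w (i + 1)) <= h (w (i - 1), t) + h (t, w (i + 1)).
Proof.
move=> mw; pose y j := if j == i then t else w j.
have three (f : int -> R) : action h f (i - 1) (i + 1) = h (f (i - 1), f i) + h (f i, f (i + 1)).
  rewrite (@action_recl _ _ _ (i - 1)); last by clear; lia.
  by rewrite subrK action1.
have y1 : y (i - 1) = w (i - 1) by rewrite /y ifF//; clear; lia.
have y2 : y (i + 1) = w (i + 1) by rewrite /y ifF//; clear; lia.
have ii : i - 1 <= i + 1 by clear; lia.
by have := minimal_action mw ii y1 y2; rewrite !three y1 y2 /y eqxx.
Qed.

(** By rigidity a contact with a bound spreads to both neighbors and then to all times, so one entry
    off each bound suffices. *)
Lemma local_min_interior x : integral_twist h -> semiconcave_in_each_variable h ->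
  between x -> (forall i, exists2 d : R, 0 < d & forall t, u i <= t <= v i -> `|t - x i| < d ->
    h (x (i - 1), x i) + h (x i, x (i + 1)) <= h (x (i - 1), t) + h (t, x (i + 1))) ->
  (exists i, u i < x i) -> (exists i, x i < v i) -> forall i, u i < x i < v i.
Proof.
move=> h5 h6 xK xmin [i1 ux] [i2 xv] i; apply/andP; split.
- rewrite lt_neqAle (andP (xK i)).1 andbT; apply/eqP => E.
  suff : u i1 = x i1 by move=> E1; move: ux; rewrite E1 ltxx.
  apply: (int_spread (P := fun j => u j = x j) E) => j Ej.
  have [d d0 dP] := xmin j.
  have [|||||e1 e2] := @touch_rigid_lo _ h h5 h6 (u (j - 1)) (u (j + 1)) (x (j - 1))
     (x (j + 1)) (u j) (Num.min d (v j - u j)).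
  - exact: (andP (xK _)).1.
  - exact: (andP (xK _)).1.
  - by rewrite lt_min d0 subr_gt0 uv.
  - by move=> t; exact: minimal_triple.
  - move=> t jt; rewrite lt_min => /andP[td tv]; rewrite Ej; apply: dP.
      by rewrite jt /= ltW//; move: tv; lra.
    by rewrite -Ej ger0_norm// subr_ge0.
  by split; apply/esym.
- rewrite lt_neqAle (andP (xK i)).2 andbT; apply/eqP => E.
  suff : x i2 = v i2 by move=> E1; move: xv; rewrite E1 ltxx.
  apply: (int_spread (P := fun j => x j = v j) E) => j Ej.
  have [d d0 dP] := xmin j.
  have [|||||e1 e2] := @touch_rigid_hi _ h h5 h6 (v (j - 1)) (v (j + 1)) (x (j - 1))
     (x (j + 1)) (v j) (Num.min d (v j - u j)).
  - exact: (andP (xK _)).2.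
  - exact: (andP (xK _)).2.
  - by rewrite lt_min d0 subr_gt0 uv.
  - by move=> t; exact: minimal_triple.
  - move=> t tj; rewrite lt_min => /andP[td tv]; rewrite -Ej; apply: dP.
      by rewrite tj andbT ltW//; move: tv; lra.
    by rewrite Ej distrC ger0_norm// subr_ge0.
  by [].
Qed.

Lemma local_min_stationary x : semiconcave_in_each_variable h ->
  (forall i, exists2 d : R, 0 < d & forall t, u i <= t <= v i -> `|t - x i| < d ->
    h (x (i - 1), x i) + h (x i, x (i + 1)) <= h (x (i - 1), t) + h (t, x (i + 1))) ->
  (forall i, u i < x i < v i) -> stationary h x.
Proof.
move=> [theta t0 [s1 s2]] xmin xin i; have [d d0 dP] := xmin i.
have /andP[ux xv] := xin i.
pose e := Num.min d (Num.min (x i - u i) (v i - x i)).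
have e0 : 0 < e by rewrite !lt_min d0 !subr_gt0 ux.
apply: (@local_min_left_derive _ (fun t => h (x (i - 1), t)) (fun t => h (t, x (i + 1)))
  theta (x i) e (s2 _) (s1 _) e0) => t.
rewrite !lt_min => /and3P[td tu tv]; apply: dP => //.
move: tu tv; rewrite !ltr_norml => /andP[? ?] /andP[? ?].
by apply/andP; split; lra.
Qed.

Lemma tail_hi_asymptotic x w : tail_hi x w <-> asymptotic_pinfty x w.
Proof.
split=> [T|T].
  apply/cvgrPdist_le => e e0; have [L LP] := T e e0.
  by exists L => // n /= Ln; rewrite sub0r normrN normr_id; apply: LP.
move=> e e0; have /cvgrPdist_le/(_ e e0)[L _ LP] := T.
exists L => -[n|n] // Ln; have := LP n Ln.
by rewrite /= sub0r normrN normr_id.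
Qed.

Lemma tail_lo_asymptotic x w : tail_lo x w <-> asymptotic_ninfty x w.
Proof.
split=> [T|T].
  apply/cvgrPdist_le => e e0; have [L LP] := T e e0.
  by exists L => // n /= Ln; rewrite sub0r normrN normr_id; apply: LP; rewrite lerN2.
move=> e e0; have /cvgrPdist_le/(_ e e0)[L _ LP] := T.
exists L => i iL; have Li : (L <= `|i|)%N by move: iL; clear; lia.
have := LP `|i|%N Li; rewrite /= sub0r normrN normr_id.
by have -> : - `|i|%N%:Z = i by move: iL; clear; lia.
Qed.

Lemma between_rotation x alpha : between x ->
  has_rotation_number u alpha -> has_rotation_number v alpha -> has_rotation_number x alpha.
Proof.
move=> xK [u1 u2] [v1 v2]; split.
- apply: (squeeze_cvgr _ u1 v1); near=> n.
  have n0 : 0 <= n%:R^-1 :> R by rewrite invr_ge0.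
  by have /andP[? ?] := xK n%:Z; apply/andP; split; rewrite ler_wpM2r.
- apply: (squeeze_cvgr _ v2 u2); near=> n.
  have n0 : (- n%:R)^-1 <= 0 :> R by rewrite invrN oppr_le0 invr_ge0.
  by have /andP[? ?] := xK (- n%:Z); apply/andP; split; rewrite ler_wnM2r.
Unshelve. all: by end_near. Qed.

End LocalMinima.

(** * Choice of the barriers, the tolerances and the rounded block times *)

Theorem theorem1p12 (R : realType) (h : R * R -> R)
    (h_continuous : continuous h)
    (h1 : diagonal_periodic h)
    (h2 : uniformly_coercive h)
    (h3 : strict_twist h)
    (h4 : minimal_triples_cross h)
    (h5 : integral_twist h)
    (h6 : semiconcave_in_each_variable h)
    (alpha : rat) (x0 x1 : configuration R)
    (x01 : neighboring_pair (periodic_minimals h alpha) x0 x1)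
    (gap_plus : I_plus h alpha x0 x1 <> `]x0 0, x1 0[%classic)
    (gap_minus : I_minus h alpha x0 x1 <> `]x0 0, x1 0[%classic) :
  forall eps : int -> R, (forall i, 0 < eps i) ->
  exists m : int -> int, (forall i, 0 < m i) /\
  forall k : int -> int, (forall i, m i <= k (i + 1) - k i) ->
  exists x : configuration R,
    [/\ stationary h x,
        (forall i, x0 i < x i < x1 i) &
        forall j : int,
          (forall i, k (4 * j) <= i <= k (4 * j + 1) ->
             `|x i - alternating_pair x0 x1 (2 * j) i| <= eps (2 * j)) /\
          (forall i, k (4 * j + 2) <= i <= k (4 * j + 3) ->
             `|x i - alternating_pair x0 x1 (2 * j + 1) i| <= eps (2 * j + 1))].
Proof.
move=> eps eps0.
have [[[u_min u_rot] u_per] [[v_min v_rot] v_per] uv nobetween] := x01.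
pose q := `|denq alpha|%N; pose p := numq alpha.
have qE : denq alpha = q%:Z by rewrite /q gtz0_abs ?denq_gt0.
have q_gt0 : (0 < q)%N by rewrite -ltz_nat -qE denq_gt0.
rewrite qE -/p in u_per v_per.
have H : periodic_pair h q p x0 x1 by split.
have noper : ~ exists x, [/\ minimal h x, forall i, x (i + q%:Z) = x i + p%:~R &
    forall i, x0 i < x i < x1 i].
  move=> [x [mx px xb]]; apply: nobetween; exists x; split.
  - split; last by rewrite qE.
    split=> //; apply: between_rotation u_rot v_rot => i.
    by have /andP[/ltW -> /ltW ->] := xb i.
  - by move=> i; have /andP[] := xb i.
  - by move=> i; have /andP[] := xb i.
have G := block_chain_cost H noper.
set g := block_cost h q p x0 x1 in G.
have interp s : chain_path (x0 0) (x1 0) s -> exists x, interpolates h q p x0 x1 s x.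
  by move=> ps; have [x [? ? ? _]] := interpolation H ps; exists x.
have plus_in x : heteroclinic_plus h alpha x0 x1 x -> x0 0 < x 0 < x1 0.
  move=> [[mx _] lo hi]; apply: (heteroclinic_between H mx); left.
  by split; [apply/tail_lo_asymptotic|apply/tail_hi_asymptotic].
have minus_in x : heteroclinic_minus h alpha x0 x1 x -> x0 0 < x 0 < x1 0.
  move=> [[mx _] hi lo]; apply: (heteroclinic_between H mx); right.
  by split; [apply/tail_lo_asymptotic|apply/tail_hi_asymptotic].
(* Containment in the open interval turns the inequality of sets into a missing value. *)
have gap (I : set (configuration R)) : (forall x, I x -> x0 0 < x 0 < x1 0) ->
    [set x 0 | x in I] <> `]x0 0, x1 0[%classic ->
    exists2 s, x0 0 < s < x1 0 & forall x, I x -> x 0 <> s.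
  move=> Iin; apply: contra_notP => ns; apply/seteqP; split => [_ [x Ix <-]|s] /=.
    by rewrite in_itv /=; exact: Iin.
  rewrite in_itv /= => sI; apply: contrapT => nI; apply: ns; exists s => // x Ix xs.
  by apply: nI; exists x.
have [sp sp_in spP] := gap _ plus_in gap_plus.
have [sm sm_in smP] := gap _ minus_in gap_minus.
(* The index is the pole where the transition starts: [true] is the way down from [x1], which
   belongs to I^-. *)
pose al (c : bool) := if c then sm else sp.
have al_in c : x0 0 < al c < x1 0 by case: c.
have nohet c s : chain_heteroclinic g (x0 0) (x1 0) c s -> s 0 <> al c.
  move=> hs; have [x sx] := interp s hs.1.1.
  have [mx xs xt] := heteroclinic_interpolation H sx hs.
  have rx : minimals h (ratr alpha) x.
    by split=> //; have [xK _ _] := sx; exact: between_rotation xK u_rot v_rot.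
  rewrite -xs; case: c hs xt => /= _ xt.
    apply: smP; split=> //.
      by apply/tail_hi_asymptotic => e /xt[L LP]; exists L => i; have [+ _] := LP i.
    by apply/tail_lo_asymptotic => e /xt[L LP]; exists L => i; have [_] := LP i.
  apply: spP; split=> //.
    by apply/tail_lo_asymptotic => e /xt[L LP]; exists L => i; have [_] := LP i.
  by apply/tail_hi_asymptotic => e /xt[L LP]; exists L => i; have [+ _] := LP i.
have ab : 0 < x1 0 - x0 0 by rewrite subr_gt0.
have /choice[dl dlP] : forall T, exists d : R, 0 < d /\
    forall (s : int -> R) x n, interpolates h q p x0 x1 s x ->
    `|s n - bound x0 x1 (block_pole T) 0| <= d ->
    `|s (n + 1) - bound x0 x1 (block_pole T) 0| <= d ->
    forall i, n * q%:Z <= i -> i <= (n + 1) * q%:Z ->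
      `|x i - bound x0 x1 (block_pole T) i| <= eps T.
  move=> T; have [d d0 dP] := interpolates_close H (bound_is x0 x1 (block_pole T)) (eps0 T).
  by exists d.
(* The second bound keeps the samples in a block away from the opposite pole, so that [x] is neither
   [x0] nor [x1]. *)
pose delta T := Num.min (dl T) (x1 0 - x0 0).
have delta0 T : 0 < delta T by rewrite lt_min (dlP T).1.
have [M [M0 MP]] := chain_transitions G al_in nohet delta0.
have qz : 0 < q%:Z by rewrite ltz_nat.
(* The chain counts periods, whence the factor [q]; the summand 2 absorbs the rounding of the
   times. *)
exists (fun i => q%:Z * (M i + 2)); split.
  by move=> i; rewrite mulr_gt0// addr_gt0.
move=> k km.
(* Rounding outwards: the block of whole periods contains all times from [k (2 * T)] to
   [k (2 * T + 1)]. *)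
pose K (i : int) := if (2 %| i)%Z then (k i %/ q%:Z)%Z else (k i %/ q%:Z)%Z + 1.
have KE T : K (2 * T) = (k (2 * T) %/ q%:Z)%Z.
  by rewrite /K ifT//; clear; lia.
have KO T : K (2 * T + 1) = (k (2 * T + 1) %/ q%:Z)%Z + 1.
  by rewrite /K ifF//; clear; lia.
have KM i : M i <= K (i + 1) - K i.
  have Mk : (k i %/ q%:Z)%Z + M i + 2 <= (k (i + 1) %/ q%:Z)%Z.
    rewrite lez_divRL// !mulrDl.
    have := lez_floor (k i) (lt0r_neq0 qz); have := km i.
    by move=> ? ?; lia.
  rewrite /K; case: ifP => _; case: ifP => _; move: Mk; clear; lia.
have [s [ps sblock sloc]] := MP K KM.
have [x sx] := interp s ps.
have [xK xs xE] := sx.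
have xmin := interpolates_local_min H sx sloc.
have Kle T : K (2 * T) <= K (2 * T + 1).
  by have := lt_le_trans (M0 (2 * T)) (KM (2 * T)); rewrite subr_gt0 => /ltW.
have sK T : `|s (K (2 * T)) - bound x0 x1 (block_pole T) 0| < x1 0 - x0 0.
  rewrite -pole_bound; apply: lt_le_trans (sblock T _ (lexx _) (Kle T)) _.
  by rewrite /delta ge_min lexx orbT.
have xin : forall i, x0 i < x i < x1 i.
  apply: (local_min_interior H h5 h6 xK xmin).
  (* Block 1 belongs to [x1] and yields an entry above [x0]; block 0 serves for the other bound. *)
  - exists (K (2 * 1) * q%:Z); rewrite -(ltrD2r (- (K (2 * 1) * p)%:~R)).
    have := xs (K (2 * 1)); have := periodic_sample (K (2 * 1)) u_per.
    rewrite /sample => -> ->; have := sK 1; rewrite /= ltr_norml => /andP[+ _].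
    by lra.
  - exists (K (2 * 0) * q%:Z); rewrite -(ltrD2r (- (K (2 * 0) * p)%:~R)).
    have := xs (K (2 * 0)); have := periodic_sample (K (2 * 0)) v_per.
    rewrite /sample => -> ->; have := sK 0; rewrite /= ltr_norml => /andP[_].
    by lra.
exists x; split=> //; first exact: (local_min_stationary h6 xmin xin).
have close T i : k (2 * T) <= i <= k (2 * T + 1) ->
    `|x i - bound x0 x1 (block_pole T) i| <= eps T.
  move=> /andP[ik ki]; have [n [n1 n2]] := block_of H i.
  have nE : n = (i %/ q%:Z)%Z.
    apply/eqP; rewrite eq_le lez_divRL// n1 /= -ltzD1 ltz_divLR//.
  have div_mono y z : y <= z -> (y %/ q%:Z)%Z <= (z %/ q%:Z)%Z.
    by move=> yz; rewrite lez_divRL// (le_trans (lez_floor y (lt0r_neq0 qz))).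
  have nK : K (2 * T) <= n by rewrite KE nE div_mono.
  have Kn : n + 1 <= K (2 * T + 1) by rewrite KO nE lerD2r div_mono.
  have near m : K (2 * T) <= m -> m <= K (2 * T + 1) ->
      `|s m - bound x0 x1 (block_pole T) 0| <= dl T.
    move=> m1 m2; rewrite -pole_bound; apply: le_trans (ltW (sblock T m m1 m2)) _.
    by rewrite /delta ge_min lexx.
  apply: ((dlP T).2 s x n sx _ _ i n1 (ltW n2)); apply: near => //.
  - by apply: le_trans Kn; rewrite lerDl.
  - by apply: le_trans nK _; rewrite lerDl.
move=> j; split=> i ik.
- have := close (2 * j) i; rewrite /alternating_pair /block_pole dvdz_mulr// /=; apply.
  by move: ik; rewrite !mulrA.
- have D : (2 %| 2 * j + 1)%Z = false by clear; lia.
  have := close (2 * j + 1) i; rewrite /alternating_pair /block_pole D /=; apply.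
  have -> : 2 * (2 * j + 1) = 4 * j + 2 by ring.
  by have -> : 4 * j + 2 + 1 = 4 * j + 3 by ring.
Qed.
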